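(* Let $\alpha>0$. Let $\{X_t\}_{t\ge1}$ be a sequence of identically distributed, pairwise asymptotically independent positive random variables and $\{\Theta_t\}_{t\ge1}$ a sequence of positive random variables independent of $\{X_t\}$, such that $X_{(\infty)}=\sum_{t=1}^\infty\Theta_tX_t$ is finite with probability one and has regularly varying tail of index $-\alpha$. Assume that (i) if $0<\alpha<1$, then for some $\epsilon\in(0,\alpha)$, $\sum_{t=1}^\infty\mathrm E[\Theta_t^{\alpha+\epsilon}+\Theta_t^{\alpha-\epsilon}]<\infty$; (ii) if $1\le\alpha<\infty$, then for some $\epsilon\in(0,\alpha)$, $\sum_{t=1}^\infty\big(\mathrm E[\Theta_t^{\alpha+\epsilon}+\Theta_t^{\alpha-\epsilon}]\big)^{1/(\alpha+\epsilon)}<\infty$. If further, for all $\beta\in\mathbb R$, $\sum_{t=1}^\infty\mathrm E[\Theta_t^{\alpha+i\beta}]\ne0$, then $X_1$ has regularly varying tail of index $-\alpha$ and, as $x\to\infty$, $$\mathrm P[X_{(\infty)}>x]\sim\mathrm P[X_1>x]\sum_{t=1}^\infty\mathrm E[\Theta_t^\alpha].$$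
   Context: A random variable $X$ has regularly varying tail of index $-\alpha$ if $\mathrm P[X>x]>0$ for all $x$ and $\lim_{x\to\infty}\mathrm P[X>tx]/\mathrm P[X>x]=t^{-\alpha}$ for all $t>0$. Two identically distributed random variables $X_s,X_t$ (with $\mathrm P[X_t>x]>0$ for all $x$) are asymptotically independent if $\lim_{x\to\infty}\mathrm P[X_s>x,X_t>x]/\mathrm P[X_t>x]=0$. $f\sim g$ means $f/g\to1$. *)

(* Defs.v *)
From HB Require Import structures.
From mathcomp Require Import all_boot all_order all_algebra.
From mathcomp Require Import complex.
From mathcomp Require Import all_classical all_reals all_analysis.

Set Implicit Arguments.
Unset Strict Implicit.
Unset Printing Implicit Defensive.

Import Order.TTheory GRing.Theory Num.Theory.
Import numFieldNormedType.Exports.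

Local Open Scope classical_set_scope.
Local Open Scope ring_scope.

(* Families indexed by t = 1, 2, ... are represented as functions on nat, the
   entry at index t being the one written with subscript t + 1. *)

Section Distributions.
Context (d : measure_display) (T : measurableType d) (R : realType)
  (P : probability T R).

Definition identically_distributed (X : nat -> {RV P >-> R}) : Prop :=
  forall (s t : nat) (A : set R), measurable A ->
    distribution P (X s) A = distribution P (X t) A.

Definition sigma_family (X : nat -> {RV P >-> R}) : set (set T) :=
  <<s \bigcup_t g_sigma_algebra_preimage (X t) >>.

(* The two sequences are independent of each other; nothing is said about the
   dependence inside either of them. *)
Definition independent_families (X Y : nat -> {RV P >-> R}) : Prop :=
  forall A B : set T, sigma_family X A -> sigma_family Y B ->
    (P (A `&` B) = P A * P B)%E.

(* Values lie in the extended reals so that the definition also applies to the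
   sum of a series of random variables. *)
Definition tail (Y : T -> \bar R) (x : R) : R :=
  fine (P [set w | (x%:E < Y w)%E]).

Definition asymptotically_independent (X Y : T -> R) : Prop :=
  (forall x : R, 0 < tail (EFin \o Y) x) /\
  fine (P [set w | x < X w /\ x < Y w]) / tail (EFin \o Y) x @[x --> +oo] --> 0.

(* Regularly varying tail of index - a. *)
Definition regularly_varying_tail (Y : T -> \bar R) (a : R) : Prop :=
  (forall x : R, 0 < tail Y x) /\
  (forall t : R, 0 < t ->
    tail Y (t * x) / tail Y x @[x --> +oo] --> t `^ (- a)).

Definition random_series (Theta X : nat -> {RV P >-> R}) (w : T) : \bar R :=
  (\sum_(0 <= t <oo) (Theta t w * X t w)%:E)%E.

End Distributions.

Section ComplexMoments.
Context (d : measure_display) (T : measurableType d) (R : realType)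
  (P : probability T R).
Local Open Scope complex_scope.

(* x ^ z = exp (z * log x), for x > 0. *)
Definition cpowR (x : R) (z : R[i]) : R[i] :=
  (x `^ complex.Re z)%:C *
  (cos (complex.Im z * ln x) +i* sin (complex.Im z * ln x)).

(* Meaningful when the real and imaginary parts of Z are integrable. *)
Definition cexpectation (Z : T -> R[i]) : R[i] :=
  fine 'E_P[fun w => complex.Re (Z w)] +i* fine 'E_P[fun w => complex.Im (Z w)].

(* R[i]^o carries the topology of the complex modulus. *)
Definition cseries_sum (u : nat -> R[i]) : R[i] :=
  limn (series (u : nat -> R[i]^o)).

End ComplexMoments.

Definition equiv_at_pinfty (R : realType) (f g : R -> R) : Prop :=
  f x / g x @[x --> +oo] --> (1 : R).

(* Main.v *)
Require Import Defs.
From HB Require Import structures.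
From mathcomp Require Import all_boot all_order all_algebra.
From mathcomp Require Import complex.
From mathcomp Require Import all_classical all_reals all_analysis.
From mathcomp Require Import measurable_realfun lebesgue_integral_under.
From mathcomp Require Import ring lra.

(** Write F for the tail of X_1 and g for the tail of the series. The proof
    first shows that a certain average of F is equivalent to g, and then inverts
    the average.

    One big jump. When the series exceeds a large x, essentially one term does
    it alone, so that the sum over t of P (Theta_t X_t > x) is equivalent to
    g x (sum_tails_le, sum_tails_ge). The upper bound is Bonferroni's
    inequality: joint exceedances of two terms are negligible because the X_t
    are pairwise asymptotically independent and large weights are rare
    (joint_exceedance_small_scaled). The lower bound also needs that the terms
    of large index do not add up to a fraction of x (heavy_tail_sum). All these
    estimates are relative to g although they concern F: since Theta_1 X_1 is
    at most the series, F <= C g (single_tail_le), and Potter's inequality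
    (potter_bound) bounds g (x / theta) by g x times a two-sided power of
    theta, whose moments are those in the assumptions (moment_choice).

    Averaging. Conditioning on the weights turns P (Theta_t X_t > x) into
    E F (x / Theta_t). On the product of the probability space with the index
    set, let W = Theta^alpha and Y = ln Theta, and put r s = F (e^s) / g (e^s).
    As g (e^s / Theta) / g (e^s) tends to W, the equivalence above says that
    the integral of W r (s - Y) tends to 1: a convolution of r with the image
    of W under Y.

    Inversion. The sum of E [Theta_t^(alpha + i beta)] is the Fourier transform
    of this image at beta, and it never vanishes. It is also twice
    differentiable, because Y has a second moment under W. Dividing a triangle
    by it gives the transform of an integrable function q whose convolution
    with the image is the Fejer kernel (deconvolution); hence the Fejer means
    of r converge to 1 / m times the mass of the kernel, where m is the
    integral of W (cvg_fejer_smoothing). This is Wiener's argument, reduced to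
    the only kernels that are needed. Finally r is slowly decreasing, F being
    monotone and g regularly varying (ratio_slowly_decreasing), and this allows
    the means to be removed (tauberian_slowly_decreasing). So F / g tends to
    1 / m, where m is the sum of the E [Theta_t^alpha], and F inherits the
    regular variation of g. *)

Set Implicit Arguments.
Unset Strict Implicit.
Unset Printing Implicit Defensive.

Import Order.TTheory GRing.Theory Num.Theory.
Import numFieldNormedType.Exports.

Local Open Scope classical_set_scope.
Local Open Scope ring_scope.

(** * Integration tools *)

Section RealIntegrals.
Context {R : realType}.

Lemma integrable_le d (T : measurableType d) (mu : {measure set T -> \bar R})
    (f g : T -> R) :
  measurable_fun setT f -> mu.-integrable setT (EFin \o g) ->
  (forall x, `|f x| <= g x) -> mu.-integrable setT (EFin \o f).
Proof.
move=> mf ig fg; apply: (le_integrable _ _ _ ig) => //.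
  exact/measurable_EFinP.
move=> x _ /=; rewrite lee_fin (le_trans (fg x))// ler_norm//.
Qed.

Lemma dominated_cvg_Rintegral d (T : measurableType d)
    (mu : {measure set T -> \bar R}) (f_ : nat -> T -> R) (f g : T -> R) :
  (forall n, measurable_fun setT (f_ n)) ->
  mu.-integrable setT (EFin \o g) ->
  (forall n x, `|f_ n x| <= g x) ->
  (forall x, f_ n x @[n --> \oo] --> f x) ->
  \int[mu]_x f_ n x @[n --> \oo] --> \int[mu]_x f x.
Proof.
move=> mf_ ig fg cf.
have mf : measurable_fun setT f by exact: (measurable_fun_cvg mf_).
have [|||||] := @dominated_convergence _ T R mu setT measurableT
   (fun n => EFin \o f_ n) (EFin \o f) (EFin \o g).
- by move=> n; exact/measurable_EFinP.
- exact/measurable_EFinP.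
- by apply: aeW => x _; apply: cvg_EFin; [exact: nearW|exact: cf].
- exact: ig.
- by apply: aeW => x n _; rewrite lee_fin.
move=> iF _ h; apply: fine_cvg; rewrite fineK//.
by have := integrable_fin_num measurableT iF.
Qed.

(** By Tonelli it suffices that the iterated integral of the product bound be
    finite, and that bound separates the variables. *)
Lemma integrable_prod_le d1 d2 (T1 : measurableType d1) (T2 : measurableType d2)
    (m1 : {sigma_finite_measure set T1 -> \bar R})
    (m2 : {sigma_finite_measure set T2 -> \bar R})
    (f : T1 * T2 -> R) (g : T1 -> R) (h : T2 -> R) :
  measurable_fun setT f ->
  m1.-integrable setT (EFin \o g) -> m2.-integrable setT (EFin \o h) ->
  (forall x y, `|f (x, y)| <= g x * h y) ->
  (m1 \x m2)%E.-integrable setT (EFin \o f).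
Proof.
move=> mf ig ih fgh; apply/integrable12ltyP; first exact/measurable_EFinP.
pose G := (\int[m2]_y `|(h y)%:E|)%E.
have Gfin : G \is a fin_num.
  rewrite ge0_fin_numE ?integral_ge0//.
  by have /integrableP[] := ih.
have mg : measurable_fun setT (EFin \o g) by exact: measurable_int ig.
have mh : measurable_fun setT (EFin \o h) by exact: measurable_int ih.
apply: (@le_lt_trans _ _ (\int[m1]_x (`|(g x)%:E| * G))%E).
  apply: ge0_le_integral => //.
  - by move=> x _; exact: integral_ge0.
  - apply: (measurable_fun_fubini_tonelli_F (abse \o (EFin \o f))).
      by apply: measurableT_comp => //; exact/measurable_EFinP.
    by move=> x; exact: abse_ge0.
  - by apply: emeasurable_funM => //; exact: measurableT_comp.
  move=> x _; rewrite -ge0_integralZl//; last exact: measurableT_comp.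
  apply: ge0_le_integral => //.
  - apply: measurableT_comp => //.
    by apply/measurable_EFinP; apply: (measurableT_comp mf); exact: pair1_measurable.
  - by apply: emeasurable_funM => //; exact: measurableT_comp.
  by move=> y _; rewrite -EFinM lee_fin -normrM (le_trans (fgh x y))// ler_norm.
rewrite ge0_integralZr//; last 2 first.
  exact: measurableT_comp.
  exact: integral_ge0.
apply: lte_mul_pinfty; first exact: integral_ge0.
  by rewrite ge0_fin_numE ?integral_ge0//; have /integrableP[] := ig.
by rewrite -ge0_fin_numE// integral_ge0.
Qed.

Lemma Fubini_Rintegral d1 d2 (T1 : measurableType d1) (T2 : measurableType d2)
    (m1 : {sigma_finite_measure set T1 -> \bar R})
    (m2 : {sigma_finite_measure set T2 -> \bar R}) (f : T1 * T2 -> R) :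
  (m1 \x m2)%E.-integrable setT (EFin \o f) ->
  (forall x, m2.-integrable setT (fun y => (f (x, y))%:E)) ->
  (forall y, m1.-integrable setT (fun x => (f (x, y))%:E)) ->
  \int[m1]_x \int[m2]_y f (x, y) = \int[m2]_y \int[m1]_x f (x, y).
Proof.
move=> iF i2 i1; rewrite /Rintegral; congr fine.
transitivity (\int[m1]_x \int[m2]_y (f (x, y))%:E)%E.
  by apply: eq_integral => x _; rewrite fineK//; exact: integrable_fin_num.
rewrite (Fubini iF).
by apply: eq_integral => x _; rewrite fineK//; exact: integrable_fin_num.
Qed.

Local Notation leb := (@lebesgue_measure R).

Lemma lebesgue_measure_shift (c : R) (A : set R) : measurable A ->
  pushforward leb ((fun x => x - c) : _ -> measurableTypeR R) A = leb A.
Proof.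
move=> mA.
have mf : measurable_fun [set: measurableTypeR R]
    ((fun x => x - c) : _ -> measurableTypeR R).
  by apply: measurable_funB.
pose f : {mfun measurableTypeR R >-> measurableTypeR R} :=
  HB.pack ((fun x => x - c) : measurableTypeR R -> measurableTypeR R)
   (isMeasurableFun.Build _ _ _ _ _ mf).
apply/esym; apply: (@lebesgue_measure_unique R (pushforward leb f)) => //.
move=> _ [[a b]] _ <-; rewrite /pushforward/=.
rewrite (_ : pushforward leb _ _ = leb `]a + c, b + c]%classic); last first.
  rewrite /pushforward; congr (leb _).
  by apply/seteqP; split => x /=; rewrite !in_itv/= ltrBrDr lerBlDr.
rewrite !lebesgue_measure_itv/= !lte_fin ltrD2r.
by case: ifPn => // _; rewrite -!EFinB; congr EFin; ring.
Qed.

Lemma Rintegral_shift (f : R -> R) (c : R) : measurable_fun setT f ->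
  leb.-integrable setT (EFin \o (fun x => f (x - c))) ->
  \int[leb]_x f (x - c) = \int[leb]_x f x.
Proof.
move=> mf i; rewrite /Rintegral; congr fine.
have mf1 : measurable_fun [set: measurableTypeR R]
    ((fun x => x - c) : _ -> measurableTypeR R) by apply: measurable_funB.
pose phi : measurableTypeR R -> measurableTypeR R := fun x => x - c.
transitivity (\int[pushforward leb phi]_x (f x)%:E)%E; last first.
  by apply: eq_measure_integral => A mA _; exact: lebesgue_measure_shift.
rewrite integral_pushforward// ?preimage_setT//.
exact/measurable_EFinP.
Qed.

(** The Fejer kernel and the functions obtained from it by deconvolution are
    all dominated by a multiple of this function. *)
Lemma integrable_oneDsqrV : leb.-integrable setT (EFin \o (fun x : R => (1 + x ^+ 2)^-1)).
Proof.
have m : measurable_fun setT (fun x : R => (1 + x ^+ 2)^-1).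
  by apply: continuous_measurable_fun; exact: continuous_oneDsqrV.
apply/integrableP; split; first exact/measurable_EFinP.
have p0 x : 0 <= (1 + x ^+ 2)^-1 :> R.
  by rewrite invr_ge0 addr_ge0// sqr_ge0.
under eq_integral => x _ do rewrite /= ger0_norm ?p0//.
rewrite ge0_symfun_integralT//.
- rewrite -set_itvcy integral0y_oneDsqr -EFinM ltry//.
- exact: continuous_oneDsqrV.
- by move=> x /=; rewrite sqrrN.
Qed.

Lemma measurable_div_pos d (T : measurableType d) (V : T -> R) (x : R) :
  (forall w, 0 < V w) -> measurable_fun setT V ->
  measurable_fun setT (fun w => x / V w).
Proof.
move=> V0 mV; apply: measurable_funM => //.
rewrite (_ : (fun w => _) = (fun w => V w `^ (-1))).
  exact: (measurableT_comp (@measurable_powR R (-1)) mV).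
by apply/funext => w; rewrite powR_inv1// ltW.
Qed.

End RealIntegrals.

(** * Twice differentiable functions and trigonometric integrals *)

Section Oscillatory.
Context {R : realType}.
Local Notation leb := (@lebesgue_measure R).

(** The derivatives are explicit here because integration by parts has to name
    them; C2 below forgets them. *)
Definition C2_with (f f1 f2 : R -> R) : Prop :=
  [/\ forall x : R, is_derive x (1 : R) f (f1 x), forall x : R, is_derive x (1 : R) f1 (f2 x) &
      continuous f2].

Definition C2 (f : R -> R) : Prop := exists f1 f2, C2_with f f1 f2.

Lemma is_derive_congr (f g : R -> R) (x a b : R) :
  is_derive x (1 : R) f a -> f =1 g -> a = b -> is_derive x (1 : R) g b.
Proof. by move=> h /funext <- <-. Qed.

Lemma is_derive_continuous (f f1 : R -> R) :
  (forall x : R, is_derive x (1 : R) f (f1 x)) -> continuous f.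
Proof.
by move=> h x; apply/differentiable_continuous/derivable1_diffP; exact: ex_derive.
Qed.

Lemma C2_D f g : C2 f -> C2 g -> C2 (f \+ g).
Proof.
move=> [f1 [f2 [df df1 cf2]]] [g1 [g2 [dg dg1 cg2]]].
exists (f1 \+ g1), (f2 \+ g2); split.
- by move=> x; exact: is_deriveD.
- by move=> x; exact: is_deriveD.
- by move=> x; apply: continuousD; [exact: cf2|exact: cg2].
Qed.

Lemma C2_M f g : C2 f -> C2 g -> C2 (f \* g).
Proof.
move=> [f1 [f2 [df df1 cf2]]] [g1 [g2 [dg dg1 cg2]]].
have cf := is_derive_continuous df; have cf1 := is_derive_continuous df1.
have cg := is_derive_continuous dg; have cg1 := is_derive_continuous dg1.
exists (f1 \* g \+ f \* g1), ((f2 \* g \+ f1 \* g1) \+ (f1 \* g1 \+ f \* g2)); split.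
- move=> x; apply: (is_derive_congr (is_deriveM (df x) (dg x))) => //.
  by rewrite ?fctE /GRing.scale/=; ring.
- move=> x; apply: is_deriveD.
  + apply: (is_derive_congr (is_deriveM (df1 x) (dg x))) => //.
    by rewrite ?fctE /GRing.scale/=; ring.
  + apply: (is_derive_congr (is_deriveM (df x) (dg1 x))) => //.
    by rewrite ?fctE /GRing.scale/=; ring.
- move=> x; apply: continuousD; apply: continuousD; apply: continuousM;
  [exact: cf2|exact: cg|exact: cf1|exact: cg1|exact: cf1|exact: cg1|exact: cf|exact: cg2].
Qed.

Lemma C2_V (f : R -> R) : (forall x, f x != 0) -> C2 f -> C2 (fun x => (f x)^-1).
Proof.
move=> f0 [f1 [f2 [df df1 cf2]]].
have cf := is_derive_continuous df; have cf1 := is_derive_continuous df1.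
have dV (x : R) : is_derive x 1 (fun x => (f x)^-1) (- (f x)^-1 ^+ 2 * f1 x).
  apply: (is_derive_congr (is_deriveV (f0 x) (df x))) => //.
  by rewrite /GRing.scale/= exprVn.
have cV := is_derive_continuous dV.
exists (fun x => - (f x)^-1 ^+ 2 * f1 x),
  (fun x => 2 * ((f x)^-1 * (f x)^-1 * (f x)^-1) * (f1 x * f1 x) -
    (f x)^-1 * (f x)^-1 * f2 x); split => //.
- move=> x.
  apply: (is_derive_congr (is_deriveM (is_deriveN (is_deriveM (dV x) (dV x))) (df1 x))) => //.
  by rewrite ?fctE /GRing.scale/=; ring.
- move=> x; rewrite /continuous_at; apply: cvgB; apply: cvgM.
  + by apply: cvgM; [exact: cvg_cst|exact: (cvgM (cvgM (cV x) (cV x)) (cV x))].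
  + exact: (cvgM (cf1 x) (cf1 x)).
  + exact: (cvgM (cV x) (cV x)).
  + exact: cf2.
Qed.

Lemma C2_continuous f : C2 f -> continuous f.
Proof. by move=> [f1 [f2 [df _ _]]]; exact: is_derive_continuous df. Qed.

Lemma integrable_segment (f : R -> R) (L : R) : continuous f ->
  leb.-integrable `[0, L] (EFin \o f).
Proof.
move=> cf; apply: continuous_compact_integrable; first exact: segment_compact.
exact: continuous_subspaceT.
Qed.

Lemma Rintegral_derive (F f : R -> R) (L : R) : 0 < L ->
  (forall x : R, is_derive x (1 : R) F (f x)) -> continuous f ->
  \int[leb]_(x in `[0, L]) f x = F L - F 0.
Proof.
move=> L0 dF cf; have cF := is_derive_continuous dF.
rewrite /Rintegral (@continuous_FTC2 _ f F)//.
- exact: continuous_subspaceT.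
- split; first by move=> x _; exact: ex_derive.
  + by apply: cvg_at_right_filter; exact: cF.
  + by apply: cvg_at_left_filter; exact: cF.
- by move=> x _; rewrite derive1E; exact: derive_val.
Qed.

Lemma is_derive_cosM (x y : R) :
  is_derive y 1 (fun y => cos (x * y)) (- (x * sin (x * y))).
Proof.
have h : is_derive y 1 (fun y => x * y) x.
  apply: (is_derive_congr (is_deriveZ x (is_derive_id y (1 : R)))) => //.
  by rewrite /GRing.scale/= mulr1.
apply: (is_derive_congr (is_derive1_comp (is_derive_cos (x * y)) h)) => //.
by rewrite /GRing.scale/= ; ring.
Qed.

Lemma is_derive_sinM (x y : R) :
  is_derive y 1 (fun y => sin (x * y)) (x * cos (x * y)).
Proof.
have h : is_derive y 1 (fun y => x * y) x.
  apply: (is_derive_congr (is_deriveZ x (is_derive_id y (1 : R)))) => //.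
  by rewrite /GRing.scale/= mulr1.
apply: (is_derive_congr (is_derive1_comp (is_derive_sin (x * y)) h)) => //.
by rewrite /GRing.scale/= ; ring.
Qed.

Lemma continuous_cosM (x : R) : continuous (fun y => cos (x * y)).
Proof. exact: is_derive_continuous (is_derive_cosM x). Qed.

Lemma continuous_sinM (x : R) : continuous (fun y => sin (x * y)).
Proof. exact: is_derive_continuous (is_derive_sinM x). Qed.

(** Two integrations by parts done at once: the sum of the two integrals is
    that of the derivative in y of x sin (x y) u y + cos (x y) u' y. As u L =
    0, only the terms with u' remain at the end points. *)
Lemma cos_transform_by_parts (u u1 u2 : R -> R) (L x : R) : 0 < L ->
  C2_with u u1 u2 -> u L = 0 ->
  x ^+ 2 * (\int[leb]_(y in `[0, L]) (cos (x * y) * u y)) =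
  cos (x * L) * u1 L - u1 0 - \int[leb]_(y in `[0, L]) (cos (x * y) * u2 y).
Proof.
move=> L0 [du du1 cu2] uL.
have cu := is_derive_continuous du; have cu1 := is_derive_continuous du1.
have c1 : continuous (fun y => cos (x * y) * u y).
  by move=> y; rewrite /continuous_at; apply: cvgM; [exact: continuous_cosM|exact: cu].
have c2 : continuous (fun y => cos (x * y) * u2 y).
  by move=> y; rewrite /continuous_at; apply: cvgM; [exact: continuous_cosM|exact: cu2].
have i1 := integrable_segment L c1.
have i2 := integrable_segment L c2.
rewrite -RintegralZl//; apply/eqP; rewrite eq_sym subr_eq -RintegralD//; last first.
  by have := integrableZl _ (x ^+ 2) i1; apply.
apply/eqP.
have dF (y : R) : is_derive y (1 : R)
    (fun y => x * (sin (x * y) * u y) + cos (x * y) * u1 y)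
    (x ^+ 2 * (cos (x * y) * u y) + cos (x * y) * u2 y).
  apply: (is_derive_congr (is_deriveD
    (is_deriveZ (x) (is_deriveM (is_derive_sinM x y) (du y)))
    (is_deriveM (is_derive_cosM x y) (du1 y)))) => //.
  by rewrite ?fctE /GRing.scale/=; ring.
have cF : continuous (fun y => x ^+ 2 * (cos (x * y) * u y) + cos (x * y) * u2 y).
  move=> y; rewrite /continuous_at; apply: cvgD; last exact: c2.
  by apply: cvgM; [exact: cvg_cst|exact: c1].
rewrite (Rintegral_derive L0 dF cF).
by rewrite uL !mulr0 sin0 cos0; ring.
Qed.

(** As for the cosine, but the primitive is now - x cos (x y) u y + sin (x y)
    u' y, whose first term vanishes at the origin only because u does. *)
Lemma sin_transform_by_parts (u u1 u2 : R -> R) (L x : R) : 0 < L ->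
  C2_with u u1 u2 -> u 0 = 0 -> u L = 0 ->
  x ^+ 2 * (\int[leb]_(y in `[0, L]) (sin (x * y) * u y)) =
  sin (x * L) * u1 L - \int[leb]_(y in `[0, L]) (sin (x * y) * u2 y).
Proof.
move=> L0 [du du1 cu2] u0 uL.
have cu := is_derive_continuous du; have cu1 := is_derive_continuous du1.
have c1 : continuous (fun y => sin (x * y) * u y).
  by move=> y; rewrite /continuous_at; apply: cvgM; [exact: continuous_sinM|exact: cu].
have c2 : continuous (fun y => sin (x * y) * u2 y).
  by move=> y; rewrite /continuous_at; apply: cvgM; [exact: continuous_sinM|exact: cu2].
have i1 := integrable_segment L c1.
have i2 := integrable_segment L c2.
rewrite -RintegralZl//; apply/eqP; rewrite eq_sym subr_eq -RintegralD//; last first.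
  by have := integrableZl _ (x ^+ 2) i1; apply.
apply/eqP.
have dF (y : R) : is_derive y (1 : R)
    (fun y => - x * (cos (x * y) * u y) + sin (x * y) * u1 y)
    (x ^+ 2 * (sin (x * y) * u y) + sin (x * y) * u2 y).
  apply: (is_derive_congr (is_deriveD
    (is_deriveZ (- x) (is_deriveM (is_derive_cosM x y) (du y)))
    (is_deriveM (is_derive_sinM x y) (du1 y)))) => //.
  by rewrite ?fctE /GRing.scale/=; ring.
have cF : continuous (fun y => x ^+ 2 * (sin (x * y) * u y) + sin (x * y) * u2 y).
  move=> y; rewrite /continuous_at; apply: cvgD; last exact: c2.
  by apply: cvgM; [exact: cvg_cst|exact: c1].
rewrite (Rintegral_derive L0 dF cF).
by rewrite uL u0 !mulr0 sin0 mul0r; ring.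
Qed.

Lemma le_norm_Rintegral_segment (f g : R -> R) (L : R) :
  continuous f -> continuous g -> (forall x, `|f x| <= `|g x|) ->
  `|\int[leb]_(x in `[0, L]) f x| <= \int[leb]_(x in `[0, L]) `|g x|.
Proof.
move=> cf cg fg.
apply: (le_trans (le_normr_Rintegral _ (integrable_segment L cf))) => //.
apply: le_Rintegral => //.
- apply: (integrable_segment L (f := fun x => `|f x|)) => x.
  by apply: continuous_comp; [exact: cf|exact: norm_continuous].
- apply: (integrable_segment L (f := fun x => `|g x|)) => x.
  by apply: continuous_comp; [exact: cg|exact: norm_continuous].
Qed.

(** Integration by parts bounds x^2 times the transform; adding the trivial
    bound on the transform itself gives a bound that is integrable in x. *)
Lemma cos_transform_decay (u : R -> R) (L : R) : 0 < L -> C2 u -> u L = 0 ->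
  exists C : R, forall x,
    `|\int[leb]_(y in `[0, L]) (cos (x * y) * u y)| <= C * (1 + x ^+ 2)^-1.
Proof.
move=> L0 [u1 [u2 Cu]] uL; have [du du1 cu2] := Cu.
have cu := is_derive_continuous du.
exists (\int[leb]_(y in `[0, L]) `|u y| + (`|u1 L| + `|u1 0| +
  \int[leb]_(y in `[0, L]) `|u2 y|)) => x.
have p : 0 < 1 + x ^+ 2 by rewrite ltr_pwDl// sqr_ge0.
rewrite ler_pdivlMr// -{1}(ger0_norm (ltW p)) -normrM mulrDr mulr1.
rewrite [X in _ + X]mulrC (cos_transform_by_parts x L0 Cu uL).
have cosM1 (v : R -> R) y : `|cos (x * y) * v y| <= `|v y|.
  by rewrite normrM ler_piMl// cos_max.
have cM (v : R -> R) : continuous v -> continuous (fun y => cos (x * y) * v y).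
  by move=> cv y; rewrite /continuous_at; apply: cvgM; [exact: continuous_cosM|exact: cv].
rewrite (le_trans (ler_normD _ _))// lerD//.
  by apply: le_norm_Rintegral_segment; [exact: cM|exact: cu|exact: cosM1].
rewrite (le_trans (ler_normB _ _))// lerD//; last first.
  by apply: le_norm_Rintegral_segment; [exact: cM|exact: cu2|exact: cosM1].
by rewrite (le_trans (ler_normB _ _))// lerD// normrM ler_piMl// cos_max.
Qed.

Lemma sin_transform_decay (u : R -> R) (L : R) : 0 < L -> C2 u ->
  u 0 = 0 -> u L = 0 ->
  exists C : R, forall x,
    `|\int[leb]_(y in `[0, L]) (sin (x * y) * u y)| <= C * (1 + x ^+ 2)^-1.
Proof.
move=> L0 [u1 [u2 Cu]] u0 uL; have [du du1 cu2] := Cu.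
have cu := is_derive_continuous du.
exists (\int[leb]_(y in `[0, L]) `|u y| + (`|u1 L| +
  \int[leb]_(y in `[0, L]) `|u2 y|)) => x.
have p : 0 < 1 + x ^+ 2 by rewrite ltr_pwDl// sqr_ge0.
rewrite ler_pdivlMr// -{1}(ger0_norm (ltW p)) -normrM mulrDr mulr1.
rewrite [X in _ + X]mulrC (sin_transform_by_parts x L0 Cu u0 uL).
have sinM1 (v : R -> R) y : `|sin (x * y) * v y| <= `|v y|.
  by rewrite normrM ler_piMl// sin_max.
have cM (v : R -> R) : continuous v -> continuous (fun y => sin (x * y) * v y).
  by move=> cv y; rewrite /continuous_at; apply: cvgM; [exact: continuous_sinM|exact: cv].
rewrite (le_trans (ler_normD _ _))// lerD//.
  by apply: le_norm_Rintegral_segment; [exact: cM|exact: cu|exact: sinM1].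
rewrite (le_trans (ler_normB _ _))// lerD//; last first.
  by apply: le_norm_Rintegral_segment; [exact: cM|exact: cu2|exact: sinM1].
Qed.

End Oscillatory.

(** * Trigonometric transforms of a weighted measure *)

Section TrigTransforms.
Context {R : realType} d (T : measurableType d) (mu : {measure set T -> \bar R}).

(** The domination holds for all values of the parameter at once, which
    dispenses with a choice of neighbourhoods. *)
Lemma is_derive_Rintegral (f f' : R -> T -> R) (G : T -> R) (a : R) :
  (forall x, mu.-integrable setT (EFin \o f x)) ->
  (forall (x : R) y, is_derive x (1 : R) (f ^~ y) (f' x y)) ->
  mu.-integrable setT (EFin \o G) ->
  (forall x y, `|f' x y| <= G y) ->
  is_derive a (1 : R) (fun x => \int[mu]_y f x y) (\int[mu]_y f' a y).
Proof.
move=> intf df iG fG.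
have d1f x y : partial1of2 f x y = f' x y.
  by rewrite partial1of2E; exact: derive_val.
have aI : `]a - 1, a + 1[%classic a.
  by rewrite /= in_itv/= ltrBlDr ltrDl ltr01.
have G0 y : 0 <= G y by exact: le_trans (fG a y).
have derf x y : `]a - 1, a + 1[%classic x -> setT y -> derivable (f ^~ y) x 1.
  by move=> _ _; exact: ex_derive.
have Gub x y : `]a - 1, a + 1[%classic x -> setT y -> `|partial1of2 f x y| <= G y.
  by move=> _ _; rewrite d1f.
split.
  exact: (derivable_under_integral measurableT aI (fun x _ => intf x) derf G0 iG Gub).
rewrite -derive1E.
rewrite (differentiation_under_integral measurableT aI (fun x _ => intf x) derf G0 iG Gub).
by apply: eq_Rintegral => y _; rewrite d1f.
Qed.

Lemma continuous_Rintegral (f : R -> T -> R) (G : T -> R) :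
  (forall x, measurable_fun setT (f x)) ->
  (forall y, continuous (f ^~ y)) ->
  mu.-integrable setT (EFin \o G) ->
  (forall x y, `|f x y| <= G y) ->
  continuous (fun x => \int[mu]_y f x y).
Proof.
move=> mf cf iG fG a.
apply: (@continuity_under_integral _ _ _ mu f setT measurableT (a - 1) (a + 1) _ _ G iG _ a).
- by move=> x _; exact: integrable_le iG (fG x).
- by apply: aeW => y _ x _; exact: cf.
- by move=> x _; apply: aeW => y _.
- by rewrite inE/= in_itv/= ltrBlDr ltrDl ltr01.
Qed.

Lemma measurable_cos_comp d' (T' : measurableType d') (f : T' -> R) :
  measurable_fun setT f -> measurable_fun setT (fun x => cos (f x)).
Proof.
move=> mf; apply: measurableT_comp mf => //.
by apply: continuous_measurable_fun; exact: continuous_cos.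
Qed.

Lemma measurable_sin_comp d' (T' : measurableType d') (f : T' -> R) :
  measurable_fun setT f -> measurable_fun setT (fun x => sin (f x)).
Proof.
move=> mf; apply: measurableT_comp mf => //.
by apply: continuous_measurable_fun; exact: continuous_sin.
Qed.

Variables (Y : T -> R).
Hypothesis mY : measurable_fun setT Y.

(** Real and imaginary parts of the Fourier transform of the image under Y of
    the measure of density W. All of the harmonic analysis is done on these
    two real functions. *)
Definition cos_transform (W : T -> R) (x : R) : R := \int[mu]_w (W w * cos (x * Y w)).
Definition sin_transform (W : T -> R) (x : R) : R := \int[mu]_w (W w * sin (x * Y w)).

Section OneWeight.
Variable W : T -> R.
Hypothesis iW : mu.-integrable setT (EFin \o W).

Let mW : measurable_fun setT W.
Proof. by apply/measurable_EFinP; exact: measurable_int iW. Qed.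

Let iaW : mu.-integrable setT (EFin \o (fun w => `|W w|)).
Proof. exact: integrable_norm. Qed.

Lemma measurable_weighted_cos x : measurable_fun setT (fun w => W w * cos (x * Y w)).
Proof.
by apply: measurable_funM => //; apply: measurable_cos_comp; exact: measurable_funM.
Qed.

Lemma measurable_weighted_sin x : measurable_fun setT (fun w => W w * sin (x * Y w)).
Proof.
by apply: measurable_funM => //; apply: measurable_sin_comp; exact: measurable_funM.
Qed.

Lemma weighted_cos_le x w : `|W w * cos (x * Y w)| <= `|W w|.
Proof. by rewrite normrM ler_piMr// cos_max. Qed.

Lemma weighted_sin_le x w : `|W w * sin (x * Y w)| <= `|W w|.
Proof. by rewrite normrM ler_piMr// sin_max. Qed.

Lemma integrable_weighted_cos x :
  mu.-integrable setT (EFin \o (fun w => W w * cos (x * Y w))).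
Proof.
by apply: integrable_le iaW _; [exact: measurable_weighted_cos|exact: weighted_cos_le].
Qed.

Lemma integrable_weighted_sin x :
  mu.-integrable setT (EFin \o (fun w => W w * sin (x * Y w))).
Proof.
by apply: integrable_le iaW _; [exact: measurable_weighted_sin|exact: weighted_sin_le].
Qed.

Lemma continuous_cos_transform : continuous (cos_transform W).
Proof.
apply: (continuous_Rintegral _ _ iaW).
- exact: measurable_weighted_cos.
- move=> w x; rewrite /continuous_at; apply: cvgM; first exact: cvg_cst.
  have := @continuous_cosM R (Y w) x; rewrite /continuous_at.
  by under eq_fun do rewrite mulrC; rewrite mulrC.
- exact: weighted_cos_le.
Qed.

Lemma continuous_sin_transform : continuous (sin_transform W).
Proof.
apply: (continuous_Rintegral _ _ iaW).
- exact: measurable_weighted_sin.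
- move=> w x; rewrite /continuous_at; apply: cvgM; first exact: cvg_cst.
  have := @continuous_sinM R (Y w) x; rewrite /continuous_at.
  by under eq_fun do rewrite mulrC; rewrite mulrC.
- exact: weighted_sin_le.
Qed.

End OneWeight.

Lemma is_derive_cos_transform (W : T -> R) (x : R) :
  mu.-integrable setT (EFin \o W) ->
  mu.-integrable setT (EFin \o (fun w => W w * Y w)) ->
  is_derive x (1 : R) (cos_transform W) (sin_transform (fun w => - (W w * Y w)) x).
Proof.
move=> iW iWY.
apply: (@is_derive_Rintegral (fun x w => W w * cos (x * Y w))
  (fun x w => - (W w * Y w) * sin (x * Y w)) (fun w => `|W w * Y w|)).
- exact: integrable_weighted_cos.
- move=> {}x w.
  apply: (is_derive_congr (is_deriveZ (W w) (is_derive_cosM (Y w) x))) => //.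
    by move=> y; rewrite /GRing.scale/= mulrC; congr (_ * cos _); rewrite mulrC.
  by rewrite /GRing.scale/= [x * _]mulrC; ring.
- exact: integrable_norm.
- by move=> {}x w; rewrite normrM normrN ler_piMr// sin_max.
Qed.

Lemma is_derive_sin_transform (W : T -> R) (x : R) :
  mu.-integrable setT (EFin \o W) ->
  mu.-integrable setT (EFin \o (fun w => W w * Y w)) ->
  is_derive x (1 : R) (sin_transform W) (cos_transform (fun w => W w * Y w) x).
Proof.
move=> iW iWY.
apply: (@is_derive_Rintegral (fun x w => W w * sin (x * Y w))
  (fun x w => W w * Y w * cos (x * Y w)) (fun w => `|W w * Y w|)).
- exact: integrable_weighted_sin.
- move=> {}x w.
  apply: (is_derive_congr (is_deriveZ (W w) (is_derive_sinM (Y w) x))) => //.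
    by move=> y; rewrite /GRing.scale/=; congr (_ * sin _); rewrite mulrC.
  by rewrite /GRing.scale/= [x * _]mulrC; ring.
- exact: integrable_norm.
- by move=> {}x w; rewrite normrM ler_piMr// cos_max.
Qed.

(** Each differentiation brings down a factor Y, so that two moments of Y
    under W give two derivatives. *)
Lemma C2_cos_transform (W : T -> R) :
  mu.-integrable setT (EFin \o W) ->
  mu.-integrable setT (EFin \o (fun w => W w * Y w)) ->
  mu.-integrable setT (EFin \o (fun w => W w * Y w ^+ 2)) ->
  C2 (cos_transform W).
Proof.
move=> iW iWY iWY2.
have iN : mu.-integrable setT (EFin \o (fun w => - (W w * Y w))).
  exact: integrableN iWY.
have iN2 : mu.-integrable setT (EFin \o (fun w => - (W w * Y w) * Y w)).
  rewrite (_ : (fun w => - (W w * Y w) * Y w) = (fun w => - (W w * Y w ^+ 2))).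
    exact: integrableN iWY2.
  by apply/funext => w; ring.
exists (sin_transform (fun w => - (W w * Y w))),
       (cos_transform (fun w => - (W w * Y w) * Y w)); split.
- by move=> x; exact: is_derive_cos_transform.
- by move=> x; exact: is_derive_sin_transform.
- exact: continuous_cos_transform.
Qed.

Lemma C2_sin_transform (W : T -> R) :
  mu.-integrable setT (EFin \o W) ->
  mu.-integrable setT (EFin \o (fun w => W w * Y w)) ->
  mu.-integrable setT (EFin \o (fun w => W w * Y w ^+ 2)) ->
  C2 (sin_transform W).
Proof.
move=> iW iWY iWY2.
have i2 : mu.-integrable setT (EFin \o (fun w => W w * Y w * Y w)).
  rewrite (_ : (fun w => _) = (fun w => W w * Y w ^+ 2))//.
  by apply/funext => w; ring.
exists (cos_transform (fun w => W w * Y w)),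
       (sin_transform (fun w => - (W w * Y w * Y w))); split.
- by move=> x; exact: is_derive_sin_transform.
- by move=> x; exact: is_derive_cos_transform.
- by apply: continuous_sin_transform; exact: integrableN i2.
Qed.

End TrigTransforms.

(** * Exchange of integrals under a product bound *)

Section DominatedFubini.
Context {R : realType} d1 d2 (T1 : measurableType d1) (T2 : measurableType d2)
    (m1 : {sigma_finite_measure set T1 -> \bar R})
    (m2 : {sigma_finite_measure set T2 -> \bar R})
    (f : T1 * T2 -> R) (g : T1 -> R) (h : T2 -> R).
Hypothesis mf : measurable_fun setT f.
Hypothesis ig : m1.-integrable setT (EFin \o g).
Hypothesis ih : m2.-integrable setT (EFin \o h).
Hypothesis fgh : forall x y, `|f (x, y)| <= g x * h y.

Let iF := integrable_prod_le mf ig ih fgh.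

Let i2 x : m2.-integrable setT (fun y => (f (x, y))%:E).
Proof.
apply: (@integrable_le _ _ _ m2 (fun y => f (x, y)) (fun y => g x * h y)).
- by apply: (measurableT_comp mf); exact: pair1_measurable.
- exact: (integrableZl measurableT (g x) ih).
- by move=> y; exact: fgh.
Qed.

Let i1 y : m1.-integrable setT (fun x => (f (x, y))%:E).
Proof.
apply: (@integrable_le _ _ _ m1 (fun x => f (x, y)) (fun x => g x * h y)).
- by apply: (measurableT_comp mf); exact: pair2_measurable.
- exact: (integrableZr measurableT (h y) ig).
- by move=> x; exact: fgh.
Qed.

Lemma Fubini_dominated :
  \int[m1]_x \int[m2]_y f (x, y) = \int[m2]_y \int[m1]_x f (x, y).
Proof. exact: Fubini_Rintegral. Qed.

Lemma measurable_Rintegral_dominated :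
  measurable_fun setT (fun y => \int[m1]_x f (x, y)).
Proof.
apply/measurable_EFinP.
rewrite (_ : EFin \o _ = fubini_G m1 (EFin \o f)); first exact: (measurable_fubini_G iF).
by apply/funext => y /=; rewrite /fubini_G /Rintegral fineK//; exact: integrable_fin_num.
Qed.

End DominatedFubini.

(** * The Fejer kernel *)

Section Fejer.
Context {R : realType}.
Local Notation leb := (@lebesgue_measure R).

Definition ramp (L y : R) : R := 1 - L^-1 * y.

(** The Fourier transform of a triangle, hence (up to a factor) the Fejer
    kernel. What matters is that it is a nonnegative kernel whose transform
    has compact support. *)
Definition fejer (L x : R) : R := \int[leb]_(y in `[0, L]) (cos (x * y) * ramp L y).

Lemma C2_with_ramp L : C2_with (ramp L) (fun=> - L^-1) (fun=> 0).
Proof.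
split=> x; [|exact: is_derive_cst|exact: cvg_cst].
apply: (is_derive_congr (is_deriveB (is_derive_cst (1 : R) x (1 : R))
  (is_deriveZ L^-1 (is_derive_id x (1 : R))))) => //.
by rewrite /GRing.scale/= sub0r mulr1.
Qed.

Lemma C2_ramp L : C2 (ramp L).
Proof. by exists (fun=> - L^-1), (fun=> 0); exact: C2_with_ramp. Qed.

Lemma ramp_end (L : R) : 0 < L -> ramp L L = 0.
Proof. by move=> L0; rewrite /ramp mulVf ?subrr// gt_eqF. Qed.

(** The closed form of the kernel, multiplied by x^2 so as to hold at the
    origin too; positivity and decay are read off from it. *)
Lemma fejerE (L x : R) : 0 < L -> x ^+ 2 * fejer L x = L^-1 * (1 - cos (x * L)).
Proof.
move=> L0; rewrite (cos_transform_by_parts x L0 (C2_with_ramp L) (ramp_end L0)).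
under eq_Rintegral do rewrite mulr0.
by rewrite Rintegral_cst// mul0r; ring.
Qed.

Lemma fejer_ge0 (L x : R) : 0 < L -> 0 <= fejer L x.
Proof.
move=> L0; have [->|x0] := eqVneq x 0.
  apply: Rintegral_ge0 => y /=; rewrite in_itv/= => /andP[y0 yL].
  by rewrite mul0r cos0 mul1r subr_ge0 mulrC ler_pdivrMr// mul1r.
have x2 : 0 < x ^+ 2 by rewrite exprn_even_gt0.
by rewrite -(pmulr_rge0 _ x2) fejerE// mulr_ge0// ?invr_ge0 ?(ltW L0)//.
Qed.

Lemma fejer_tail (L x : R) : 0 < L -> x ^+ 2 * fejer L x <= 2 * L^-1.
Proof.
move=> L0; rewrite fejerE// mulrC ler_wpM2r ?invr_ge0 ?(ltW L0)//.
by have := cos_geN1 (x * L); lra.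
Qed.

(** In this range x y stays in [-1, 1] over the whole segment of integration,
    and there the cosine is at least cos 1, which is positive. *)
Lemma fejer_bulk (L x : R) : 0 < L -> `|x| <= L^-1 -> cos 1 / 2 * L <= fejer L x.
Proof.
move=> L0 xL.
have ir : leb.-integrable `[0, L] (EFin \o ramp L).
  by apply: integrable_segment; exact: C2_continuous (C2_ramp L).
have -> : cos 1 / 2 * L = \int[leb]_(y in `[0, L]) (cos 1 * ramp L y).
  rewrite RintegralZl// -mulrA; congr (_ * _).
  have dF (y : R) : is_derive y (1 : R) (fun y => y - (L^-1 / 2) * (y * y)) (ramp L y).
    apply: (is_derive_congr (is_deriveB (is_derive_id y (1 : R))
       (is_deriveZ (L^-1 / 2) (is_deriveM (is_derive_id y (1 : R))
          (is_derive_id y (1 : R)))))) => //.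
    by rewrite /ramp /GRing.scale/=; field; rewrite gt_eqF.
  rewrite (Rintegral_derive L0 dF (C2_continuous (C2_ramp L))).
  by field; rewrite gt_eqF.
apply: le_Rintegral => //.
- exact: (integrableZl _ (cos 1) ir).
- apply: (integrable_segment L (f := fun y => cos (x * y) * ramp L y)) => y.
  rewrite /continuous_at; apply: cvgM; first exact: continuous_cosM.
  exact: C2_continuous (C2_ramp L) y.
move=> y /=; rewrite in_itv/= => /andP[y0 yL].
rewrite ler_wpM2r//; first by rewrite subr_ge0 mulrC ler_pdivrMr// mul1r.
rewrite -[leRHS]cos_norm normrM (ger0_norm y0).
have h : `|x| * y <= 1.
  by rewrite (le_trans (ler_pM _ _ xL yL))// mulVf// gt_eqF.
have pi1 : 1 <= pi :> R by rewrite (le_trans _ (pi_ge2 R))// ler1n.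
have [->//|neq] := eqVneq (`|x| * y) 1.
rewrite ltW// ltr_cos ?in_itv/= ?ler01 ?mulr_ge0//=.
- by rewrite lt_neqAle neq.
- exact: le_trans pi1.
Qed.

End Fejer.

(** * Deconvolution of the Fejer kernel *)

Section Wiener.
Context {R : realType} d (T : measurableType d)
  (mu : {sigma_finite_measure set T -> \bar R}).
Local Notation leb := (@lebesgue_measure R).
Variables (W Y : T -> R).
Hypothesis W0 : forall w, 0 <= W w.
Hypothesis mY : measurable_fun setT Y.
Hypothesis iW : mu.-integrable setT (EFin \o W).
Hypothesis iWY2 : mu.-integrable setT (EFin \o (fun w => W w * Y w ^+ 2)).

Let a := cos_transform mu Y W.
Let b := sin_transform mu Y W.
Hypothesis ab0 : forall x, (a x, b x) != (0, 0).

Let mW : measurable_fun setT W.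
Proof. by apply/measurable_EFinP; exact: measurable_int iW. Qed.

Let iW1Y2 : mu.-integrable setT (EFin \o (fun w => W w * (1 + Y w ^+ 2))).
Proof.
rewrite (_ : (fun w => _) = (fun w => W w + W w * Y w ^+ 2)).
  exact: (integrableD measurableT iW iWY2).
by apply/funext => w; rewrite mulrDr mulr1.
Qed.

Let iWY : mu.-integrable setT (EFin \o (fun w => W w * Y w)).
Proof.
apply: integrable_le iW1Y2 _; first exact: measurable_funM.
move=> w; rewrite normrM (ger0_norm (W0 w)) ler_wpM2l// ler_norml.
by have := sqr_ge0 (Y w - 1); have := sqr_ge0 (Y w + 1); rewrite !expr2; nra.
Qed.

Let modulus2 x := a x * a x + b x * b x.

Let modulus2_neq0 x : modulus2 x != 0.
Proof.
rewrite /modulus2 -!expr2 paddr_eq0 ?sqr_ge0// !sqrf_eq0.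
by have := ab0 x; rewrite xpair_eqE.
Qed.

Let C2a : C2 a. Proof. exact: C2_cos_transform. Qed.
Let C2b : C2 b. Proof. exact: C2_sin_transform. Qed.

Let invD x := (modulus2 x)^-1.

Let C2invD : C2 invD.
Proof. by apply: C2_V => //; apply: C2_D; exact: C2_M. Qed.

Variable L : R.
Hypothesis L0 : 0 < L.

(* u + i v is the triangle divided by the complex conjugate of a + i b. *)
Let u y := ramp L y * (a y * invD y).
Let v y := ramp L y * (b y * invD y).

Let C2u : C2 u.
Proof. by apply: C2_M; [exact: C2_ramp|exact: C2_M]. Qed.
Let C2v : C2 v.
Proof. by apply: C2_M; [exact: C2_ramp|exact: C2_M]. Qed.
Let uL : u L = 0. Proof. by rewrite /u ramp_end// mul0r. Qed.
Let vL : v L = 0. Proof. by rewrite /v ramp_end// mul0r. Qed.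
Let b_0 : b 0 = 0.
Proof.
rewrite /b /sin_transform; under eq_Rintegral do rewrite mul0r sin0 mulr0.
by rewrite Rintegral_cst// mul0r.
Qed.
Let v_0 : v 0 = 0. Proof. by rewrite /v b_0 mul0r mulr0. Qed.

Let chi : R -> R := \1_(`[0, L]).

Let mchi : measurable_fun setT chi.
Proof. exact: measurable_indic. Qed.

Let chiE (f : R -> R) : \int[leb]_(y in `[0, L]) f y = \int[leb]_y (chi y * f y).
Proof.
rewrite Rintegral_mkcond; apply: eq_Rintegral => y _.
by rewrite patch_indic mulrC.
Qed.

Let ichi (f : R -> R) : continuous f -> leb.-integrable setT (EFin \o (fun y => chi y * f y)).
Proof.
move=> cf; have := integrable_segment L cf.
rewrite integrable_mkcond//= => h.
rewrite (_ : EFin \o _ = (EFin \o f) \_ `[0, L])//.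
by rewrite restrict_EFin; congr (_ \o _); rewrite patch_indic; apply/funext => y /=; rewrite mulrC.
Qed.

(* The real part of the integral over [0, L] of (u y + i v y) e^(i x y). *)
Let q x := cos_transform leb id (fun y => chi y * u y) x -
           sin_transform leb id (fun y => chi y * v y) x.

Let qE x : q x = \int[leb]_(y in `[0, L]) (cos (x * y) * u y) -
                 \int[leb]_(y in `[0, L]) (sin (x * y) * v y).
Proof.
rewrite !chiE /q /cos_transform /sin_transform.
by congr (_ - _); apply: eq_Rintegral => y _; ring.
Qed.

Let iu := ichi (C2_continuous C2u).
Let iv := ichi (C2_continuous C2v).

Let cq : continuous q.
Proof.
move=> x; rewrite /continuous_at; apply: cvgB.
  exact: continuous_cos_transform.
exact: continuous_sin_transform.
Qed.

(* The quotients u and v are twice differentiable because a and b are and have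
   no common zero; v vanishes at 0 because b is odd. *)
Let q_decay : exists2 C : R, 0 <= C & forall x, `|q x| <= C * (1 + x ^+ 2)^-1.
Proof.
have [Cu hu] := cos_transform_decay L0 C2u uL.
have [Cv hv] := sin_transform_decay L0 C2v v_0 vL.
have h x : `|q x| <= (Cu + Cv) * (1 + x ^+ 2)^-1.
  by rewrite qE mulrDl (le_trans (ler_normB _ _))// lerD.
exists (Cu + Cv) => //.
by have := le_trans (normr_ge0 _) (h 0); rewrite expr0n addr0 invr1 mulr1.
Qed.

Let iq : leb.-integrable setT (EFin \o q).
Proof.
have [C C0 h] := q_decay.
have i1 := integrableZl measurableT C (@integrable_oneDsqrV R).
refine (@integrable_le _ _ _ leb _ (fun x => C * (1 + x ^+ 2)^-1) _ i1 h).
exact: continuous_measurable_fun.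
Qed.

Let fejerT x : fejer L x = cos_transform leb id (fun y => chi y * ramp L y) x.
Proof.
by rewrite /fejer chiE /cos_transform; apply: eq_Rintegral => y _; ring.
Qed.

Lemma continuous_fejer : continuous (fejer L).
Proof.
move=> x; rewrite (_ : fejer L = cos_transform leb id (fun y => chi y * ramp L y)).
  apply: continuous_cos_transform => //; apply: ichi.
  exact: C2_continuous (C2_ramp L).
by apply/funext => z; exact: fejerT.
Qed.

Lemma integrable_fejer : leb.-integrable setT (EFin \o fejer L).
Proof.
have [C h] := cos_transform_decay L0 (C2_ramp L) (ramp_end L0).
have i1 := integrableZl measurableT C (@integrable_oneDsqrV R).
refine (@integrable_le _ _ _ leb _ (fun x => C * (1 + x ^+ 2)^-1) _ i1 h).
by apply: continuous_measurable_fun; exact: continuous_fejer.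
Qed.

Let mWq (z : R) : measurable_fun setT (fun w => W w * q (z - Y w)).
Proof.
apply: measurable_funM => //; apply: (measurableT_comp (f := q)).
  exact: continuous_measurable_fun.
exact: measurable_funB.
Qed.

(** Averaging the translates of q by Y multiplies its transform by the complex
    conjugate of a + i b, and this restores the triangle. *)
Lemma deconvolution z : \int[mu]_w (W w * q (z - Y w)) = fejer L z.
Proof.
pose f (p : T * R) := W p.1 * (chi p.2 *
  (cos ((z - Y p.1) * p.2) * u p.2 - sin ((z - Y p.1) * p.2) * v p.2)).
have mf : measurable_fun setT f.
  have m1 : measurable_fun [set: T * R] (fun p => (z - Y p.1) * p.2).
    apply: measurable_funM => //; apply: measurable_funB => //.
    exact: measurableT_comp.
  have mu' : measurable_fun setT u by exact: continuous_measurable_fun (C2_continuous C2u).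
  have mv' : measurable_fun setT v by exact: continuous_measurable_fun (C2_continuous C2v).
  apply: measurable_funM; first exact: (measurableT_comp mW).
  apply: measurable_funM; first exact: (measurableT_comp mchi).
  apply: measurable_funB; apply: measurable_funM.
  - exact: measurable_cos_comp.
  - exact: (measurableT_comp mu').
  - exact: measurable_sin_comp.
  - exact: (measurableT_comp mv').
have ih : leb.-integrable setT (EFin \o (fun y => chi y * (`|u y| + `|v y|))).
  apply: ichi => y; rewrite /continuous_at; apply: cvgD; apply: cvg_norm.
    exact: C2_continuous C2u y.
  exact: C2_continuous C2v y.
have fle w y : `|f (w, y)| <= W w * (chi y * (`|u y| + `|v y|)).
  rewrite /f /= normrM (ger0_norm (W0 w)) ler_wpM2l// normrM.
  have c0 : 0 <= chi y by rewrite /chi indicE.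
  rewrite (ger0_norm c0) ler_wpM2l// (le_trans (ler_normB _ _))//.
  by rewrite lerD// normrM ler_piMl// ?cos_max ?sin_max.
transitivity (\int[mu]_w \int[leb]_y f (w, y)).
  apply: eq_Rintegral => w _; rewrite qE.
  have cu : continuous (fun y => cos ((z - Y w) * y) * u y).
    move=> y; rewrite /continuous_at; apply: cvgM; first exact: continuous_cosM.
    exact: C2_continuous C2u y.
  have cv : continuous (fun y => sin ((z - Y w) * y) * v y).
    move=> y; rewrite /continuous_at; apply: cvgM; first exact: continuous_sinM.
    exact: C2_continuous C2v y.
  rewrite -RintegralB//; [|exact: integrable_segment cu|exact: integrable_segment cv].
  rewrite chiE /f/= RintegralZl//.
  apply: (ichi (f := fun y => cos ((z - Y w) * y) * u y - sin ((z - Y w) * y) * v y)) => y.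
  by rewrite /continuous_at; apply: cvgB; [exact: cu|exact: cv].
rewrite (@Fubini_dominated _ _ _ _ _ mu leb _ _ _ mf iW ih fle) /fejer chiE; apply: eq_Rintegral => y _.
pose c1 := chi y * (u y * cos (z * y) - v y * sin (z * y)).
pose c2 := chi y * (u y * sin (z * y) + v y * cos (z * y)).
transitivity (\int[mu]_w (c1 * (W w * cos (y * Y w)) + c2 * (W w * sin (y * Y w)))).
  apply: eq_Rintegral => w _; rewrite /f /= /c1 /c2 [y * _]mulrC.
  by rewrite mulrBl cosB sinB; ring.
rewrite RintegralD//; last 2 first.
- by apply: (integrableZl _ c1 (integrable_weighted_cos mY iW y)).
- by apply: (integrableZl _ c2 (integrable_weighted_sin mY iW y)).
rewrite !RintegralZl//; [|exact: integrable_weighted_sin|exact: integrable_weighted_cos].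
rewrite -/(cos_transform mu Y W y) -/(sin_transform mu Y W y) -/(a y) -/(b y).
rewrite /c1 /c2 /u /v.
have -> : chi y * (cos (z * y) * ramp L y) =
  chi y * (cos (z * y) * ramp L y) * (modulus2 y * invD y).
  by rewrite /invD mulfV ?mulr1.
by rewrite /modulus2; ring.
Qed.

(** An inequality of Peetre type: the decay of a kernel survives a translation
    by y at the cost of a factor 1 + y^2, and this is where the second moment
    of Y is spent. *)
Lemma shifted_decay (z y : R) :
  (1 + (z - y) ^+ 2)^-1 <= (1 + y ^+ 2) * (2 * (1 + z ^+ 2)^-1).
Proof.
have p (x : R) : 0 < 1 + x ^+ 2 by rewrite ltr_pwDl// sqr_ge0.
rewrite mulrA ler_pdivlMr// mulrC ler_pdivrMr// -subr_ge0.
have -> : (1 + y ^+ 2) * 2 * (1 + (z - y) ^+ 2) - (1 + z ^+ 2) =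
  1 + (z - 2 * y) ^+ 2 + 2 * (y * (z - y)) ^+ 2 by ring.
by rewrite addr_ge0 ?addr_ge0 ?sqr_ge0// mulr_ge0 ?sqr_ge0.
Qed.

Section Smoothing.
Variables (r : R -> R) (M : R).
Hypothesis mr : measurable_fun setT r.
Hypothesis rM : forall s, `|r s| <= M.

Let M0 : 0 <= M. Proof. exact: le_trans (rM 0). Qed.

Let convolution_integrand s (p : T * R) : R := W p.1 * (q p.2 * r (s - p.2 - Y p.1)).

Let mconvolution_integrand s : measurable_fun setT (convolution_integrand s).
Proof.
apply: measurable_funM; first exact: (measurableT_comp mW).
apply: measurable_funM.
  apply: (measurableT_comp (f := q)) => //; exact: continuous_measurable_fun.
apply: (measurableT_comp mr); apply: measurable_funB; last exact: measurableT_comp.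
exact: measurable_funB.
Qed.

Let convolution_integrand_le s w z :
  `|convolution_integrand s (w, z)| <= W w * (M * `|q z|).
Proof.
rewrite /convolution_integrand/= normrM (ger0_norm (W0 w)) ler_wpM2l//.
by rewrite normrM mulrC ler_wpM2r.
Qed.

Let iMq : leb.-integrable setT (EFin \o (fun z => M * `|q z|)).
Proof. exact: (integrableZl measurableT M (integrable_norm iq)). Qed.

(** Replace the kernel by the average of translates of q given by
    deconvolution, and move the translation by Y from q to r with Fubini's
    theorem and the invariance of Lebesgue measure. *)
Lemma fejer_smoothing s :
  \int[leb]_z (r (s - z) * fejer L z) =
  \int[leb]_z (q z * \int[mu]_w (W w * r (s - z - Y w))).
Proof.
have [C C0 qC] := q_decay.
have mq : measurable_fun setT q by exact: continuous_measurable_fun.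
pose f (p : T * R) := W p.1 * (r (s - p.2) * q (p.2 - Y p.1)).
have mf : measurable_fun setT f.
  apply: measurable_funM; first exact: (measurableT_comp mW).
  apply: measurable_funM; first by apply: (measurableT_comp mr); exact: measurable_funB.
  by apply: (measurableT_comp mq); apply: measurable_funB => //; exact: measurableT_comp.
have ih := integrableZl measurableT (M * C * 2) (@integrable_oneDsqrV R).
have fle w z : `|f (w, z)| <= (W w * (1 + Y w ^+ 2)) * (M * C * 2 * (1 + z ^+ 2)^-1).
  rewrite /f/= normrM (ger0_norm (W0 w)) -mulrA ler_wpM2l// normrM.
  rewrite (le_trans (ler_pM _ _ (rM _) (qC _)))//.
  rewrite [leRHS](_ : _ = M * (C * ((1 + Y w ^+ 2) * (2 * (1 + z ^+ 2)^-1)))); last by ring.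
  by rewrite ler_wpM2l// ler_wpM2l// shifted_decay.
transitivity (\int[leb]_z \int[mu]_w f (w, z)).
  apply: eq_Rintegral => z _; rewrite -deconvolution -RintegralZl//.
    by apply: eq_Rintegral => w _; rewrite /f/=; ring.
  apply: (integrable_le (g := fun w => W w * C) (mWq z)).
    exact: (integrableZr measurableT C iW).
  move=> w; rewrite normrM (ger0_norm (W0 w)) ler_wpM2l// (le_trans (qC _))//.
  by rewrite ler_piMr// invf_le1 ?ltr_pwDl ?sqr_ge0// lerDl sqr_ge0.
rewrite -(@Fubini_dominated _ _ _ _ _ mu leb _ _ _ mf iW1Y2 ih fle).
transitivity (\int[mu]_w \int[leb]_z convolution_integrand s (w, z)).
  apply: eq_Rintegral => w _; rewrite /f /convolution_integrand/=.
  pose g z := W w * (q z * r (s - z - Y w)).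
  have mg : measurable_fun setT g.
    apply: measurable_funM => //; apply: measurable_funM => //.
    by apply: (measurableT_comp mr); apply: measurable_funB => //; exact: measurable_funB.
  have shiftE z : s - (z - Y w) - Y w = s - z by ring.
  rewrite -/(Rintegral _ _ g) -(@Rintegral_shift _ g (Y w))//.
    by apply: eq_Rintegral => z _; rewrite /g shiftE; ring.
  apply: (@integrable_le _ _ _ leb _ (fun z => (W w * (1 + Y w ^+ 2)) * (M * C * 2 * (1 + z ^+ 2)^-1))).
  - apply: (measurableT_comp mg); exact: measurable_funB.
  - exact: (integrableZl measurableT (W w * (1 + Y w ^+ 2)) ih).
  - move=> z; rewrite (_ : g _ = f (w, z)); first exact: fle.
    by rewrite /g /f/= shiftE; ring.
rewrite (@Fubini_dominated _ _ _ _ _ mu leb _ _ _ (mconvolution_integrand s) iW iMq (convolution_integrand_le s)).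
apply: eq_Rintegral => z _; rewrite -RintegralZl//.
  by apply: eq_Rintegral => w _; rewrite /convolution_integrand/=; ring.
apply: (integrable_le (g := fun w => W w * M)).
- apply: measurable_funM => //; apply: (measurableT_comp mr); exact: measurable_funB.
- exact: (integrableZr measurableT M iW).
- by move=> w; rewrite normrM (ger0_norm (W0 w)) ler_wpM2l.
Qed.

Let smoothing_le s : `|\int[mu]_w (W w * r (s - Y w))| <= M * \int[mu]_w W w.
Proof.
have i1 : mu.-integrable setT (EFin \o (fun w => W w * r (s - Y w))).
  apply: (integrable_le (g := fun w => M * W w)).
  - apply: measurable_funM => //; apply: (measurableT_comp mr); exact: measurable_funB.
  - exact: (integrableZl measurableT M iW).
  - by move=> w; rewrite normrM (ger0_norm (W0 w)) mulrC ler_wpM2r.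
rewrite (le_trans (le_normr_Rintegral _ i1))// -RintegralZl// le_Rintegral//.
- exact: (integrable_norm i1).
- exact: (integrableZl measurableT M iW).
- by move=> w _; rewrite normrM (ger0_norm (W0 w)) mulrC ler_wpM2r.
Qed.

(** In fejer_smoothing the inner integral is the given function at s - z; it
    is bounded and q is integrable, so the limit passes under the outer
    integral. *)
Lemma cvg_smoothing_filter (l : R) :
  \int[mu]_w (W w * r (s - Y w)) @[s --> +oo] --> l ->
  \int[leb]_z (r (s - z) * fejer L z) @[s --> +oo] --> l * \int[leb]_z q z.
Proof.
move=> /cvg_pinftyP hl; apply/cvg_pinftyP => s_ s_oo.
under eq_fun do rewrite fejer_smoothing.
rewrite -RintegralZl//.
apply: (@dominated_cvg_Rintegral _ _ _ leb _ _ ( fun z => (M * \int[mu]_w W w) * `|q z|)).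
- move=> n.
  have := @measurable_Rintegral_dominated _ _ _ _ _ mu leb _ _ _ (mconvolution_integrand (s_ n)) iW iMq
    (convolution_integrand_le (s_ n)).
  congr measurable_fun; apply/funext => z; rewrite -RintegralZl//.
    by apply: eq_Rintegral => w _; rewrite /convolution_integrand/=; ring.
  apply: (integrable_le (g := fun w => M * W w)).
  - apply: measurable_funM => //; apply: (measurableT_comp mr); exact: measurable_funB.
  - exact: (integrableZl measurableT M iW).
  - by move=> w; rewrite normrM (ger0_norm (W0 w)) mulrC ler_wpM2r.
- exact: (integrableZl measurableT (M * \int[mu]_w W w) (integrable_norm iq)).
- by move=> n z; rewrite normrM mulrC ler_wpM2r.
- move=> z; rewrite mulrC; apply: cvgM; first exact: cvg_cst.
  apply: (hl (fun n => s_ n - z)).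
  apply/cvgryPge => A; move/cvgryPge : s_oo => /(_ (A + z)).
  by apply: filterS => n; rewrite lerBrDr.
Qed.

End Smoothing.

(* The case r = 1 of fejer_smoothing. *)
Let mass_q : \int[leb]_z fejer L z = (\int[mu]_w W w) * \int[leb]_z q z.
Proof.
have := @fejer_smoothing (fun=> 1) 1 _ _ 0.
under eq_Rintegral do rewrite mul1r.
move=> ->//; last by move=> s; rewrite normr1.
under eq_Rintegral => z _.
  under eq_Rintegral do rewrite mulr1.
  rewrite mulrC; over.
by rewrite RintegralZl.
Qed.

Lemma mass_neq0 : \int[mu]_w W w != 0.
Proof.
have := ab0 0; rewrite b_0 xpair_eqE eqxx andbT /a /cos_transform.
by under eq_Rintegral do rewrite mul0r cos0 mulr1.
Qed.

(** Wiener's theorem for the Fejer kernels: convergence of the convolution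
    with one measure, whose transform has no zero, implies convergence of the
    convolution with each of these kernels, and the limits are in the ratio of
    the total masses. *)
Lemma cvg_fejer_smoothing (r : R -> R) (M l : R) :
  measurable_fun setT r -> (forall s, `|r s| <= M) ->
  \int[mu]_w (W w * r (s - Y w)) @[s --> +oo] --> l ->
  \int[leb]_z (r (s - z) * fejer L z) @[s --> +oo] -->
    l / (\int[mu]_w W w) * \int[leb]_z fejer L z.
Proof.
move=> mr rM rl.
by rewrite mass_q mulrA divfK ?mass_neq0//; exact: cvg_smoothing_filter rl.
Qed.

End Wiener.

(** * A Tauberian theorem for slowly decreasing functions *)

Section Tauberian.
Context {R : realType}.
Local Notation leb := (@lebesgue_measure R).
Variables (K : R -> R -> R) (c0 : R).
Hypothesis c0_gt0 : 0 < c0.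
Hypothesis K0 : forall L x, 0 < L -> 0 <= K L x.
Hypothesis iK : forall L, 0 < L -> leb.-integrable setT (EFin \o K L).
Hypothesis K_tail : forall L x, 0 < L -> x ^+ 2 * K L x <= 2 * L^-1.
Hypothesis K_bulk : forall L x, 0 < L -> `|x| <= L^-1 -> c0 * L <= K L x.

Let inside (e : R) : R -> R := \1_(`[- e, e]).

Let inside01 e x : 0 <= inside e x <= 1.
Proof. by rewrite /inside indicE; case: (_ \in _); rewrite ?lexx ?ler01. Qed.

Let inside1 e x : `|x| <= e -> inside e x = 1.
Proof. by rewrite ler_norml /inside indicE => h; rewrite mem_set//= in_itv. Qed.

Let inside0 e x : e < `|x| -> inside e x = 0.
Proof.
by rewrite ltNge ler_norml /inside indicE => /negP h; rewrite memNset//= in_itv.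
Qed.

Let minside e : measurable_fun setT (inside e).
Proof. exact: measurable_indic. Qed.

Let mK L : 0 < L -> measurable_fun setT (K L).
Proof. by move=> /iK i; apply/measurable_EFinP; exact: measurable_int i. Qed.

Let iKb L (f : R -> R) (B : R) : 0 < L -> measurable_fun setT f ->
  (forall x, `|f x| <= B) -> leb.-integrable setT (EFin \o (fun x => f x * K L x)).
Proof.
move=> L0 mf fB; apply: (@integrable_le _ _ _ leb _ (fun x => B * K L x)).
- by apply: measurable_funM => //; exact: mK.
- exact: (integrableZl measurableT B (iK L0)).
- by move=> x; rewrite normrM (ger0_norm (K0 x L0)) ler_wpM2r// K0.
Qed.

Let mass_in e L := \int[leb]_x (inside e x * K L x).
Let mass_out e L := \int[leb]_x ((1 - inside e x) * K L x).

Let iin e L : 0 < L -> leb.-integrable setT (EFin \o (fun x => inside e x * K L x)).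
Proof.
move=> L0; apply: (iKb (B := 1)) => // x; have /andP[h1 h2] := inside01 e x.
by rewrite ger0_norm.
Qed.

Let iout e L : 0 < L ->
  leb.-integrable setT (EFin \o (fun x => (1 - inside e x) * K L x)).
Proof.
move=> L0; apply: (iKb (B := 1)) => //; first exact: measurable_funB.
move=> x; have /andP[h1 h2] := inside01 e x.
by rewrite ger0_norm ?subr_ge0// gerBl.
Qed.

Let mass_split e L : 0 < L -> \int[leb]_x K L x = mass_in e L + mass_out e L.
Proof.
move=> L0; rewrite -RintegralD//; [|exact: iin|exact: iout].
by apply: eq_Rintegral => x _; ring.
Qed.

Let mass_out_ge0 e L : 0 < L -> 0 <= mass_out e L.
Proof.
move=> L0; apply: Rintegral_ge0 => x _; rewrite mulr_ge0 ?K0// subr_ge0.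
by have /andP[] := inside01 e x.
Qed.

(* The kernel is at least c0 L on an interval of length 2 / L. *)
Let mass_in_ge e L : 0 < L -> L^-1 <= e -> c0 <= mass_in e L.
Proof.
move=> L0 Le; have Lv : 0 < L^-1 by rewrite invr_gt0.
have iI : leb.-integrable setT (EFin \o (fun x => inside L^-1 x * (c0 * L))).
  rewrite (_ : EFin \o _ = fun x => (inside L^-1 x)%:E * (c0 * L)%:E)%E//.
  by apply: integrableZr => //; exact: integrable_indic_itv.
have eqI : \int[leb]_x (inside L^-1 x * (c0 * L)) = 2 * c0.
  rewrite RintegralZr//; last exact: integrable_indic_itv.
  have hm : leb `[- L^-1, L^-1] = (L^-1 + L^-1)%:E.
    rewrite lebesgue_measure_itv/= lte_fin gtrN// -EFinB/=; congr EFin; ring.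
  rewrite /Rintegral integral_indic// setIT [X in fine X]hm/=.
  by field; rewrite gt_eqF.
apply: (@le_trans _ _ (2 * c0)); first by rewrite ler_peMl ?(ltW c0_gt0)// ler1n.
rewrite -eqI; apply: le_Rintegral => //; first exact: iin.
move=> x _; have [xL|xL] := leP `|x| L^-1; last first.
  by rewrite inside0// mul0r mulr_ge0 ?K0//; have /andP[] := inside01 e x.
by rewrite !inside1 ?mul1r ?(le_trans xL)//; exact: K_bulk.
Qed.

Let mass_out_le e : 0 < e ->
  exists2 C : R, 0 <= C & forall L, 0 < L -> mass_out e L <= C * L^-1.
Proof.
move=> e0.
have iN := @integrable_oneDsqrV R.
pose N := \int[leb]_x (1 + x ^+ 2)^-1 : R.
have N0 : 0 <= N.
  by apply: Rintegral_ge0 => x _; rewrite invr_ge0 addr_ge0 ?sqr_ge0.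
exists (2 * (1 + e ^- 2) * N).
  by rewrite mulr_ge0// mulr_ge0// addr_ge0// invr_ge0 sqr_ge0.
move=> L L0.
have -> : 2 * (1 + e ^- 2) * N * L^-1 =
    \int[leb]_x (2 * (1 + e ^- 2) * L^-1 * (1 + x ^+ 2)^-1).
  by rewrite RintegralZl// -/N; ring.
apply: le_Rintegral => //.
- exact: iout.
- exact: (integrableZl measurableT (2 * (1 + e ^- 2) * L^-1) iN).
move=> x _; have [xe|xe] := leP `|x| e.
  rewrite inside1// subrr mul0r mulr_ge0//.
    by rewrite mulr_ge0 ?invr_ge0 ?(ltW L0)// mulr_ge0// addr_ge0// invr_ge0 sqr_ge0.
  by rewrite invr_ge0 addr_ge0 ?sqr_ge0.
rewrite inside0// subr0 mul1r ler_pdivlMr; last by rewrite ltr_pwDl// sqr_ge0.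
have := K_tail x L0; have := K0 x L0; set k := K L x => k0 kx.
have x2 : e ^+ 2 <= x ^+ 2 by rewrite -(real_normK (num_real x)) ler_sqr ?nnegrE// ltW.
have e2 : 0 < e ^+ 2 by rewrite exprn_gt0.
have kx2 : k <= e ^- 2 * (x ^+ 2 * k).
  by rewrite mulrA ler_peMl// mulrC ler_pdivlMr// mul1r.
rewrite mulrDr mulr1 [k * _]mulrC.
rewrite [leRHS](_ : _ = e ^- 2 * (2 * L^-1) + 2 * L^-1); last by ring.
rewrite lerD// (le_trans kx2)// ler_wpM2l// invr_ge0 ltW//.
Qed.

Variables (r : R -> R) (M c : R).
Hypothesis mr : measurable_fun setT r.
Hypothesis r0 : forall s, 0 <= r s.
Hypothesis rM : forall s, r s <= M.
Hypothesis slow : forall rho : R, 1 < rho -> exists2 e : R, 0 < e &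
  exists S : R, forall s h, S <= s -> 0 <= h <= e -> r s <= rho * r (s - h).
Hypothesis rK : forall L, 0 < L ->
  \int[leb]_z (r (s - z) * K L z) @[s --> +oo] --> c * \int[leb]_z K L z.

Let M0 : 0 <= M. Proof. exact: le_trans (r0 0) (rM 0). Qed.

Let irK L s : 0 < L -> leb.-integrable setT (EFin \o (fun z => r (s - z) * K L z)).
Proof.
move=> L0; apply: (iKb (B := M)) => //.
  by apply: (measurableT_comp mr); exact: measurable_funB.
by move=> x; rewrite ger0_norm.
Qed.

Let mass_gt0 L : 0 < L -> 0 < \int[leb]_x K L x.
Proof.
move=> L0; rewrite (mass_split L^-1 L0) ltr_pwDl ?mass_out_ge0//.
exact: lt_le_trans (mass_in_ge L0 (lexx _)).
Qed.

Let c_ge0 : 0 <= c.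
Proof.
rewrite -(pmulr_lge0 _ (mass_gt0 ltr01)); apply: (cvgr_to_ge (rK ltr01)); apply: nearW => s.
by apply: Rintegral_ge0 => z _; rewrite mulr_ge0 ?K0.
Qed.

Let concentrate (e k : R) : 0 < e -> 0 < k ->
  exists2 L : R, 0 < L & 0 < mass_in e L /\ mass_out e L <= k * mass_in e L.
Proof.
move=> e0 k0; have [C C0 hC] := mass_out_le e0.
pose L := e^-1 + C / (k * c0).
have kc : 0 < k * c0 by rewrite mulr_gt0.
have L0 : 0 < L by rewrite ltr_pwDl ?invr_gt0// divr_ge0 ?(ltW kc).
have Le : L^-1 <= e.
  by rewrite -[leRHS]invrK lef_pV2 ?posrE ?invr_gt0// lerDl divr_ge0 ?(ltW kc).
have h := mass_in_ge L0 Le.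
exists L => //; split; first exact: lt_le_trans h.
rewrite (le_trans (hC _ L0))// (@le_trans _ _ (k * c0))//; last by rewrite ler_pM2l.
rewrite ler_pdivrMr// mulrDr mulrCA divff ?mulr1 ?gt_eqF// lerDr.
by rewrite mulr_ge0 ?(ltW kc)// invr_ge0 ltW.
Qed.

(** The means are taken over a window of half-width e, centred at s - e or at
    s + e, so that s lies at one end. Across a window r grows by at most a
    factor 1 + k; hence r s is at most (1 + k) times its values on the left
    window, and at least (1 + k)^-1 times those on the right one. For L large
    the kernel gives the complement of the window at most k times the mass of
    the window. *)
Lemma slowly_decreasing_squeeze (k : R) : 0 < k ->
  \forall s \near +oo,
     r s <= (1 + k) * (c + k * (c + 1)) /\ c - k * (1 + M) <= (1 + k) * r s.
Proof.
move=> k0; have k1 : 0 < 1 + k by rewrite ltr_wpDl.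
have k11 : 1 < 1 + k by rewrite ltrDl.
have [e2 e20 [S hS]] := slow k11.
pose e := e2 / 2; have e0 : 0 < e by rewrite divr_gt0.
have e2E : e2 = e + e by rewrite /e; lra.
have [L L0 [in0 out_in]] := concentrate e0 k0.
have outL := mass_out_ge0 e L0.
pose I := mass_in e L.
have kI : 0 < k * I by rewrite mulr_gt0.
have /cvgrPdist_le /(_ _ kI) := rK L0; rewrite (mass_split e L0) -/I => rKI.
have [A [_ hA]] := rKI.
near=> s.
have Ss : S <= s by near: s; apply: nbhs_pinfty_ge; exact: num_real.
have As1 : A < s - e by rewrite ltrBrDr; near: s; apply: nbhs_pinfty_gt; exact: num_real.
have As2 : A < s + e by apply: (lt_trans As1); rewrite ltrBlDr -addrA ltrDl addr_gt0.
have low : I * r s <= (1 + k) * \int[leb]_z (r (s - e - z) * K L z).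
  rewrite -RintegralZl//; last exact: irK.
  rewrite -RintegralZr//; last exact: iin.
  apply: le_Rintegral => //.
  - exact: (integrableZr measurableT (r s) (iin e L0)).
  - exact: (integrableZl measurableT (1 + k) (irK (s - e) L0)).
  move=> z _; have [ze|ze] := leP `|z| e; last first.
    by rewrite inside0// !mul0r mulr_ge0 ?(ltW k1)// mulr_ge0 ?K0.
  rewrite inside1// mul1r mulrA mulrC ler_wpM2r ?K0//.
  rewrite (_ : s - e - z = s - (e + z)); last by ring.
  apply: hS => //; move: ze; rewrite ler_norml => /andP[? ?]; apply/andP; split; lra.
have high : \int[leb]_z (r (s + e - z) * K L z) <= (1 + k) * r s * I + M * mass_out e L.
  rewrite -RintegralZl//; last exact: iin.
  rewrite -[in leRHS]RintegralZl//; last exact: iout.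
  rewrite -RintegralD//; last 2 first.
    exact: (integrableZl measurableT ((1 + k) * r s) (iin e L0)).
    exact: (integrableZl measurableT M (iout e L0)).
  apply: le_Rintegral => //.
  - exact: irK.
  - exact: (integrableD measurableT
      (integrableZl measurableT ((1 + k) * r s) (iin e L0))
      (integrableZl measurableT M (iout e L0))).
  move=> z _; have [ze|ze] := leP `|z| e; last first.
    by rewrite inside0// subr0 !mul0r mulr0 add0r mul1r ler_wpM2r ?K0.
  rewrite inside1// subrr mul0r mulr0 addr0 mul1r ler_wpM2r ?K0//.
  move: ze; rewrite ler_norml => /andP[z1 z2].
  rewrite [in leRHS](_ : s = s + e - z - (e - z)); last by ring.
  by apply: hS; [lra|apply/andP; split; lra].
have := hA _ As1; have := hA _ As2; rewrite /= !ler_norml.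
move=> /andP[_ h2] /andP[h1 _].
have cout := ler_wpM2l c_ge0 out_in; have Mout := ler_wpM2l M0 out_in.
rewrite -/I in cout Mout; split.
  rewrite -(ler_pM2l in0) -/I (le_trans low)// [leRHS]mulrCA ler_pM2l//.
  have : c * (k * I) = k * c * I by ring.
  by nra.
rewrite -(ler_pM2l in0) -/I.
have := ler_wpM2l c_ge0 outL; rewrite mulr0 => cout0.
by nra.
Unshelve. all: by end_near. Qed.

Lemma tauberian_slowly_decreasing : r s @[s --> +oo] --> c.
Proof.
apply/cvgrPdist_le => e e0.
(* For k <= 1 both bounds of the squeeze are within k D of c. *)
pose D := 3 * c + 3 + M.
have D0 : 0 < D by rewrite /D; have := c_ge0; have := M0; lra.
pose k := Num.min 1 (e / D).
have k0 : 0 < k by rewrite /k lt_min ltr01 divr_gt0.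
have k1 : k <= 1 by rewrite /k ge_min lexx.
have kD : k * D <= e by rewrite -ler_pdivlMr// /k ge_min lexx orbT.
have := slowly_decreasing_squeeze k0; apply: filterS => s [h1 h2].
have := c_ge0; have := M0; rewrite ler_norml; rewrite /D in kD => M0' c0'.
have kk : k * k <= k by rewrite ler_piMl// ltW.
have ckk := ler_wpM2l c0' kk.
by apply/andP; split; nra.
Qed.

End Tauberian.

(** * Regularly varying tails *)

Section RegularVariation.
Context {R : realType}.

Lemma dyadic_bracket (y : R) : 1 <= y -> exists n : nat, 2 ^+ n <= y < 2 ^+ n.+1.
Proof.
move=> y1.
have ex : exists n, y < 2 ^+ n.
  exists (Num.truncn y).+1; rewrite (lt_trans (truncnS_gt y))//.
  by rewrite -natrX ltr_nat ltn_expl.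
pose m := ex_minn ex; have : y < 2 ^+ m by rewrite /m; case: ex_minnP.
have : forall k, y < 2 ^+ k -> (m <= k)%N by rewrite /m; case: ex_minnP.
case: m => [_|m mmin ym]; first by rewrite expr0 ltNge y1.
by exists m; rewrite ym andbT leNgt; apply/negP => /mmin; rewrite ltnn.
Qed.

Lemma powR2_lt (x y : R) : x < y -> 2 `^ x < 2 `^ y :> R.
Proof.
by move=> xy; rewrite /powR gt_eqF// ltr_expR ltr_pM2r// ln_gt0// ltr1n.
Qed.

Lemma powR2_ge1 (x : R) : 0 <= x -> 1 <= 2 `^ x :> R.
Proof.
have h2 : 1 <= 2 :> R by rewrite ler1n.
by move=> x0; have := ler_powR h2 x0; rewrite powRr0.
Qed.

Variables (g : R -> R) (alpha : R).
Hypothesis g_gt0 : forall x, 0 < g x.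
Hypothesis g_le1 : forall x, g x <= 1.
Hypothesis g_nincr : forall x y, x <= y -> g y <= g x.
Hypothesis g_rv : forall t, 0 < t -> g (t * x) / g x @[x --> +oo] --> t `^ (- alpha).
Hypothesis alpha0 : 0 < alpha.

Lemma regular_variation_le (t e : R) : 0 < t -> 0 < e ->
  \forall x \near +oo, g (t * x) <= (1 + e) * t `^ (- alpha) * g x.
Proof.
move=> t0 e0; have ta : 0 < t `^ (- alpha) by rewrite powR_gt0.
have h : t `^ (- alpha) < (1 + e) * t `^ (- alpha) by rewrite ltr_pMl// ltrDl.
apply: filterS (cvgr_le _ (g_rv t0) _ h) => x.
by rewrite ler_pdivrMr.
Qed.

Lemma regular_variation_ge (t e : R) : 0 < t -> e < 1 ->
  \forall x \near +oo, e * t `^ (- alpha) * g x <= g (t * x).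
Proof.
move=> t0 e0; have ta : 0 < t `^ (- alpha) by rewrite powR_gt0.
have h : e * t `^ (- alpha) < t `^ (- alpha) by rewrite gtr_pMl.
apply: filterS (cvgr_ge _ (g_rv t0) _ h) => x.
by rewrite ler_pdivlMr.
Qed.

Variable eta : R.
Hypothesis eta_gt0 : 0 < eta.
Hypothesis eta_alpha : eta < alpha.

(** Beyond some x0, doubling the argument multiplies g by a factor between
    2^-(alpha + eta) and 2^-(alpha - eta). Iterating this upwards settles
    theta <= 1, after rounding 1 / theta down to a power of 2; iterating it
    downwards settles theta > 1. *)
Lemma potter_bound : exists C x0 : R, [/\ 0 < C, 0 < x0 & forall x theta,
  x0 <= x -> 0 < theta ->
  g (x / theta) <= C * g x * (theta `^ (alpha + eta) + theta `^ (alpha - eta))].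
Proof.
pose p := alpha - eta; pose q := alpha + eta.
have p0 : 0 < p by rewrite subr_gt0.
have q0 : 0 < q by rewrite addr_gt0.
have two0 : 0 < 2 :> R by [].
have rv2 : \forall x \near +oo, g (2 * x) <= 2 `^ (- p) * g x /\
                                g x <= 2 `^ q * g (2 * x).
  have h1 : 2 `^ (- alpha) < 2 `^ (- p) :> R.
    by rewrite powR2_lt// ltrN2 gtrBl.
  have h2 : 2 `^ (- q) < 2 `^ (- alpha) :> R.
    by rewrite powR2_lt// ltrN2 ltrDl.
  apply: filterS2 (cvgr_le _ (g_rv two0) _ h1) (cvgr_ge _ (g_rv two0) _ h2) => x.
  rewrite ler_pdivrMr// ler_pdivlMr// => ? ?; split => //.
  by rewrite mulrC -ler_pdivrMr ?powR_gt0// -powRN mulrC.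
have [A [_ hA]] := rv2.
pose x0 := Num.max 1 (A + 1).
have x00 : 0 < x0 by rewrite /x0 lt_max ltr01.
have hx0 x : x0 <= x -> g (2 * x) <= 2 `^ (- p) * g x /\ g x <= 2 `^ q * g (2 * x).
  rewrite /x0 ge_max => /andP[_ Ax]; apply: hA.
  by rewrite (lt_le_trans _ Ax)// ltrDl.
have up n x : x0 <= x -> g (2 ^+ n * x) <= (2 `^ (- p)) ^+ n * g x.
  move=> xx0; elim: n => [|n IH]; first by rewrite !expr0 !mul1r.
  have xn : x0 <= 2 ^+ n * x.
    rewrite (le_trans xx0)// ler_peMl ?(le_trans (ltW x00))// exprn_ege1// ler1n//.
  rewrite exprS -mulrA; have [+ _] := hx0 _ xn; move/le_trans; apply.
  by rewrite exprS -mulrA ler_wpM2l// powR_ge0.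
(* The descent may leave the range of the doubling estimate: below 2 x0 the
   trivial bound g <= 1 is used instead, and costs the factor D. *)
pose D := (g (2 * x0))^-1.
have D1 : 1 <= D by rewrite invf_ge1.
have two_q n : 1 <= (2 `^ q) ^+ n :> R.
  by rewrite exprn_ege1// powR2_ge1// ltW.
have down n x : x0 <= x -> g (x / 2 ^+ n) <= D * (2 `^ q) ^+ n * g x.
  elim: n x => [|n IH] x xx0.
    by rewrite !expr0 divr1 mulr1 ler_peMl// ltW.
  have [xs|xb] := ltP x (2 * x0).
    rewrite (le_trans (g_le1 _))// -mulrA [_ * g x]mulrC mulrA.
    rewrite (@le_trans _ _ (D * g x))//; last first.
      by rewrite ler_peMr// mulr_ge0// ?(ltW (g_gt0 _))// (le_trans ler01).
    by rewrite /D mulrC ler_pdivlMr// mul1r g_nincr// ltW.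
  have xh : x0 <= x / 2 by rewrite ler_pdivlMr// mulrC.
  rewrite exprS invfM mulrA; have /le_trans := IH _ xh; apply.
  have [_ h] := hx0 _ xh; rewrite mulrC (le_trans (ler_wpM2r _ h))//.
    by rewrite mulr_ge0// (le_trans ler01).
  by rewrite [2 * _]mulrC divfK// exprS le_eqVlt; apply/orP; left; apply/eqP; ring.
exists (2 `^ p + D * 2 `^ q), x0; split => //.
  by rewrite addr_gt0 ?powR_gt0// mulr_gt0 ?powR_gt0// (lt_le_trans ltr01).
move=> x t xx0 t0.
have x_gt0 : 0 < x by exact: lt_le_trans xx0.
have tq : 0 <= t `^ q by exact: powR_ge0.
have tp : 0 <= t `^ p by exact: powR_ge0.
rewrite -/q -/p; have [t1|t1] := leP t 1.
  have tV1 : 1 <= t^-1 by rewrite invf_ge1.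
  have [n /andP[n1 n2]] := dyadic_bracket tV1.
  have h1 : g (x / t) <= (2 `^ (- p)) ^+ n * g x.
    by rewrite (le_trans _ (up n x xx0))// g_nincr// mulrC ler_pM2l.
  have h2 : (2 `^ (- p)) ^+ n <= 2 `^ p * t `^ p.
    have -> : (2 `^ (- p)) ^+ n = ((2 ^+ n) `^ p)^-1 :> R.
      rewrite powRN exprVn -powR_mulrn ?powR_ge0// -powRrM mulrC powRrM.
      by rewrite powR_mulrn.
    rewrite -[leLHS]mul1r ler_pdivrMr ?powR_gt0 ?exprn_gt0//.
    rewrite -!powRM ?exprn_ge0 ?mulr_ge0 ?(ltW t0)//.
    have h : 1 <= 2 * t * 2 ^+ n.
      have h' := ltW n2; rewrite -(ler_pM2r t0) mulVf ?gt_eqF// in h'.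
      by rewrite mulrAC -exprS.
    have h0 : 0 <= 2 * t * 2 ^+ n by exact: le_trans ler01 h.
    by have := ge0_ler_powR (ltW p0) (ler01 : 1 \in Num.nneg) h0 h; rewrite powR1.
  rewrite (le_trans h1)// (le_trans (ler_wpM2r (ltW (g_gt0 x)) h2))//.
  have := g_gt0 x; set gx := g x => gx0.
  have : 0 <= D * 2 `^ q * gx * (t `^ q + t `^ p).
    by rewrite !mulr_ge0 ?addr_ge0 ?powR_ge0 ?(ltW gx0)// (le_trans ler01).
  have : 0 <= 2 `^ p * gx * t `^ q by rewrite !mulr_ge0 ?powR_ge0 ?(ltW gx0).
  by move=> ? ?; rewrite -subr_ge0; set X := (X in 0 <= X);
     rewrite (_ : X = D * 2 `^ q * gx * (t `^ q + t `^ p) + 2 `^ p * gx * t `^ q);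
     [rewrite addr_ge0|rewrite /X; ring].
have [n /andP[n1 n2]] := dyadic_bracket (ltW t1).
have h1 : g (x / t) <= D * (2 `^ q) ^+ n.+1 * g x.
  rewrite (le_trans _ (down n.+1 x xx0))// g_nincr// ler_pM2l//.
  by rewrite lef_pV2 ?posrE ?exprn_gt0// ltW.
have h2 : (2 `^ q) ^+ n.+1 <= 2 `^ q * t `^ q.
  rewrite exprS ler_wpM2l ?powR_ge0// -powR_mulrn ?powR_ge0// -powRrM mulrC powRrM.
  rewrite powR_mulrn//; apply: (ge0_ler_powR (ltW q0)) n1.
    by rewrite nnegrE exprn_ge0.
  by rewrite nnegrE ltW.
rewrite (le_trans h1)//.
have := g_gt0 x; set gx := g x => gx0.
have h3 : D * (2 `^ q) ^+ n.+1 * gx <= D * (2 `^ q * t `^ q) * gx.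
  by rewrite ler_wpM2r ?(ltW gx0)// ler_wpM2l// (le_trans ler01).
rewrite (le_trans h3)//.
have : 0 <= D * 2 `^ q * gx * t `^ p.
  by rewrite !mulr_ge0 ?powR_ge0 ?(ltW gx0)// (le_trans ler01).
have : 0 <= 2 `^ p * gx * (t `^ q + t `^ p).
  by rewrite !mulr_ge0 ?addr_ge0 ?powR_ge0 ?(ltW gx0).
by move=> ? ?; rewrite -subr_ge0; set X := (X in 0 <= X);
     rewrite (_ : X = D * 2 `^ q * gx * t `^ p + 2 `^ p * gx * (t `^ q + t `^ p));
     [rewrite addr_ge0|rewrite /X; ring].
Qed.

Variables (F : R -> R).
Hypothesis F_ge0 : forall x, 0 <= F x.
Hypothesis F_nincr : forall x y, x <= y -> F y <= F x.

(** F is nonincreasing, so over a step h the ratio grows only through the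
    decrease of g, and regular variation controls the latter over a factor
    e^h. *)
Lemma ratio_slowly_decreasing (rho : R) : 1 < rho -> exists2 e : R, 0 < e &
  exists S : R, forall s h, S <= s -> 0 <= h <= e ->
    F (expR s) / g (expR s) <= rho * (F (expR (s - h)) / g (expR (s - h))).
Proof.
move=> rho1; have rho0 : 0 < rho by exact: lt_trans rho1.
pose e := ln rho / (2 * alpha).
have lr0 : 0 < ln rho by rewrite ln_gt0.
have e0 : 0 < e by rewrite divr_gt0// mulr_gt0.
exists e => //.
(* The choice of e makes expR e `^ (- alpha) equal to rho `^ (- 1 / 2). *)
have ea : rho^-1 < expR e `^ (- alpha).
  rewrite /powR gt_eqF ?expR_gt0// expRK -[rho^-1]lnK ?posrE ?invr_gt0//.
  rewrite ltr_expR lnV ?posrE// mulNr ltrN2 /e.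
  rewrite (_ : alpha * _ = ln rho / 2); last by field; rewrite gt_eqF.
  by rewrite ltr_pdivrMr// ltr_pMr// ltr1n.
have /= [A [_ hA]] : \forall x \near +oo, rho^-1 <= g (expR e * x) / g x.
  exact: (cvgr_ge _ (g_rv (expR_gt0 e)) _ ea).
exists (ln (Num.max 1 A) + e + 1) => s h Ss /andP[h0 he].
have Ax : A < expR (s - e).
  rewrite (@le_lt_trans _ _ (Num.max 1 A))//; first by rewrite le_max lexx orbT.
  rewrite -[ltLHS]lnK ?posrE ?lt_max ?ltr01// ltr_expR; lra.
have := hA _ Ax; rewrite -expRD addrCA subrr addr0 ler_pdivlMr// => gg.
have gh : g (expR (s - h)) <= rho * g (expR s).
  rewrite (@le_trans _ _ (g (expR (s - e))))//.
    by rewrite g_nincr// ler_expR lerD2l lerN2.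
  by rewrite mulrC -ler_pdivrMr// mulrC.
have Fh : F (expR s) <= F (expR (s - h)) by rewrite F_nincr// ler_expR gerBl.
rewrite mulrA ler_pdivrMr// mulrAC ler_pdivlMr//.
rewrite (le_trans (ler_pM _ _ Fh gh))// ?(ltW (g_gt0 _))//.
by rewrite mulrA [F _ * rho]mulrC.
Qed.

End RegularVariation.

(** * Tails of independent products *)

Section ProductTail.
Context d (T : measurableType d) (R : realType) (P : probability T R).
Implicit Types U V : {RV P >-> R}.

(** Real-valued probabilities, so that estimates can be combined by linear
    arithmetic. *)
Definition pr (A : set T) : R := fine (P A).

Lemma prE A : measurable A -> P A = (pr A)%:E.
Proof. by move=> mA; rewrite fineK// fin_num_measure. Qed.

Lemma integral_indic_pr A : measurable A ->
  (\int[P]_w (\1_A w)%:E = (pr A)%:E)%E.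
Proof. by move=> mA; rewrite integral_indic// setIT; exact: prE. Qed.

Lemma pr_ge0 A : 0 <= pr A. Proof. exact: fine_ge0. Qed.

Lemma pr_le1 A : measurable A -> pr A <= 1.
Proof. by move=> mA; rewrite -lee_fin -prE// probability_le1. Qed.

Lemma le_pr A B : measurable A -> measurable B -> A `<=` B -> pr A <= pr B.
Proof. by move=> mA mB AB; rewrite -lee_fin -!prE// le_measure// inE. Qed.

Lemma pr_setU_le A B : measurable A -> measurable B -> pr (A `|` B) <= pr A + pr B.
Proof.
move=> mA mB; rewrite -lee_fin EFinD -!prE//; last exact: measurableU.
exact: measureU2.
Qed.

Lemma pr_bigsetU_le (I : Type) (s : seq I) (A : I -> set T) :
  (forall i, measurable (A i)) ->
  pr (\big[setU/set0]_(i <- s) A i) <= \sum_(i <- s) pr (A i).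
Proof.
move=> mA; elim: s => [|i s IH]; first by rewrite !big_nil /pr measure0.
rewrite !big_cons (le_trans (pr_setU_le _ _))// ?lerD2l//.
exact: bigsetU_measurable.
Qed.

Lemma pr_bigsetU_le_cond (I : Type) (s : seq I) (Q : pred I) (A : I -> set T) :
  (forall i, measurable (A i)) ->
  pr (\big[setU/set0]_(i <- s | Q i) A i) <= \sum_(i <- s | Q i) pr (A i).
Proof.
by move=> mA; have := pr_bigsetU_le [seq i <- s | Q i] mA; rewrite !big_filter.
Qed.

Lemma measurable_gt (f : T -> R) (y : R) : measurable_fun setT f ->
  measurable [set w | y < f w].
Proof.
move=> mf; rewrite -[X in measurable X]setTI.
have := mf measurableT `]y, +oo[%classic; rewrite (_ : _ @^-1` _ = [set w | y < f w]).
  by apply.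
by apply/seteqP; split => w /=; rewrite in_itv/= andbT.
Qed.

Lemma tailE (f : T -> R) x : tail P (EFin \o f) x = pr [set w | x < f w].
Proof. by rewrite /tail; under eq_set => w do rewrite /= lte_fin. Qed.

Lemma tail_ge0 (f : T -> \bar R) x : 0 <= tail P f x.
Proof. exact: fine_ge0. Qed.

Lemma tail_le1 V x : tail P (EFin \o V) x <= 1.
Proof.
by rewrite tailE; apply: pr_le1; exact: measurable_gt.
Qed.

Lemma tail_nincr V x y : x <= y -> tail P (EFin \o V) y <= tail P (EFin \o V) x.
Proof.
move=> xy; rewrite !tailE.
apply: le_pr; [exact: measurable_gt|exact: measurable_gt|].
by move=> w /=; exact: le_lt_trans.
Qed.

Lemma measurable_tail V : measurable_fun setT (tail P (EFin \o V)).
Proof. by apply: nonincreasing_measurable => // x y; exact: tail_nincr. Qed.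

Definition independent_pair U V := forall A B : set R, measurable A -> measurable B ->
  (P (U @^-1` A `&` V @^-1` B) = P (U @^-1` A) * P (V @^-1` B))%E.

(** Independence determines the joint law on rectangles, hence everywhere by
    uniqueness of the product measure, whose value is the integral of the
    measures of the sections. *)
Lemma joint_law U V (C : set (R * R)) : independent_pair U V -> measurable C ->
  (P ((fun w => (U w, V w)) @^-1` C) =
   \int[P]_w distribution P V (xsection C (U w)))%E.
Proof.
move=> UV mC.
have mUV : measurable_fun setT (fun w => (U w, V w)) by exact: measurable_fun_pair.
pose UVm : {mfun T >-> (R * R)%type} := HB.pack (fun w => (U w, V w))
  (isMeasurableFun.Build _ _ _ _ _ mUV).
have := @product_measure_unique _ _ _ _ _ (distribution P U) (distribution P V)
  (distribution P UVm) UV C mC.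
move=> h; transitivity (distribution P UVm C) => //; rewrite -h.
rewrite /product_measure1 ge0_integral_distribution//.
exact: measurable_fun_xsection.
Qed.

(** For a given value of U, the product exceeds y exactly when V exceeds
    y / U. *)
Lemma product_tail U V (B : set R) (y : R) : independent_pair U V ->
  (forall w, 0 < U w) -> measurable B ->
  pr [set w | B (U w) /\ y < U w * V w] =
  \int[P]_w (\1_B (U w) * tail P (EFin \o V) (y / U w)).
Proof.
move=> UV U0 mB.
pose C := [set p : R * R | B p.1 /\ y < p.1 * p.2].
have mC : measurable C.
  apply: measurableI.
    have := (@measurable_fst _ _ R R) measurableT B mB; rewrite setTI.
    by apply.
  have mf : measurable_fun setT (fun p : R * R => p.1 * p.2) by exact: measurable_funM.
  rewrite -[X in measurable X]setTI.
  have := mf measurableT `]y, +oo[%classic; rewrite (_ : _ @^-1` _ = [set p | y < p.1 * p.2]).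
    by apply.
  by apply/seteqP; split => w /=; rewrite in_itv/= andbT.
have := joint_law UV mC; rewrite /pr /Rintegral => h.
congr fine; rewrite -[LHS]/(P ((fun w => (U w, V w)) @^-1` C)) h.
apply: eq_integral => w _; rewrite indicE.
have [BU|BU] := boolP (U w \in B); last first.
  rewrite mul0r (_ : xsection C (U w) = set0) ?measure0//.
  apply/seteqP; split => // x; rewrite /xsection/= inE => -[/=].
  by move: BU; rewrite notin_setE.
rewrite mul1r /tail fineK; last first.
  by rewrite fin_num_measure//; exact: (measurable_gt (f := V)).
rewrite /distribution /pushforward; congr (P _).
apply/seteqP; split => x; rewrite /xsection/= inE /C/= lte_fin.
  by move=> [_]; rewrite ltr_pdivrMr// mulrC.
by rewrite ltr_pdivrMr// mulrC => ?; split => //; exact/set_mem.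
Qed.

End ProductTail.

(** * Exceedances of finitely many variables *)

Definition both_exceed (R : realType) (T : Type) (Y : nat -> T -> R)
    (s t : nat) (x : R) : set T := [set w | x < Y s w /\ x < Y t w].

Section FiniteSums.
Context d (T : measurableType d) (R : realType) (P : probability T R).
Variable (Y : nat -> T -> R).
Hypothesis mY : forall t, measurable_fun setT (Y t).
Hypothesis Y0 : forall t w, 0 <= Y t w.

Lemma measurable_both_exceed s t x : measurable (both_exceed Y s t x).
Proof. by apply: measurableI; exact: measurable_gt. Qed.

(** By induction: joining one more event to a union loses only the probability
    of meeting the earlier ones. *)
Lemma bonferroni_ge (x : R) n :
  \sum_(t < n) pr P [set w | x < Y t w] <=
  pr P (\big[setU/set0]_(t < n) [set w | x < Y t w]) +
  \sum_(t < n) \sum_(s < t) pr P (both_exceed Y s t x).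
Proof.
pose A t := [set w | x < Y t w].
have mA t : measurable (A t) by exact: measurable_gt.
elim: n => [|n IH]; first by rewrite !big_ord0 addr0 pr_ge0.
rewrite !big_ord_recr/=.
set U := \big[setU/set0]_(t < n) _ in IH *.
have mU : measurable U by apply: bigsetU_measurable => i _; exact: mA.
have h1 : pr P (U `|` A n) + pr P (U `&` A n) = pr P U + pr P (A n).
  have mI : measurable (U `&` A n) by exact: measurableI.
  have mUU : measurable (U `|` A n) by exact: measurableU.
  have h := measureUfinl mU (mA n).
  have Pfin : (P U < +oo)%E by rewrite ltey_eq fin_num_measure.
  have : (P (U `|` A n) = P U + P (A n) - P (U `&` A n))%E := h _ P Pfin.
  rewrite (prE P mUU) (prE P mI) (prE P mU) (prE P (mA n)).
  by move=> /(congr1 fine) /= ->; ring.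
have h2 : pr P (U `&` A n) <= \sum_(s < n) pr P (both_exceed Y s n x).
  rewrite /U big_distrl/=; apply: pr_bigsetU_le => s; exact: measurable_both_exceed.
move: IH h1 h2; rewrite -/(A n); lra.
Qed.

(** If at most one term exceeds e x / n, the others add up to at most e x, so
    that this term has to carry the rest. *)
Lemma large_sum_cases (n : nat) (y : nat -> R) (x e : R) : 0 < x -> 0 < e -> e <= 2^-1 ->
  (forall t, 0 <= y t) -> (1 - e) * x < \sum_(t < n) y t ->
  (exists t : 'I_n, (1 - 2 * e) * x < y t) \/
  exists p : 'I_n * 'I_n, p.1 != p.2 /\ (e * x / n%:R < y p.1 /\ e * x / n%:R < y p.2).
Proof.
move=> x0 e0 e2 y0 hsum.
have ex : 0 < e * x by rewrite mulr_gt0.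
have [[p hp]|nop] := pselect (exists p : 'I_n * 'I_n, p.1 != p.2 /\
   (e * x / n%:R < y p.1 /\ e * x / n%:R < y p.2)); first by right; exists p.
left; apply: contrapT => not.
have le1 (t : 'I_n) : y t <= (1 - 2 * e) * x.
  by rewrite leNgt; apply/negP => h; apply: not; exists t.
have n0 : (0 < n)%N.
  by case: n hsum {nop not le1} => //; rewrite big_ord0 pmulr_llt0// subr_lt0 => h; lra.
have nR : 0 < n%:R :> R by rewrite ltr0n.
have sumz : \sum_(t < n) (e * x / n%:R) = e * x.
  by rewrite sumr_const card_ord -[LHS]mulr_natr divfK ?gt_eqF.
move: hsum; apply/negP; rewrite -leNgt.
have [[t0 ht0]|noone] := pselect (exists t : 'I_n, e * x / n%:R < y t); last first.
  have le2 (t : 'I_n) : y t <= e * x / n%:R.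
    by rewrite leNgt; apply/negP => h; apply: noone; exists t.
  rewrite (le_trans (ler_sum _ (fun t _ => le2 t)))//.
  rewrite sumz ler_pM2r//; lra.
rewrite (bigD1 t0)//= (@le_trans _ _ ((1 - 2 * e) * x + \sum_(t < n | t != t0) e * x / n%:R))//.
  rewrite lerD//; apply: ler_sum => t tt0; rewrite leNgt; apply/negP => h; apply: nop.
  by exists (t, t0).
have : \sum_(t < n | t != t0) e * x / n%:R <= \sum_(t < n) e * x / n%:R.
  by rewrite [leRHS](bigD1 t0)//= lerDr ltW// divr_gt0.
rewrite sumz.
by move=> h; rewrite (_ : (1 - e) * x = (1 - 2 * e) * x + e * x); [rewrite lerD2l|ring].
Qed.

Lemma finite_sum_pr_le n (x e : R) : 0 < x -> 0 < e -> e <= 2^-1 ->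
  pr P [set w | (1 - e) * x < \sum_(t < n) Y t w] <=
  \sum_(t < n) pr P [set w | (1 - 2 * e) * x < Y t w] +
  \sum_(p : 'I_n * 'I_n | p.1 != p.2) pr P (both_exceed Y p.1 p.2 (e * x / n%:R)).
Proof.
move=> x0 e0 e2.
pose A (t : 'I_n) := [set w | (1 - 2 * e) * x < Y t w].
pose B (p : 'I_n * 'I_n) := both_exceed Y p.1 p.2 (e * x / n%:R).
have mA t : measurable (A t) by exact: measurable_gt.
have mB p : measurable (B p) by exact: measurable_both_exceed.
rewrite (le_trans _ (lerD (pr_bigsetU_le P (index_enum _) mA)
  (pr_bigsetU_le_cond P (index_enum _) (fun p => p.1 != p.2) mB)))//.
have mUA : measurable (\big[setU/set0]_(i <- index_enum 'I_n) A i).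
  exact: bigsetU_measurable.
have mUB : measurable (\big[setU/set0]_(i <- index_enum ('I_n * 'I_n)%type | i.1 != i.2) B i).
  exact: bigsetU_measurable.
rewrite (le_trans _ (pr_setU_le P mUA mUB))//; apply: le_pr.
- apply: measurable_gt; exact: measurable_sum.
- exact: measurableU.
move=> w /= /(large_sum_cases x0 e0 e2 (fun t => Y0 t w)) [[t ht]|[p [pp hp]]].
  by left; rewrite -bigcup_seq; exists t => //=; rewrite mem_index_enum.
right; rewrite -big_filter -bigcup_seq; exists p => //=.
by rewrite mem_filter pp mem_index_enum.
Qed.

End FiniteSums.

(** * Tails of weighted terms *)

(** Comparable to the largest of the powers theta `^ s with s within eta of
    alpha, whichever side of 1 theta lies on. *)
Definition two_sided_power (R : realType) (alpha eta theta : R) : R :=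
  theta `^ (alpha + eta) + theta `^ (alpha - eta).

Lemma two_sided_power_ge0 (R : realType) (alpha eta theta : R) :
  0 <= two_sided_power alpha eta theta.
Proof. by rewrite addr_ge0// powR_ge0. Qed.

Lemma measurable_two_sided d (T : measurableType d) (R : realType) (alpha eta : R)
    (V : T -> R) : measurable_fun setT V ->
  measurable_fun setT (fun w => two_sided_power alpha eta (V w)).
Proof.
move=> mV; apply: measurable_funD.
  exact: (measurableT_comp (@measurable_powR R (alpha + eta)) mV).
exact: (measurableT_comp (@measurable_powR R (alpha - eta)) mV).
Qed.

Section WeightedTerms.
Context d (T : measurableType d) (R : realType) (P : probability T R).
Variables (X Theta : nat -> {RV P >-> R}) (g : R -> R) (alpha eta C x0 : R).
Hypothesis Theta_gt0 : forall t w, 0 < Theta t w.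
Hypothesis X_ident : identically_distributed X.
Hypothesis X_asym : forall s t, s != t -> asymptotically_independent P (X s) (X t).
Hypothesis ThetaX : forall t, independent_pair (Theta t) (X t).
Hypothesis g_gt0 : forall x, 0 < g x.
Hypothesis g_rv : forall t, 0 < t -> g (t * x) / g x @[x --> +oo] --> t `^ (- alpha).
Hypothesis eta0 : 0 < eta.

Local Notation F := (tail P (EFin \o X 0%N)).
Local Notation psi := (two_sided_power alpha eta).

Hypothesis C0 : 0 < C.
Hypothesis x00 : 0 < x0.
Hypothesis F_le : forall x theta, x0 <= x -> 0 < theta ->
  F (x / theta) <= C * g x * psi theta.
Hypothesis ipsi : forall t, P.-integrable setT (EFin \o (fun w => psi (Theta t w))).

Local Notation c t := (\int[P]_w psi (Theta t w)).

Lemma identical_tails t : tail P (EFin \o X t) = F.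
Proof.
apply/funext => x; rewrite !tailE /pr; congr fine.
have := X_ident t 0%N (measurable_itv `]x, +oo[).
rewrite /distribution /pushforward.
have h (V : T -> R) : V @^-1` `]x, +oo[ = [set w | x < V w].
  by apply/seteqP; split => w /=; rewrite in_itv/= andbT.
by rewrite !h.
Qed.

(** Condition on the weight and bound the tail of the other factor by the
    assumed multiple of the two-sided power. *)
Lemma truncated_weighted_tail_le t (B : set R) x : measurable B -> x0 <= x ->
  pr P [set w | B (Theta t w) /\ x < Theta t w * X t w] <=
  C * g x * \int[P]_w (\1_B (Theta t w) * psi (Theta t w)).
Proof.
move=> mB xx0; rewrite product_tail// identical_tails.
have mind : measurable_fun setT (fun w => \1_B (Theta t w) : R).
  by apply: measurableT_comp => //; exact: measurable_indic.
have ind01 w : 0 <= (\1_B (Theta t w) : R) <= 1.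
  by rewrite indicE; case: (_ \in _); rewrite ?lexx ?ler01.
have i1 : P.-integrable setT (EFin \o (fun w => \1_B (Theta t w) * psi (Theta t w))).
  apply: integrable_le (ipsi t) _.
    by apply: measurable_funM => //; exact: measurable_two_sided.
  move=> w; have /andP[h1 h2] := ind01 w.
  by rewrite ger0_norm ?mulr_ge0 ?two_sided_power_ge0// ler_piMl// two_sided_power_ge0.
have i2 := integrableZl measurableT (C * g x) i1.
have le2 w : \1_B (Theta t w) * F (x / Theta t w) <=
    C * g x * (\1_B (Theta t w) * psi (Theta t w)).
  by rewrite mulrCA ler_wpM2l ?F_le//; have /andP[] := ind01 w.
rewrite -RintegralZl//; apply: le_Rintegral => //.
apply: (@integrable_le _ _ _ P _ (fun w => C * g x * (\1_B (Theta t w) * psi (Theta t w)))) => //.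
- apply: measurable_funM => //; apply: (measurableT_comp (measurable_tail (X 0%N))).
  exact: measurable_div_pos.
- by move=> w; rewrite ger0_norm// mulr_ge0 ?tail_ge0//; have /andP[] := ind01 w.
Qed.

Lemma psi_scale k theta : 1 <= k -> 0 < theta ->
  psi (k * theta) <= k `^ (alpha + eta) * psi theta.
Proof.
move=> k1 t0; have k0 : 0 <= k by rewrite (le_trans ler01).
rewrite /two_sided_power !powRM ?(ltW t0)// mulrDr lerD2l ler_wpM2r ?powR_ge0//.
by rewrite ler_powR// lerD2l; have := eta0; lra.
Qed.

Lemma weighted_tail_le t x k : 1 <= k -> x0 <= x ->
  pr P [set w | x / k < Theta t w * X t w] <= C * g x * (k `^ (alpha + eta) * c t).
Proof.
move=> k1 xx0; have k0 : 0 < k by rewrite (lt_le_trans ltr01).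
have -> : [set w | x / k < Theta t w * X t w] =
          [set w | setT (Theta t w) /\ x / k < Theta t w * X t w].
  by apply/seteqP; split => w //= [].
rewrite product_tail// identical_tails.
have -> : C * g x * (k `^ (alpha + eta) * c t) =
  \int[P]_w (C * g x * k `^ (alpha + eta) * psi (Theta t w)).
  by rewrite RintegralZl// mulrA.
have i2 := integrableZl measurableT (C * g x * k `^ (alpha + eta)) (ipsi t).
have le2 w : \1_setT (Theta t w) * F (x / k / Theta t w) <=
    C * g x * k `^ (alpha + eta) * psi (Theta t w).
  rewrite indicE in_setT mul1r -mulrA -invfM -mulrA.
  rewrite (le_trans (F_le xx0 _))// ?mulr_gt0// ler_wpM2l ?psi_scale//.
  by rewrite mulr_ge0// ltW.
apply: le_Rintegral => //.
apply: (@integrable_le _ _ _ P _ (fun w => C * g x * k `^ (alpha + eta) * psi (Theta t w))) => //.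
- apply: measurable_funM => //.
    by rewrite indicT; exact: measurable_cst.
  apply: (measurableT_comp (measurable_tail (X 0%N))); exact: measurable_div_pos.
- by move=> w; rewrite ger0_norm// mulr_ge0 ?tail_ge0// indicE.
Qed.

Lemma two_sided_moment_gt0 t : 0 < c t.
Proof.
have h0 : 0 <= c t by apply: Rintegral_ge0 => w _; exact: two_sided_power_ge0.
rewrite lt_neqAle h0 andbT eq_sym; apply/eqP => ct0.
have h : (\int[P]_w `|(psi (Theta t w))%:E| = 0)%E.
  under eq_integral do rewrite /= ger0_norm ?two_sided_power_ge0//.
  have := ct0; rewrite /Rintegral.
  have := integrable_fin_num measurableT (ipsi t).
  by move=> /fineK <- /= ->.
have mE : measurable_fun setT (EFin \o (fun w => psi (Theta t w))).
  by apply/measurable_EFinP; exact: measurable_two_sided.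
have := (ae_eq_integral_abs P measurableT mE).1 h.
move=> [N [mN N0 sub]].
suff : P setT = 0%E by rewrite probability_setT => /eqP; rewrite onee_eq0.
apply/eqP; rewrite -measure_le0 -N0 le_measure ?inE//.
apply: subset_trans sub => w _ /= /(_ I) /eqP; rewrite eqe => /eqP h'.
have : 0 < psi (Theta t w) by rewrite addr_gt0// powR_gt0.
by rewrite h' ltxx.
Qed.

Lemma truncated_moment_small t e : 0 < e ->
  exists2 M : R, 0 < M & \int[P]_w (\1_(`]M, +oo[) (Theta t w) * psi (Theta t w)) <= e.
Proof.
move=> e0.
have h : \int[P]_w (\1_(`]n%:R, +oo[) (Theta t w) * psi (Theta t w)) @[n --> \oo] -->
   \int[P]_w (0 : R).
  apply: (@dominated_cvg_Rintegral _ _ _ P _ _ (fun w => psi (Theta t w))) => //.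
  - move=> n; apply: measurable_funM; last exact: measurable_two_sided.
    by apply: measurableT_comp => //; exact: measurable_indic.
  - move=> n w; rewrite indicE ger0_norm; last by rewrite mulr_ge0 ?two_sided_power_ge0.
    by rewrite ler_piMl ?two_sided_power_ge0//; case: (_ \in _).
  - move=> w; apply: cvg_near_cst; near=> n.
    rewrite indicE memNset ?mul0r//= in_itv/= andbT; apply/negP; rewrite -leNgt.
    by near: n; exact: nbhs_infty_ger.
rewrite Rintegral_cst// mul0r in h.
have [N _ hN] : \forall n \near \oo,
    \int[P]_w (\1_(`]n%:R, +oo[) (Theta t w) * psi (Theta t w)) <= e.
  exact: (cvgr_le _ h _ e0).
exists N.+1%:R => //; exact: (hN N.+1 (leqnSn _)).
Unshelve. all: by end_near. Qed.

Let term_gt t x : measurable [set w | x < Theta t w * X t w].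
Proof. by apply: measurable_gt; exact: measurable_funM. Qed.

Let mterm_gt t (B : set R) x : measurable B ->
  measurable [set w | B (Theta t w) /\ x < Theta t w * X t w].
Proof.
move=> mB; apply: measurableI; last exact: term_gt.
by rewrite -[X in measurable X]setTI; exact: (measurable_funP (Theta t)).
Qed.

(** If both weights are at most M, both variables X exceed x / M, which is
    negligible against F (x / M) by asymptotic independence, and F (x / M) is
    at most a multiple of g x. If one weight exceeds M, its term alone has
    probability at most C g x times a truncated moment, which is small for M
    large. Each of the three cases is given one third of e. *)
Lemma joint_exceedance_small s t e : s != t -> 0 < e ->
  \forall x \near +oo, pr P [set w | x < Theta s w * X s w /\ x < Theta t w * X t w]
     <= e * g x.
Proof.
move=> st e0.
have e1 : 0 < e / (3 * C) by rewrite divr_gt0// mulr_gt0.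
have [Ms Ms0 hMs] := truncated_moment_small s e1.
have [Mt Mt0 hMt] := truncated_moment_small t e1.
pose M := Num.max Ms Mt.
have M0 : 0 < M by rewrite /M lt_max Ms0.
have pM0 : 0 < psi M by rewrite addr_gt0// powR_gt0.
(* Compensates the factor C * psi M in the bound of F (x / M) by g x. *)
pose e2 := e / (3 * C * psi M).
have e20 : 0 < e2 by rewrite divr_gt0// !mulr_gt0.
have [_ asy] := X_asym st.
have [A [_ hA]] : \forall x \near +oo,
    fine (P [set w | x < X s w /\ x < X t w]) / tail P (EFin \o X t) x <= e2.
  exact: (cvgr_le _ asy _ e20).
near=> x.
have xx0 : x0 <= x by near: x; apply: nbhs_pinfty_ge; exact: num_real.
have xA : A < x / M.
  by rewrite ltr_pdivlMr//; near: x; apply: nbhs_pinfty_gt; exact: num_real.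
have big r Mr : Mr \in `]-oo, M] -> \int[P]_w (\1_(`]Mr, +oo[) (Theta r w) * psi (Theta r w))
    <= e / (3 * C) -> pr P [set w | `]M, +oo[%classic (Theta r w) /\ x < Theta r w * X r w]
    <= e / 3 * g x.
  rewrite in_itv/= => MrM h.
  rewrite (@le_trans _ _ (pr P [set w | `]Mr, +oo[%classic (Theta r w) /\
       x < Theta r w * X r w]))//.
    apply: le_pr; [exact: (mterm_gt r x (measurable_itv `]M, +oo[))|
                   exact: (mterm_gt r x (measurable_itv `]Mr, +oo[))|].
    by move=> w /=; rewrite !in_itv/= !andbT => -[? ?]; split => //; exact: le_lt_trans MrM _.
  rewrite (le_trans (truncated_weighted_tail_le _ _ xx0))//.
  have := ler_wpM2l (ltW (mulr_gt0 C0 (g_gt0 x))) h => /le_trans; apply.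
  by rewrite le_eqVlt; apply/orP; left; apply/eqP; field; rewrite gt_eqF.
have hs := big s Ms _ hMs; have ht := big t Mt _ hMt.
have both : pr P [set w | x / M < X s w /\ x / M < X t w] <= e / 3 * g x.
  have := hA _ xA; rewrite identical_tails.
  have [Ft0 _] := X_asym st; have := Ft0 (x / M); rewrite identical_tails => F0.
  rewrite ler_pdivrMr// => /le_trans; apply.
  rewrite (le_trans (ler_wpM2l (ltW e20) (F_le xx0 M0)))//.
  rewrite le_eqVlt; apply/orP; left; apply/eqP; rewrite /e2; field.
  by rewrite !gt_eqF.
pose A1 := [set w | x / M < X s w /\ x / M < X t w].
pose A2 := [set w | `]M, +oo[%classic (Theta s w) /\ x < Theta s w * X s w].
pose A3 := [set w | `]M, +oo[%classic (Theta t w) /\ x < Theta t w * X t w].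
have mA1 : measurable A1 by apply: measurableI; exact: measurable_gt.
have mA2 : measurable A2 by exact: (mterm_gt s x (measurable_itv `]M, +oo[)).
have mA3 : measurable A3 by exact: (mterm_gt t x (measurable_itv `]M, +oo[)).
apply: (@le_trans _ _ (pr P (A1 `|` (A2 `|` A3)))).
  apply: le_pr.
  - by apply: measurableI; exact: term_gt.
  - by apply: measurableU => //; exact: measurableU.
  move=> w /= [xs xt].
  have xgt0 : 0 < x by exact: lt_le_trans xx0.
  have [sM|sM] := leP (Theta s w) M; last first.
    by right; left; split => //; rewrite /= in_itv/= sM.
  have [tM|tM] := leP (Theta t w) M; last first.
    by right; right; split => //; rewrite /= in_itv/= tM.
  have small r : Theta r w <= M -> x < Theta r w * X r w -> x / M < X r w.
    move=> rM xr; rewrite ltr_pdivrMr// (lt_le_trans xr)// mulrC ler_pM2l//.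
    by rewrite -(pmulr_rgt0 _ (Theta_gt0 r w)) (lt_trans xgt0).
  by left; split; exact: small.
rewrite (le_trans (pr_setU_le _ _ _))//; first exact: measurableU.
have h23 := pr_setU_le P mA2 mA3.
have sM : Ms \in `]-oo, M] by rewrite in_itv/= /M le_max lexx.
have tM : Mt \in `]-oo, M] by rewrite in_itv/= /M le_max lexx orbT.
have := hs sM; have := ht tM; rewrite -/A2 -/A3 -/A1 in both h23 *.
by move: both h23; set a1 := pr P A1; set a2 := pr P A2; set a3 := pr P A3; lra.
Unshelve. all: by end_near. Qed.

Lemma joint_exceedance_small_scaled s t a e : s != t -> 0 < a -> 0 < e ->
  \forall x \near +oo,
     pr P (both_exceed (fun t w => Theta t w * X t w) s t (a * x)) <= e * g x.
Proof.
move=> st a0 e0.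
have aa : 0 < a `^ (- alpha) by rewrite powR_gt0.
have e1 : 0 < e / (2 * a `^ (- alpha)) by rewrite divr_gt0// mulr_gt0.
have [A [_ hA]] := joint_exceedance_small st e1.
have [B [_ hB]] := regular_variation_le g_gt0 g_rv a0 (ltr01 : 0 < 1).
near=> x.
have xA : A < a * x.
  by rewrite mulrC -ltr_pdivrMr//; near: x; apply: nbhs_pinfty_gt; exact: num_real.
have xB : B < x by near: x; apply: nbhs_pinfty_gt; exact: num_real.
rewrite (le_trans (hA _ xA))// (le_trans (ler_wpM2l (ltW e1) (hB _ xB)))//.
rewrite le_eqVlt; apply/orP; left; apply/eqP; field.
by rewrite gt_eqF.
Unshelve. all: by end_near. Qed.

End WeightedTerms.

(** * The sum of many small terms *)

Lemma exprn_powR (R : realType) (a r : R) k : 0 <= a ->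
  (a ^+ k) `^ r = (a `^ r) ^+ k.
Proof.
by move=> a0; rewrite -(powR_mulrn k (powR_ge0 a r)) -powRrM mulrC powRrM powR_mulrn.
Qed.

Section HeavyTailSum.
Context d (T : measurableType d) (R : realType) (P : probability T R).
Variables (Y : nat -> T -> R) (b : nat -> R) (p q y G B Cb : R).
Hypothesis mY : forall t, measurable_fun setT (Y t).
Hypothesis Y_gt0 : forall t w, 0 < Y t w.
Hypothesis b_gt0 : forall t, 0 < b t.
Hypothesis p_ge1 : 1 <= p.
Hypothesis qp : q < p.
Hypothesis y_gt0 : 0 < y.
Hypothesis G_ge0 : 0 <= G.
Hypothesis B_gt0 : 0 < B.
Hypothesis pr_le : forall t k, 1 <= k ->
  pr P [set w | y / k < Y t w] <= G * (k `^ q * b t `^ p).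
Hypothesis b_sum : (\sum_(0 <= t <oo) (b t)%:E <= B%:E)%E.
Hypothesis bp_sum : (\sum_(0 <= t <oo) (b t `^ p)%:E <= Cb%:E)%E.

Let p_gt0 : 0 < p. Proof. exact: lt_le_trans p_ge1. Qed.

Let below t : set T := [set w | Y t w <= y].

Let mbelow t : measurable (below t).
Proof.
rewrite (_ : below t = ~` [set w | y < Y t w]).
  by apply: measurableC; exact: measurable_gt.
by apply/seteqP; split => w; rewrite /below /=; [rewrite leNgt => /negP|move=> /negP; rewrite -leNgt].
Qed.

Definition truncated_power t w : R := \1_(below t) w * Y t w `^ p.

Let mtruncated_power t : measurable_fun setT (truncated_power t).
Proof.
apply: measurable_funM; first exact: measurable_indic.
exact: (measurableT_comp (@measurable_powR R p) (mY t)).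
Qed.

Let truncated_power_ge0 t w : 0 <= truncated_power t w.
Proof. by rewrite mulr_ge0 ?powR_ge0// indicE. Qed.

Let dyadic_cover t w : ((truncated_power t w)%:E <=
  \sum_(0 <= k <oo) ((y / 2 ^+ k) `^ p * \1_[set w | y / 2 ^+ k.+1 < Y t w] w)%:E)%E.
Proof.
have t0 k : (0 <= ((y / 2 ^+ k) `^ p * \1_[set w | y / 2 ^+ k.+1 < Y t w] w)%:E)%E.
  by rewrite lee_fin mulr_ge0 ?powR_ge0// indicE.
have [Yy|Yy] := leP (Y t w) y; last first.
  rewrite /truncated_power indicE memNset ?mul0r; last by rewrite /below /= leNgt Yy.
  by apply: nneseries_ge0 => k _ _.
have y1 : 1 <= y / Y t w by rewrite ler_pdivlMr// mul1r.
have [k /andP[k1 k2]] := dyadic_bracket y1.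
apply: le_trans (nneseries_lim_ge k.+1 (fun k _ _ => t0 k)).
rewrite big_nat_recr//= (le_trans _ (leeDr _ _))//; last first.
  by apply: sume_ge0 => i _; exact: t0.
rewrite lee_fin /truncated_power !indicE !mem_set//=; last first.
  by rewrite ltr_pdivrMr ?exprn_gt0// mulrC -ltr_pdivrMr.
rewrite mul1r mulr1 ge0_ler_powR ?nnegrE ?(ltW p_gt0) ?(ltW (Y_gt0 _ _))//.
  by rewrite divr_ge0 ?exprn_ge0// ltW.
by rewrite ler_pdivlMr ?exprn_gt0// mulrC -ler_pdivlMr.
Qed.

Let ratio := 2 `^ (q - p) : R.

Let ratio_lt1 : ratio < 1.
Proof. by rewrite -(powRr0 2) /ratio powR2_lt// subr_lt0. Qed.

(** The sum of 2^q 2^((q - p) k) over k, which is what the layers y / 2^(k+1)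
    < Y <= y / 2^k contribute to a truncated moment of order p when the tail
    has order q. *)
Definition dyadic_constant : R := 2 `^ q / (1 - 2 `^ (q - p)).

Lemma dyadic_constant_ge0 : 0 <= dyadic_constant.
Proof. by rewrite divr_ge0 ?powR_ge0// subr_ge0 ltW. Qed.

Let nneseries_geometric (a : R) : 0 <= a ->
  (\sum_(0 <= k <oo) (a * ratio ^+ k)%:E = (a / (1 - ratio))%:E)%E.
Proof.
move=> a0; apply/cvg_lim => //.
under eq_fun do rewrite sumEFin.
apply: cvg_EFin; first exact: nearW.
have := @cvg_geometric_series R a ratio.
rewrite ger0_norm ?powR_ge0// => /(_ ratio_lt1); apply.
Qed.

(** Cut the values at most y into dyadic layers: layer k contributes (y /
    2^k)^p times the bound of the probability of exceeding y / 2^(k+1), which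
    grows only like 2^(q k). *)
Lemma truncated_moment_le t :
  (\int[P]_w (truncated_power t w)%:E <=
   (dyadic_constant * G * y `^ p * b t `^ p)%:E)%E.
Proof.
pose f k w := (y / 2 ^+ k) `^ p * \1_[set w | y / 2 ^+ k.+1 < Y t w] w.
have mA k : measurable [set w | y / 2 ^+ k.+1 < Y t w] by exact: measurable_gt.
have mf k : measurable_fun setT (f k).
  by apply: measurable_funM => //; exact: measurable_indic.
have f0 k w : (0 <= (f k w)%:E)%E.
  by rewrite lee_fin mulr_ge0 ?powR_ge0// indicE.
have mEf k : measurable_fun setT (EFin \o f k) by exact/measurable_EFinP.
apply: (@le_trans _ _ (\int[P]_w \sum_(0 <= k <oo) (f k w)%:E)%E).
  apply: ge0_le_integral => //.
  - by move=> w _; rewrite lee_fin.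
  - exact/measurable_EFinP.
  - by apply: ge0_emeasurable_sum => // k _; exact: mEf.
rewrite (integral_nneseries P measurableT (f := fun k w => (f k w)%:E))//.
have -> : dyadic_constant * G * y `^ p * b t `^ p =
   (2 `^ q * G * y `^ p * b t `^ p) / (1 - ratio).
  by rewrite /dyadic_constant -/ratio; ring.
rewrite -nneseries_geometric; last by rewrite !mulr_ge0 ?powR_ge0.
apply: lee_nneseries => [k _ _|k _]; first by apply: integral_ge0 => w _.
rewrite /f; under eq_integral do rewrite EFinM.
rewrite ge0_integralZl//; last 2 first.
- by apply/measurable_EFinP; exact: measurable_indic.
- by rewrite lee_fin powR_ge0.
rewrite integral_indic_pr// -EFinM lee_fin.
have k1 : 1 <= 2 ^+ k.+1 :> R by rewrite exprn_ege1// ler1n.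
rewrite (le_trans (ler_wpM2l (powR_ge0 _ _) (pr_le t k1)))//.
rewrite le_eqVlt; apply/orP; left; apply/eqP.
rewrite exprS !powRM ?invr_ge0 ?exprn_ge0 ?(ltW y_gt0)//.
have -> : (2 ^+ k)^-1 `^ p = (2 `^ p) ^- k :> R.
  by rewrite -powR_inv1 ?exprn_ge0// -powRrM mulN1r powRN exprn_powR.
have -> : (2 ^+ k) `^ q = (2 `^ q) ^+ k :> R by rewrite exprn_powR.
rewrite /ratio powRB ?pnatr_eq0 ?implybT// expr_div_n.
by ring.
Qed.

(* Thresholds proportional to b t, with total at most y / 2. *)
Let tau t := b t * (y / (2 * B)).

Let tau_gt0 t : 0 < tau t. Proof. by rewrite mulr_gt0// divr_gt0// mulr_gt0. Qed.

(* If the series exceeds y, these quantities add up to at least 1: either a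
   single term exceeds y, or all terms are at most y and, since tau adds up to
   at most y / 2, the parts above the thresholds add up to y / 2. *)
Let excess t w : R := \1_[set w | y < Y t w] w +
  2 / y * (tau t `^ (1 - p) * truncated_power t w).

Let excess_ge0 t w : 0 <= excess t w.
Proof.
rewrite addr_ge0 ?indicE// mulr_ge0 ?divr_ge0 ?(ltW y_gt0)//.
by rewrite mulr_ge0// powR_ge0.
Qed.

Let mexcess t : measurable_fun setT (excess t).
Proof.
apply: measurable_funD.
  by apply: measurable_indic; exact: measurable_gt.
by do 2 apply: measurable_funM => //.
Qed.

(* Above its threshold, Y is at most tau^(1 - p) Y^p, since p >= 1. *)
Let term_le t w : Y t w <= y -> Y t w <= tau t + y / 2 * excess t w.
Proof.
move=> Yy; rewrite /excess indicE memNset ?add0r; last first.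
  by rewrite /= ltNge Yy.
rewrite /truncated_power indicE mem_set// mul1r.
rewrite (_ : y / 2 * _ = tau t `^ (1 - p) * Y t w `^ p); last by field; rewrite gt_eqF.
have [Yt|Yt] := leP (Y t w) (tau t).
  by rewrite (le_trans Yt)// lerDl mulr_ge0 ?powR_ge0.
rewrite ler_wpDl ?(ltW (tau_gt0 _))//.
rewrite -[leLHS]mulr1 -(@mulr_powRB1 _ (Y t w) p) ?(ltW (Y_gt0 _ _))//.
rewrite [leRHS]mulrCA ler_pM2l// -(opprB p 1) powRN.
rewrite ler_pdivlMl ?powR_gt0// mulr1 ge0_ler_powR ?subr_ge0 ?nnegrE//.
- by rewrite ltW.
- by rewrite ltW.
- by rewrite ltW.
Qed.

(** Markov's inequality for the sum of the excesses. With tau t proportional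
    to b t, the factor tau^(1 - p) turns the moment b^p of the truncated term
    into b, so that a single summability assumption on b controls the
    truncated moments for all p >= 1. *)
Lemma heavy_tail_sum :
  pr P [set w | (y%:E < \sum_(0 <= t <oo) (Y t w)%:E)%E] <=
  G * (Cb + dyadic_constant * (2 * B) `^ p).
Proof.
pose E := [set w | (y%:E < \sum_(0 <= t <oo) (Y t w)%:E)%E].
have mE : measurable E.
  rewrite -[E]setTI; apply: emeasurable_fun_o_infty => //.
  apply: ge0_emeasurable_sum => // [t w _ _|t _]; first by rewrite lee_fin ltW.
  exact/measurable_EFinP.
have mEe t : measurable_fun setT (EFin \o excess t) by exact/measurable_EFinP.
have e0 t w : (0 <= (excess t w)%:E)%E by rewrite lee_fin.
have tau_sum : (\sum_(0 <= t <oo) (tau t)%:E <= (y / 2)%:E)%E.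
  rewrite /tau; under eq_eseriesr do rewrite mulrC EFinM.
  rewrite nneseriesZl; last by move=> t _; rewrite lee_fin ltW.
  have yB : 0 <= y / (2 * B) by rewrite divr_ge0 ?mulr_ge0// ltW.
  rewrite (le_trans (lee_wpmul2l _ b_sum))// -EFinM lee_fin.
  by rewrite le_eqVlt; apply/orP; left; apply/eqP; field; rewrite gt_eqF.
have cover w : ((\1_E w : R)%:E <= \sum_(0 <= t <oo) (excess t w)%:E)%E.
  rewrite indicE; case: (boolP (w \in E)) => [|_]; last by apply: nneseries_ge0.
  rewrite inE /E /= => yY.
  have [[t yYt]|noY] := pselect (exists t, y < Y t w).
    apply: le_trans (nneseries_lim_ge t.+1 (fun k _ _ => e0 k w)).
    rewrite big_nat_recr//= (le_trans _ (leeDr _ _))//; last exact: sume_ge0.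
    rewrite lee_fin /excess indicE mem_set//= lerDl mulr_ge0 ?divr_ge0 ?(ltW y_gt0)//.
    by rewrite mulr_ge0 ?powR_ge0.
  have Yy t : Y t w <= y by rewrite leNgt; apply/negP => h; apply: noY; exists t.
  rewrite leNgt; apply/negP => h; move: yY; apply/negP; rewrite -leNgt.
  apply: (@le_trans _ _ (\sum_(0 <= t <oo) ((tau t)%:E + (y / 2)%:E * (excess t w)%:E))%E).
    apply: lee_nneseries => [t _ _|t _]; first by rewrite lee_fin ltW.
    by rewrite -EFinM -EFinD lee_fin; exact: term_le.
  rewrite nneseriesD; last 2 first.
  - by move=> t _ _; rewrite lee_fin ltW.
  - by move=> t _ _; rewrite mule_ge0// lee_fin divr_ge0// ltW.
  rewrite nneseriesZl; last by move=> t _; exact: e0.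
  have -> : y%:E = ((y / 2)%:E + (y / 2)%:E * 1)%E.
    by rewrite mule1 -EFinD; congr EFin; field.
  by rewrite leeD// lee_wpmul2l// ?(ltW h)// lee_fin divr_ge0// ltW.
rewrite -lee_fin -integral_indic_pr//.
apply: (@le_trans _ _ (\int[P]_w \sum_(0 <= t <oo) (excess t w)%:E)%E).
  apply: ge0_le_integral => //.
  - by apply/measurable_EFinP; exact: measurable_indic.
  - by apply: ge0_emeasurable_sum => // k _; exact: mEe.
  - by move=> w _; exact: cover.
rewrite (integral_nneseries P measurableT (f := fun k w => (excess k w)%:E))//.
have K0 := dyadic_constant_ge0.
have int_le t : (\int[P]_w (excess t w)%:E <=
  G%:E * (b t `^ p)%:E + (G * dyadic_constant * (2 * B) `^ p / B)%:E * (b t)%:E)%E.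
  rewrite /excess; under eq_integral do rewrite EFinD mulrA (EFinM (2 / y * _)).
  have c0 : 0 <= 2 / y * tau t `^ (1 - p).
    by rewrite mulr_ge0 ?powR_ge0// divr_ge0// ltW.
  have mA : measurable [set w | y < Y t w] by exact: measurable_gt.
  rewrite ge0_integralD//; last 3 first.
  - by apply/measurable_EFinP; exact: measurable_indic.
  - by move=> w _; rewrite -EFinM lee_fin mulr_ge0.
  - by apply: measurable_funeM; exact/measurable_EFinP.
  apply: leeD.
    rewrite integral_indic_pr// -EFinM lee_fin.
    by have := pr_le t (lexx 1); rewrite divr1 powR1 mul1r.
  rewrite ge0_integralZl//; last 2 first.
  - exact/measurable_EFinP.
  - by move=> w _; rewrite lee_fin.
  rewrite (le_trans (lee_wpmul2l _ (truncated_moment_le t)))// -?EFinM ?lee_fin//.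
  rewrite le_eqVlt; apply/orP; left; apply/eqP.
  have yB : 0 < y / (2 * B) by rewrite divr_gt0// mulr_gt0.
  have pow (z : R) : 0 < z -> z `^ p = z * z `^ (p - 1).
    by move=> z0; rewrite mulr_powRB1// ltW.
  have powV (z : R) : z `^ (1 - p) = (z `^ (p - 1))^-1 by rewrite -(opprB p 1) powRN.
  rewrite powV /tau powRM ?(ltW (b_gt0 _)) ?(ltW yB)//.
  rewrite [y `^ p]pow// [b t `^ p]pow// [(2 * B) `^ p]pow ?mulr_gt0//.
  have -> : y `^ (p - 1) = (y / (2 * B)) `^ (p - 1) * (2 * B) `^ (p - 1).
    by rewrite -powRM ?(ltW yB) ?mulr_ge0 ?(ltW B_gt0)// divfK// gt_eqF// mulr_gt0.
  have n1 : b t `^ (p - 1) != 0 by rewrite gt_eqF// powR_gt0.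
  have n2 : (y / (2 * B)) `^ (p - 1) != 0 by rewrite gt_eqF// powR_gt0.
  move: n1 n2; set u := b t `^ _; set v := _ `^ (p - 1); set z := (2 * B) `^ _ => n1 n2.
  by field; rewrite n1 n2 !gt_eqF.
apply: (@le_trans _ _ (\sum_(0 <= t <oo) (G%:E * (b t `^ p)%:E +
   (G * dyadic_constant * (2 * B) `^ p / B)%:E * (b t)%:E))%E).
  apply: lee_nneseries => [t _ _|t _ //]; first by apply: integral_ge0 => w _.
have c1 : 0 <= G * dyadic_constant * (2 * B) `^ p / B.
  apply: divr_ge0; last exact: ltW.
  by apply: mulr_ge0; [exact: mulr_ge0|exact: powR_ge0].
rewrite nneseriesD; last 2 first.
- by move=> t _ _; rewrite -EFinM lee_fin mulr_ge0 ?powR_ge0.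
- by move=> t _ _; rewrite -EFinM lee_fin mulr_ge0// ltW.
rewrite !nneseriesZl; last 2 first.
- by move=> t _; rewrite lee_fin ltW.
- by move=> t _; rewrite lee_fin powR_ge0.
rewrite (_ : (G * _)%:E = G%:E * Cb%:E +
   (G * dyadic_constant * (2 * B) `^ p / B)%:E * B%:E)%E; last first.
  by rewrite -!EFinM -EFinD; congr EFin; field; rewrite gt_eqF.
by rewrite leeD// lee_wpmul2l// lee_fin.
Qed.

End HeavyTailSum.

(** * One big jump *)

Section OneBigJump.
Context d (T : measurableType d) (R : realType) (P : probability T R).
Variables (Y : nat -> T -> R) (b : nat -> R) (g : R -> R) (alpha p q C x0 : R).
Hypothesis mY : forall t, measurable_fun setT (Y t).
Hypothesis Y_gt0 : forall t w, 0 < Y t w.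
Hypothesis gE : forall x, g x = pr P [set w | (x%:E < \sum_(0 <= t <oo) (Y t w)%:E)%E].
Hypothesis g_gt0 : forall x, 0 < g x.
Hypothesis g_rv : forall t, 0 < t -> g (t * x) / g x @[x --> +oo] --> t `^ (- alpha).
Hypothesis alpha0 : 0 < alpha.
Hypothesis b_gt0 : forall t, 0 < b t.
Hypothesis b_sum : (\sum_(0 <= t <oo) (b t)%:E < +oo)%E.
Hypothesis bp_sum : (\sum_(0 <= t <oo) (b t `^ p)%:E < +oo)%E.
Hypothesis p_ge1 : 1 <= p.
Hypothesis qp : q < p.
Hypothesis C0 : 0 < C.
Hypothesis term_le : forall t x k, 1 <= k -> x0 <= x ->
  pr P [set w | x / k < Y t w] <= C * g x * (k `^ q * b t `^ p).
Hypothesis pair_small : forall s t a e, s != t -> 0 < a -> 0 < e ->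
  \forall x \near +oo, pr P (both_exceed Y s t (a * x)) <= e * g x.

Let S (x : R) : \bar R := (\sum_(0 <= t <oo) (pr P [set w | x < Y t w])%:E)%E.

Let pr0 A : (0 <= (pr P A)%:E)%E. Proof. by rewrite lee_fin pr_ge0. Qed.

Let Y0 t w : (0 <= (Y t w)%:E)%E. Proof. by rewrite lee_fin ltW. Qed.

Let mseries_gt n x : measurable [set w | (x%:E < \sum_(n <= t <oo) (Y t w)%:E)%E].
Proof.
rewrite -[X in measurable X]setTI; apply: emeasurable_fun_o_infty => //.
rewrite (_ : (fun w => _) = fun w => (\sum_(0 <= t <oo) (Y (t + n)%N w)%:E)%E).
  by apply: ge0_emeasurable_sum => // t _; exact/measurable_EFinP.
by apply/funext => w; rewrite (nneseries_addn (f := fun t => (Y t w)%:E)).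
Qed.

Let pairs_small n a e : 0 < a -> 0 < e ->
  \forall x \near +oo, forall u : 'I_n * 'I_n, u.1 != u.2 ->
    pr P (both_exceed Y u.1 u.2 (a * x)) <= e * g x.
Proof.
move=> a0 e0.
apply: (@filter_forall _ ('I_n * 'I_n)%type
  (fun u x => u.1 != u.2 -> pr P (both_exceed Y u.1 u.2 (a * x)) <= e * g x)).
move=> u; have [->|uu] := eqVneq u.1 u.2.
  by apply: nearW => x; rewrite ?eqxx.
by apply: filterS (pair_small uu a0 e0) => x h _.
Qed.

Let tail_terms_small e : 0 < e -> exists n, [/\ (0 < n)%N, (\sum_(n <= t <oo) (b t)%:E <= e%:E)%E &
   (\sum_(n <= t <oo) (b t `^ p)%:E <= e%:E)%E].
Proof.
move=> e0.
have small (f : nat -> R) : (forall t, 0 <= f t) ->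
    (\sum_(0 <= t <oo) (f t)%:E < +oo)%E ->
    \forall n \near \oo, (\sum_(n <= t <oo) (f t)%:E <= e%:E)%E.
  move=> f0 fs; have := nneseries_tail_cvg fs (fun k _ => f0 k).
  move/fine_cvgP => [fin /cvgrPdist_le /(_ _ e0) dist]; near=> n.
  have fn : (\sum_(n <= t <oo) (f t)%:E)%E \is a fin_num by near: n.
  rewrite -(fineK fn) lee_fin.
  have : `|0 - fine (\sum_(n <= t <oo) (f t)%:E)%E| <= e by near: n.
  by rewrite sub0r normrN; apply: le_trans; rewrite ler_norm.
have h1 := small b (fun t => ltW (b_gt0 t)) b_sum.
have h2 := small _ (fun t => powR_ge0 (b t) p) bp_sum.
have [N _ hN] := filterI h1 h2.
by exists N.+1; have [] := hN N.+1 (leqnSn N).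
Unshelve. all: by end_near. Qed.

(** The union of the first n exceedances implies that the sum exceeds x;
    Bonferroni compares its probability with the sum of the probabilities, up
    to pairs that are negligible. The terms of index at least n are bounded by
    the tail of a convergent series. *)
Lemma sum_tails_le e : 0 < e -> \forall x \near +oo, (S x <= ((1 + e) * g x)%:E)%E.
Proof.
move=> e0.
have [n [_ _ hn]] := tail_terms_small (divr_gt0 e0 (mulr_gt0 (ltr0n R 2) C0)).
(* The n^2 pairs then contribute at most half of e. *)
pose e1 := e / (2 * (n ^ 2)%:R + 1).
have N0 : 0 <= (n ^ 2)%:R :> R by [].
have e10 : 0 < e1 by rewrite divr_gt0// ltr_wpDl// mulr_ge0.
have [A [_ hA]] := pairs_small n ltr01 e10.
near=> x.
have xA : A < x by near: x; apply: nbhs_pinfty_gt; exact: num_real.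
have xx0 : x0 <= x by near: x; apply: nbhs_pinfty_ge; exact: num_real.
rewrite /S (@nneseries_split _ _ 0 n)// add0n.
have -> : (1 + e) * g x = (1 + e / 2) * g x + e / 2 * g x by field.
rewrite EFinD leeD//; last first.
  apply: (@le_trans _ _ ((C * g x)%:E * \sum_(n <= t <oo) (b t `^ p)%:E)%E).
    rewrite -nneseriesZl; last by move=> t _; rewrite lee_fin powR_ge0.
    apply: lee_nneseries => [t _ _|t _]; first exact: pr0.
    have := term_le t (lexx 1) xx0; rewrite divr1 powR1 mul1r => h.
    by rewrite -EFinM lee_fin.
  apply: (le_trans (lee_wpmul2l _ hn)); first by rewrite lee_fin mulr_ge0 ?ltW.
  rewrite -EFinM lee_fin le_eqVlt; apply/orP; left; apply/eqP; field.
  by rewrite gt_eqF.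
rewrite sumEFin lee_fin big_mkord.
apply: (le_trans (bonferroni_ge P mY x n)).
rewrite mulrDl mul1r lerD//.
  rewrite gE; apply: le_pr.
  - by apply: bigsetU_measurable => i _; exact: measurable_gt.
  - exact: (mseries_gt 0).
  rewrite -bigcup_seq => w [t _ /= xY].
  apply: (@lt_le_trans _ _ (Y t w)%:E); first by rewrite lte_fin.
  apply: le_trans (nneseries_lim_ge t.+1 (fun k _ _ => Y0 k w)).
  by rewrite big_nat_recr//= leeDr// sume_ge0.
apply: (@le_trans _ _ (\sum_(t < n) \sum_(s < n) (e1 * g x))).
  apply: ler_sum => t _.
  have lt_n (s : nat) : (s < t)%N -> (s < n)%N by move=> st; exact: ltn_trans st (ltn_ord t).
  rewrite (big_ord_widen_cond n xpredT
     (fun s => pr P (both_exceed Y s t x)) (ltnW (ltn_ord t))).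
  rewrite (bigID (fun s : 'I_n => (s < t)%N) xpredT)/= ler_wpDr//.
    by apply: sumr_ge0 => s _; rewrite mulr_ge0 ?ltW.
  apply: ler_sum => s st; have := hA _ xA (s, t); rewrite /= mul1r; apply.
  by rewrite -val_eqE /= ltn_eqF.
rewrite !sumr_const !card_ord -mulrnA -[leLHS]mulr_natr mulrAC.
rewrite ler_wpM2r ?(ltW (g_gt0 _))// /e1 mulnn.
rewrite mulrAC ler_pdivrMr ?ltr_wpDl ?mulr_ge0//.
by rewrite mulrDr mulr1 mulrA divfK// ler_wpDr// divr_ge0// ltW.
Unshelve. all: by end_near. Qed.

Let series_split_event n (x e : R) :
  [set w | (x%:E < \sum_(0 <= t <oo) (Y t w)%:E)%E] `<=`
  [set w | (1 - e) * x < \sum_(t < n) Y t w] `|`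
  [set w | ((e * x)%:E < \sum_(n <= t <oo) (Y t w)%:E)%E].
Proof.
move=> w /= xY.
have [h1|h1] := ltP ((1 - e) * x) (\sum_(t < n) Y t w); first by left.
right; rewrite ltNge; apply/negP => h2; move: xY; apply/negP; rewrite -leNgt.
rewrite (@nneseries_split _ _ 0 n)// add0n sumEFin big_mkord.
rewrite (_ : x%:E = ((1 - e) * x)%:E + (e * x)%:E)%E; last first.
  by rewrite -EFinD; congr EFin; ring.
by rewrite leeD// lee_fin.
Qed.

(* n is taken so large that the tails of the two series in b are at most f,
   and f so small that the estimate of the sum of small terms is at most e. *)
Let remainder_small e a : 0 < e -> 0 < a -> exists n, (0 < n)%N /\
  \forall x \near +oo, pr P [set w | ((a * x)%:E < \sum_(n <= t <oo) (Y t w)%:E)%E]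
    <= e * g x.
Proof.
move=> e0 a0.
have K0 : 0 <= @dyadic_constant R p q by exact: dyadic_constant_ge0.
have aa : 0 < a `^ (- alpha) by rewrite powR_gt0.
pose D := C * (2 * a `^ (- alpha)) * (1 + 2 * @dyadic_constant R p q).
have D0 : 0 < D by rewrite !mulr_gt0// ltr_wpDr// mulr_ge0.
pose f := Num.min (2^-1) (e / D).
have f0 : 0 < f by rewrite lt_min invr_gt0 ltr0n divr_gt0.
have f2 : 2 * f <= 1 by rewrite -ler_pdivlMl// mulr1 /f ge_min lexx.
have fD : f * D <= e by rewrite -ler_pdivlMr// /f ge_min lexx orbT.
have [n [n0 hb hbp]] := tail_terms_small f0.
exists n; split => //.
have [A [_ hA]] := regular_variation_le g_gt0 g_rv a0 (ltr01 : 0 < 1).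
near=> x.
have xA : A < x by near: x; apply: nbhs_pinfty_gt; exact: num_real.
have x_gt0 : 0 < x by near: x; apply: nbhs_pinfty_gt; exact: num_real.
have xx0 : x0 <= a * x.
  by rewrite mulrC -ler_pdivrMr//; near: x; apply: nbhs_pinfty_ge; exact: num_real.
have shift (h : nat -> R) : (forall t, 0 <= h t) ->
   (\sum_(0 <= t <oo) (h (t + n)%N)%:E = \sum_(n <= t <oo) (h t)%:E)%E.
  by move=> h0; rewrite (nneseries_addn (f := fun t => (h t)%:E))// => i; rewrite lee_fin.
have := @heavy_tail_sum _ _ _ P (fun t => Y (t + n)%N) (fun t => b (t + n)%N) p q
  (a * x) (C * g (a * x)) f f (fun t => mY _) (fun t => Y_gt0 _) (fun t => b_gt0 _)
  p_ge1 qp (mulr_gt0 a0 x_gt0) (ltW (mulr_gt0 C0 (g_gt0 _))) f0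
  (fun t k k1 => term_le (t + n)%N k1 xx0).
rewrite (shift b)// ?(shift (fun t => b t `^ p)) => [| |t]; last 2 first.
- by move=> t; exact: powR_ge0.
- exact: ltW.
move=> /(_ hb hbp).
rewrite (_ : [set w | _] = [set w | ((a * x)%:E < \sum_(n <= t <oo) (Y t w)%:E)%E]); last first.
  by apply/seteqP; split => w /=; rewrite (shift (fun t => Y t w))// => t; exact: ltW.
move/le_trans; apply.
have f2p : (2 * f) `^ p <= 2 * f.
  by rewrite ge1r_powR// f2 mulr_gt0.
have h1 : f + @dyadic_constant R p q * (2 * f) `^ p <= f * (1 + 2 * @dyadic_constant R p q).
  rewrite mulrDr mulr1 lerD2l [leRHS](_ : _ = @dyadic_constant R p q * (2 * f)).
    exact: ler_wpM2l.
  by ring.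
have h2 := hA _ xA.
rewrite (le_trans (ler_wpM2l (ltW (mulr_gt0 C0 (g_gt0 _))) h1))//.
rewrite (@le_trans _ _ (C * ((1 + 1) * a `^ (- alpha) * g x) *
   (f * (1 + 2 * @dyadic_constant R p q))))//.
  by rewrite ler_wpM2r ?ler_pM2l// mulr_ge0 ?(ltW f0)// addr_ge0// mulr_ge0.
rewrite (_ : C * _ * _ = f * D * g x); last by rewrite /D; ring.
by rewrite ler_wpM2r// ltW.
Unshelve. all: by end_near. Qed.

(* Let n be such that the terms of index at least n rarely exceed e x in
   total; then the first n terms exceed (1 - e) x, and up to negligible pairs
   one of them exceeds (1 - 2 e) x by itself. *)
Let sum_tails_ge_scaled e : 0 < e -> e <= 4^-1 ->
  \forall x \near +oo, (((1 - 2 * e) * g x)%:E <= S ((1 - 2 * e) * x))%E.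
Proof.
move=> e0 e4.
have [n [n0 [A [_ hA]]]] := remainder_small e0 e0.
have nR : 0 < n%:R :> R by rewrite ltr0n.
pose e1 := e / (n * n)%:R.
have e10 : 0 < e1 by rewrite divr_gt0// ltr0n muln_gt0 n0.
have en : 0 < e / n%:R by rewrite divr_gt0.
have [B [_ hB]] := pairs_small n en e10.
near=> x.
have xA : A < x by near: x; apply: nbhs_pinfty_gt; exact: num_real.
have xB : B < x by near: x; apply: nbhs_pinfty_gt; exact: num_real.
have x_gt0 : 0 < x by near: x; apply: nbhs_pinfty_gt; exact: num_real.
have e2 : e <= 2^-1 by rewrite (le_trans e4)// lef_pV2 ?posrE// ler_nat.
have hpairs := hB _ xB.
set s := \sum_(t < n) pr P [set w | (1 - 2 * e) * x < Y t w].
have Sge : (s%:E <= S ((1 - 2 * e) * x))%E.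
  rewrite /S (le_trans _ (nneseries_lim_ge n (fun k _ _ => pr0 _)))//.
  by rewrite sumEFin big_mkord.
apply: le_trans Sge; rewrite lee_fin.
have h1 := finite_sum_pr_le P mY (fun t w => ltW (Y_gt0 t w)) n x_gt0 e0 e2.
have h2 := hA _ xA.
have h3 : \sum_(u : 'I_n * 'I_n | u.1 != u.2)
    pr P (both_exceed Y u.1 u.2 (e * x / n%:R)) <= e * g x.
  apply: (@le_trans _ _ (\sum_(u : 'I_n * 'I_n) (e1 * g x))).
    rewrite [leRHS](bigID (fun u : 'I_n * 'I_n => u.1 != u.2))/= ler_wpDr//.
      by apply: sumr_ge0 => u _; rewrite mulr_ge0 ?ltW.
    by apply: ler_sum => u uu; rewrite mulrAC; exact: hpairs.
  rewrite sumr_const card_prod !card_ord -[leLHS]mulr_natr mulrAC.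
  by rewrite /e1 divfK// gt_eqF// ltr0n muln_gt0 n0.
have h4 : g x <= pr P [set w | (1 - e) * x < \sum_(t < n) Y t w] +
     pr P [set w | ((e * x)%:E < \sum_(n <= t <oo) (Y t w)%:E)%E].
  have m1 : measurable [set w | (1 - e) * x < \sum_(t < n) Y t w].
    by apply: measurable_gt; exact: measurable_sum.
  rewrite gE (le_trans _ (pr_setU_le P m1 (mseries_gt n (e * x))))//.
  apply: le_pr; [exact: (mseries_gt 0)|exact: measurableU|exact: series_split_event].
by rewrite -/s in h1; lra.
Unshelve. all: by end_near. Qed.

(** The previous comparison bounds the sum of tails at u x with u = 1 - 2 f;
    regular variation at u^-1 brings it back to x, at the cost of a factor u
    `^ alpha that is close to 1 when f is small. *)
Lemma sum_tails_ge e : 0 < e -> e < 1 ->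
  \forall x \near +oo, (((1 - e) * g x)%:E <= S x)%E.
Proof.
move=> e0 e1.
pose e' := e / 3.
have e'0 : 0 < e' by rewrite divr_gt0.
have e'1 : e' < 1 by rewrite /e'; lra.
pose c := (1 - e') `^ alpha^-1.
have c0 : 0 < c by rewrite powR_gt0// subr_gt0.
have ca : c `^ alpha = 1 - e'.
  by rewrite /c -powRrM mulVf ?gt_eqF// powRr1// subr_ge0 ltW.
have c1 : c < 1.
  rewrite ltNge; apply/negP => c1.
  have := ge0_ler_powR (ltW alpha0) (ler01 : 1 \in Num.nneg) (ltW c0 : c \in Num.nneg) c1.
  by rewrite powR1 ca; lra.
pose f := Num.min (4^-1) (Num.min (e' / 2) ((1 - c) / 2)).
have f0 : 0 < f by rewrite !lt_min invr_gt0 ltr0n !divr_gt0// subr_gt0.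
have f4 : f <= 4^-1 by rewrite /f ge_min lexx.
have fe : f <= e' / 2 by rewrite /f !ge_min lexx orbT.
have fc : f <= (1 - c) / 2 by rewrite /f !ge_min lexx !orbT.
pose u := 1 - 2 * f.
have uc : c <= u by rewrite /u; lra.
have u0 : 0 < u by exact: lt_le_trans uc.
have ue : 1 - e' <= u by rewrite /u; lra.
have ua : 1 - e' <= u `^ alpha.
  by rewrite -ca ge0_ler_powR ?nnegrE// ltW.
have uV0 : 0 < u^-1 by rewrite invr_gt0.
have [A [_ hA]] := sum_tails_ge_scaled f0 f4.
have e'lt : 1 - e' < 1 by rewrite gtrBl.
have [B [_ hB]] := regular_variation_ge g_gt0 g_rv uV0 e'lt.
near=> x.
have xB : B < x by near: x; apply: nbhs_pinfty_gt; exact: num_real.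
have xA : A < u^-1 * x.
  by rewrite mulrC -ltr_pdivrMr//; near: x; apply: nbhs_pinfty_gt; exact: num_real.
have := hA _ xA; rewrite -/u mulVKf ?gt_eqF//; apply: le_trans; rewrite lee_fin.
have uaV : u^-1 `^ (- alpha) = u `^ alpha.
  by rewrite powRN -[u^-1]powR_inv1 ?(ltW u0)// -powRrM mulN1r powRN invrK.
have := hB _ xB; rewrite uaV => h.
rewrite (le_trans _ (ler_wpM2l (ltW u0) h))// mulrA ler_wpM2r// ?(ltW (g_gt0 _))//.
have p1 : 0 <= 1 - e' by rewrite subr_ge0 ltW.
rewrite (@le_trans _ _ ((1 - e') * ((1 - e') * (1 - e'))))//; last first.
  by rewrite ler_pM// ?mulr_ge0// ler_wpM2l.
rewrite (_ : 1 - e = 1 - 3 * e'); last by rewrite /e'; field.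
by have := e'0; have := p1; nra.
Unshelve. all: by end_near. Qed.

End OneBigJump.

(** * Complex moments *)

Section ComplexMean.
Context d (T : measurableType d) (R : realType) (P : probability T R).
Local Open Scope complex_scope.

Lemma cseries_sum_eq0 (u : nat -> R[i]) :
  series (fun t => complex.Re (u t)) @ \oo --> (0 : R) ->
  series (fun t => complex.Im (u t)) @ \oo --> (0 : R) ->
  cseries_sum u = 0.
Proof.
move=> hRe hIm; rewrite /cseries_sum; apply: (@cvg_lim (R[i]^o)) => //.
have seriesE n : series u n =
    series (fun t => complex.Re (u t)) n +i* series (fun t => complex.Im (u t)) n.
  elim: n => [|n IH]; first by rewrite /series/= !big_nil.
  rewrite !seriesSr IH; case: (u n) => a b /=.
  by [].
apply/(@cvgrPdist_lt _ (R[i]^o)) => e e0.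
have [eR eI] : 0 < complex.Re e /\ complex.Im e = 0.
  by move: e0; rewrite ltcE/= => /andP[/eqP -> ?].
have eE : e = (complex.Re e)%:C by case: e eI {e0 eR} => x y /= ->.
have e2 : 0 < complex.Re e / 2 by rewrite divr_gt0.
move/cvgrPdist_lt : hRe => /(_ _ e2) hRe; move/cvgrPdist_lt : hIm => /(_ _ e2) hIm.
near=> n.
rewrite sub0r normrN seriesE eE.
have h1 : `|0 - series (fun t => complex.Re (u t)) n| < complex.Re e / 2 by near: n.
have h2 : `|0 - series (fun t => complex.Im (u t)) n| < complex.Re e / 2 by near: n.
rewrite !sub0r !normrN in h1 h2.
rewrite normc_def ltcR/=.
set a := series _ n in h1 *; set b := series _ n in h2 *.
have sqrtE : complex.Re e = Num.sqrt (complex.Re e ^+ 2) by rewrite sqrtr_sqr gtr0_norm.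
rewrite sqrtE ltr_sqrt ?exprn_gt0//.
move: h1 h2; rewrite -(real_normK (num_real a)) -(real_normK (num_real b)).
by have := normr_ge0 a; have := normr_ge0 b; nra.
Unshelve. all: by end_near. Qed.

Lemma Re_cpowR (x alpha beta : R) :
  complex.Re (cpowR x (alpha +i* beta)) = x `^ alpha * cos (beta * ln x).
Proof. by rewrite /cpowR/= mul0r subr0. Qed.

Lemma Im_cpowR (x alpha beta : R) :
  complex.Im (cpowR x (alpha +i* beta)) = x `^ alpha * sin (beta * ln x).
Proof. by rewrite /cpowR/= mul0r addr0. Qed.

Lemma Re_cexpectation (Z : T -> R[i]) :
  complex.Re (cexpectation P Z) = \int[P]_w complex.Re (Z w).
Proof. by rewrite /cexpectation/= unlock. Qed.

Lemma Im_cexpectation (Z : T -> R[i]) :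
  complex.Im (cexpectation P Z) = \int[P]_w complex.Im (Z w).
Proof. by rewrite /cexpectation/= unlock. Qed.

End ComplexMean.

(** * Random sequences as functions on a product space *)

HB.instance Definition _ (R : realType) :=
  @Measure_isSigmaFinite.Build _ _ R (@counting nat R) (sigma_finite_counting R).

Section CountingProduct.
Context d (T : measurableType d) (R : realType) (P : probability T R).

Local Notation count := (@counting nat R : {sigma_finite_measure set nat -> \bar R}).
Let sigma_finite_product_counting : sigma_finite setT (P \x count)%E.
Proof.
exists (fun n => setT `*` `I_n).
  apply/esym/seteqP; split => // -[w t] _; exists t.+1 => //.
  by split => //=.
move=> n; split; first exact: measurableX.
have -> := product_measure1E P count measurableT (I : measurable `I_n).
have cn : (@counting nat R `I_n < +oo)%E by rewrite /counting asboolT// ltry.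
have PT : (P : {measure set T -> \bar R}) setT = 1%E by exact: probability_setT.
by rewrite PT mul1e; exact: cn.

Qed.

(** A sequence of random variables is a function on T * nat, and a series of
    expectations is one integral against this measure; limit theorems thus
    apply to all the terms at once. *)
Definition product_counting : {sigma_finite_measure set (T * nat)%type -> \bar R} :=
  HB.pack (P \x count)%E (Measure_isSigmaFinite.Build _ _ _ (P \x count)%E sigma_finite_product_counting).

Local Notation mu := product_counting.

Lemma measurable_uncurry_nat (f : nat -> T -> R) :
  (forall t, measurable_fun setT (f t)) ->
  measurable_fun setT (fun u : T * nat => f u.2 u.1).
Proof.
move=> mf _ A mA; rewrite setTI.
rewrite (_ : _ @^-1` _ = \bigcup_t ((f t @^-1` A) `*` [set t])).
  apply: bigcup_measurable => t _; apply: measurableX => //.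
  by rewrite -[X in measurable X]setTI; exact: mf.
apply/seteqP; split => [[w t] /= fA|[w t] [k _ [/= fA ->]]//].
by exists t.
Qed.

Lemma ge0_integral_product_counting (f : nat -> T -> R) :
  (forall t, measurable_fun setT (f t)) -> (forall t w, 0 <= f t w) ->
  (\int[mu]_u (f u.2 u.1)%:E = \sum_(0 <= t <oo) \int[P]_w (f t w)%:E)%E.
Proof.
move=> mf f0; have mF := measurable_uncurry_nat mf.
rewrite (@fubini_tonelli2 _ _ _ _ _ P (@counting nat R) (fun u : T * nat => (f u.2 u.1)%:E)).
- rewrite /fubini_G ge0_integral_count//= => t.
  by apply: integral_ge0 => w _; rewrite lee_fin.
- exact/measurable_EFinP.
- by move=> u; rewrite lee_fin.
Qed.

Lemma integrable_product_counting (f : nat -> T -> R) :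
  (forall t, measurable_fun setT (f t)) ->
  (\sum_(0 <= t <oo) \int[P]_w (`|f t w|)%:E < +oo)%E ->
  mu.-integrable setT (fun u => (f u.2 u.1)%:E).
Proof.
move=> mf fs; apply/integrableP; split.
  by apply/measurable_EFinP; exact: measurable_uncurry_nat.
rewrite (ge0_integral_product_counting (f := fun t w => `|f t w|))// => t.
by apply: measurableT_comp => //; exact: normr_measurable.
Qed.

Lemma ge0_cvg_series_product_counting (f : nat -> T -> R) :
  (forall t, measurable_fun setT (f t)) -> (forall t w, 0 <= f t w) ->
  (\sum_(0 <= t <oo) \int[P]_w (f t w)%:E < +oo)%E ->
  series (fun t => \int[P]_w f t w) @ \oo --> \int[mu]_u f u.2 u.1.
Proof.
move=> mf f0 fs.
have int0 t : (0 <= \int[P]_w (f t w)%:E)%E by apply: integral_ge0 => w _; rewrite lee_fin.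
have intfin t : (\int[P]_w (f t w)%:E)%E \is a fin_num.
  rewrite ge0_fin_numE//; apply: le_lt_trans fs.
  apply: le_trans (nneseries_lim_ge t.+1 (fun k _ _ => int0 k)).
  by rewrite big_nat_recr//= leeDr// sume_ge0.
have sfin : (\sum_(0 <= t <oo) \int[P]_w (f t w)%:E)%E \is a fin_num.
  by rewrite ge0_fin_numE// nneseries_ge0.
rewrite /Rintegral (ge0_integral_product_counting mf f0).
rewrite (_ : series _ = fine \o (fun n => \sum_(0 <= t < n) \int[P]_w (f t w)%:E)%E).
  by apply: fine_cvg; rewrite fineK//; exact: (is_cvg_nneseries (fun t _ _ => int0 t)).
apply/funext => n /=; rewrite /series/= -[LHS]/(fine (_%:E)) -sumEFin; congr fine.
by apply: eq_bigr => t _; rewrite fineK.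
Qed.

(** Reduced to nonnegative sequences by splitting into positive and negative
    parts. *)
Lemma cvg_series_product_counting (f : nat -> T -> R) :
  (forall t, measurable_fun setT (f t)) ->
  (\sum_(0 <= t <oo) \int[P]_w (`|f t w|)%:E < +oo)%E ->
  series (fun t => \int[P]_w f t w) @ \oo --> \int[mu]_u f u.2 u.1.
Proof.
move=> mf fs.
have mabs t : measurable_fun setT (fun w => `|f t w|).
  by apply: measurableT_comp => //; exact: normr_measurable.
have ifP (h : nat -> T -> R) : (forall t, measurable_fun setT (h t)) ->
    (forall t w, 0 <= h t w) -> (forall t w, h t w <= `|f t w|) ->
    (\sum_(0 <= t <oo) \int[P]_w (h t w)%:E < +oo)%E.
  move=> mh h0 hf; apply: le_lt_trans fs; apply: lee_nneseries => t.
    by move=> _ _; apply: integral_ge0 => w _; rewrite lee_fin.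
  move=> _; apply: ge0_le_integral => //; try exact/measurable_EFinP.
  - by move=> w _; rewrite lee_fin.
  - by move=> w _; rewrite lee_fin.
have finite_term (h : nat -> T -> R) t : (forall t, measurable_fun setT (h t)) ->
    (forall t w, 0 <= h t w) -> (forall t w, h t w <= `|f t w|) ->
    P.-integrable setT (EFin \o h t).
  move=> mh h0 hf; apply/integrableP; split; first exact/measurable_EFinP.
  under eq_integral do rewrite /= ger0_norm//.
  apply: le_lt_trans (ifP h mh h0 hf).
  have int0 s : (0 <= \int[P]_w (h s w)%:E)%E.
    by apply: integral_ge0 => w _; rewrite lee_fin.
  apply: le_trans (nneseries_lim_ge t.+1 (fun k _ _ => int0 k)).
  by rewrite big_nat_recr//= leeDr// sume_ge0.
pose fp t w := Num.max (f t w) 0; pose fn t w := Num.max (- f t w) 0.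
have mp t : measurable_fun setT (fp t) by exact: measurable_maxr.
have mn t : measurable_fun setT (fn t).
  by apply: measurable_maxr => //; exact: measurable_funN.
have p0 t w : 0 <= fp t w by rewrite le_max lexx orbT.
have n0 t w : 0 <= fn t w by rewrite le_max lexx orbT.
have p_le t w : fp t w <= `|f t w| by rewrite ge_max ler_norm normr_ge0.
have n_le t w : fn t w <= `|f t w| by rewrite ge_max -normrN ler_norm normr_ge0.
have splitE t w : f t w = fp t w - fn t w.
  rewrite /fp /fn; have [h|h] := leP 0 (f t w).
    by rewrite max_r ?subr0// oppr_le0.
  by rewrite max_l ?sub0r ?opprK// oppr_ge0 ltW.
have int_mu (h : nat -> T -> R) : (forall t, measurable_fun setT (h t)) ->
    (forall t w, 0 <= h t w) -> (forall t w, h t w <= `|f t w|) ->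
    mu.-integrable setT (EFin \o (fun u => h u.2 u.1)).
  move=> mh h0 hf; apply: integrable_product_counting => //.
  under eq_eseriesr => t _ do under eq_integral do rewrite ger0_norm//.
  exact: ifP.
have -> : \int[mu]_u f u.2 u.1 = \int[mu]_u fp u.2 u.1 - \int[mu]_u fn u.2 u.1.
  rewrite -RintegralB//; [|exact: int_mu|exact: int_mu].
  by apply: eq_Rintegral => u _.
rewrite (_ : series _ = series (fun t => \int[P]_w fp t w) \- series (fun t => \int[P]_w fn t w)).
  apply: cvgB; apply: ge0_cvg_series_product_counting => //; exact: ifP.
apply/funext => n; rewrite /series/= -sumrB; apply: eq_bigr => t _.
rewrite -RintegralB//; [|exact: finite_term|exact: finite_term].
by apply: eq_Rintegral => w _.
Qed.

End CountingProduct.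

(** * Moments of the weights *)

Section Moments.
Context d (T : measurableType d) (R : realType) (P : probability T R).
Implicit Types (alpha eta eps theta : R).

Lemma powR_le_two_sided alpha eps s theta : 0 < theta -> - eps <= s -> s <= eps ->
  theta `^ (alpha + s) <= two_sided_power alpha eps theta.
Proof.
move=> t0 s1 s2; rewrite /two_sided_power.
have [t1|t1] := leP 1 theta.
  by rewrite ler_wpDr ?powR_ge0// ler_powR// lerD2l.
by rewrite ler_wpDl ?powR_ge0// ger_powR ?t0 ?(ltW t1)// lerD2l.
Qed.

Lemma two_sided_power_le alpha eps eta theta : 0 < theta -> 0 <= eta -> eta <= eps ->
  two_sided_power alpha eta theta <= 2 * two_sided_power alpha eps theta.
Proof.
move=> t0 e0 e1; rewrite mulr_natl mulr2n lerD//; apply: powR_le_two_sided => //; lra.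
Qed.

(** With u = (eta / 2) ln theta this is u^2 <= e^(2 |u|), because e^(2 |u|) is
    one of theta^eta and theta^-eta. *)
Lemma log_square_le alpha eta theta : 0 < theta -> 0 < eta ->
  theta `^ alpha * ln theta ^+ 2 <= (eta / 2) ^- 2 * two_sided_power alpha eta theta.
Proof.
move=> t0 e0; have h0 : 0 < (eta / 2) ^+ 2 by rewrite exprn_gt0// divr_gt0.
rewrite ler_pdivlMl//.
pose u := eta / 2 * ln theta.
have key : u ^+ 2 <= theta `^ eta + theta `^ (- eta).
  have h1 : `|u| <= expR `|u| by rewrite (le_trans _ (expR_ge1Dx _))// lerDr.
  have h2 : u ^+ 2 <= expR (2 * `|u|).
    rewrite -(real_normK (num_real u)) mulr_natl mulr2n expRD -expr2.
    by rewrite ler_sqr ?nnegrE ?expR_ge0.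
  rewrite (le_trans h2)// /powR gt_eqF//.
  have e2 : eta * ln theta = 2 * u by rewrite /u; field.
  rewrite e2 mulNr e2; have [u0|u0] := leP 0 u.
    by rewrite ger0_norm// ler_wpDr ?expR_ge0.
  by rewrite ltr0_norm// mulrN ler_wpDl ?expR_ge0.
have ta : 0 <= theta `^ alpha by exact: powR_ge0.
have -> : two_sided_power alpha eta theta = theta `^ alpha * (theta `^ eta + theta `^ (- eta)).
  have tn : theta != 0 by rewrite gt_eqF.
  by rewrite /two_sided_power !powRD ?tn ?implybT// mulrDr.
rewrite mulrCA ler_wpM2l//; move: key; rewrite /u exprMn; exact.
Qed.

Variable Theta : nat -> {RV P >-> R}.
Hypothesis Theta_gt0 : forall t w, 0 < Theta t w.

Lemma moment_roots_summable alpha eps eta p :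
  0 < eta -> eta <= eps -> 1 <= p ->
  (\sum_(0 <= t <oo) 'E_P[fun w => two_sided_power alpha eps (Theta t w)] `^ p^-1 < +oo)%E ->
  (forall t, P.-integrable setT (EFin \o (fun w => two_sided_power alpha eta (Theta t w)))) /\
  (\sum_(0 <= t <oo)
    ((\int[P]_w two_sided_power alpha eta (Theta t w)) `^ p^-1)%:E < +oo)%E.
Proof.
move=> eta0 etae p1 Es.
have p0 : 0 < p by exact: lt_le_trans p1.
have pV : 0 < p^-1 by rewrite invr_gt0.
pose E t := ('E_P[fun w => two_sided_power alpha eps (Theta t w)])%E.
have E_int t : E t = (\int[P]_w (two_sided_power alpha eps (Theta t w))%:E)%E.
  by rewrite /E unlock.
have E0 t : (0 <= E t)%E.
  by rewrite E_int; apply: integral_ge0 => w _; rewrite lee_fin two_sided_power_ge0.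
have Efin t : (E t < +oo)%E.
  apply: (@lty_poweRy _ _ p^-1); first by rewrite gt_eqF.
  apply: le_lt_trans Es.
  apply: le_trans (nneseries_lim_ge t.+1 (fun k _ _ => poweR_ge0 _ _)).
  by rewrite big_nat_recr//= leeDr// sume_ge0// => i _; exact: poweR_ge0.
have ieps t : P.-integrable setT (EFin \o (fun w => two_sided_power alpha eps (Theta t w))).
  apply/integrableP; split; first by apply/measurable_EFinP; exact: measurable_two_sided.
  under eq_integral do rewrite /= ger0_norm ?two_sided_power_ge0//.
  by rewrite -E_int.
have le2 t w : two_sided_power alpha eta (Theta t w) <=
    2 * two_sided_power alpha eps (Theta t w).
  by rewrite two_sided_power_le// ltW.
have ieta t : P.-integrable setT (EFin \o (fun w => two_sided_power alpha eta (Theta t w))).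
  apply: (@integrable_le _ _ _ P _ (fun w => 2 * two_sided_power alpha eps (Theta t w))).
  - exact: measurable_two_sided.
  - exact: (integrableZl measurableT 2 (ieps t)).
  - by move=> w; rewrite ger0_norm ?two_sided_power_ge0.
split => //.
apply: (@le_lt_trans _ _ (\sum_(0 <= t <oo) (2 `^ p^-1)%:E * E t `^ p^-1)%E).
  apply: lee_nneseries => [t _ _|t _]; first by rewrite lee_fin powR_ge0.
  have -> : E t = (\int[P]_w two_sided_power alpha eps (Theta t w))%:E.
    by rewrite E_int /Rintegral fineK//; exact: (integrable_fin_num _ (ieps t)).
  rewrite poweR_EFin -EFinM lee_fin -powRM//; last first.
    by apply: Rintegral_ge0 => w _; exact: two_sided_power_ge0.
  rewrite ge0_ler_powR ?(ltW pV) ?nnegrE//.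
  - by apply: Rintegral_ge0 => w _; exact: two_sided_power_ge0.
  - by rewrite mulr_ge0//; apply: Rintegral_ge0 => w _; exact: two_sided_power_ge0.
  rewrite -RintegralZl//; apply: le_Rintegral => //.
  exact: (integrableZl measurableT 2 (ieps t)).
rewrite nneseriesZl; last by move=> t _; exact: poweR_ge0.
by rewrite lte_mul_pinfty// lee_fin powR_ge0.
Qed.

Lemma powR_summable (b : nat -> R) p : (forall t, 0 < b t) -> 1 <= p ->
  (\sum_(0 <= t <oo) (b t)%:E < +oo)%E -> (\sum_(0 <= t <oo) (b t `^ p)%:E < +oo)%E.
Proof.
move=> b0 p1 bs; pose B := fine (\sum_(0 <= t <oo) (b t)%:E)%E.
have bE t : (0 <= (b t)%:E)%E by rewrite lee_fin ltW.
have Bfin : (\sum_(0 <= t <oo) (b t)%:E)%E \is a fin_num.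
  by rewrite ge0_fin_numE// nneseries_ge0.
have bB t : b t <= B.
  rewrite -lee_fin fineK//.
  apply: le_trans (nneseries_lim_ge t.+1 (fun k _ _ => bE k)).
  by rewrite big_nat_recr//= leeDr// sume_ge0.
apply: (@le_lt_trans _ _ (\sum_(0 <= t <oo) (B `^ (p - 1))%:E * (b t)%:E)%E).
  apply: lee_nneseries => [t _ _|t _]; first by rewrite lee_fin powR_ge0.
  rewrite -EFinM lee_fin -mulr_powRB1 ?(ltW (b0 _)) ?(lt_le_trans ltr01)// mulrC.
  rewrite ler_pM2r// ge0_ler_powR ?subr_ge0 ?nnegrE ?(ltW (b0 _))//.
  exact: le_trans (ltW (b0 t)) (bB t).
rewrite nneseriesZl//; apply: lte_mul_pinfty => //; by rewrite lee_fin powR_ge0.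
Qed.

(** Puts the two moment assumptions in the form in which they are used, with
    an exponent p >= 1 that exceeds alpha + eta. For alpha < 1 one takes p = 1
    and eta so small that alpha + eta < 1. For alpha >= 1 one takes p = alpha
    + eps and leaves room by halving eps. *)
Lemma moment_choice alpha : 0 < alpha ->
  (alpha < 1 ->
    exists2 eps : R, 0 < eps < alpha &
    (\sum_(0 <= t <oo)
       'E_P[fun w => (Theta t w `^ (alpha + eps) + Theta t w `^ (alpha - eps))%R]
     < +oo)%E) ->
  (1 <= alpha ->
    exists2 eps : R, 0 < eps < alpha &
    (\sum_(0 <= t <oo)
       'E_P[fun w => (Theta t w `^ (alpha + eps) + Theta t w `^ (alpha - eps))%R]
         `^ (alpha + eps)^-1
     < +oo)%E) ->
  exists p eta : R, [/\ 1 <= p, 0 < eta < alpha, alpha + eta < p,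
    forall t, P.-integrable setT (EFin \o (fun w => two_sided_power alpha eta (Theta t w))) &
    (\sum_(0 <= t <oo)
      ((\int[P]_w two_sided_power alpha eta (Theta t w)) `^ p^-1)%:E < +oo)%E].
Proof.
move=> a0 H1 H2; have [a1|a1] := ltP alpha 1.
  have [eps /andP[e0 ea] Es] := H1 a1.
  pose eta := Num.min eps ((1 - alpha) / 2).
  have eta0 : 0 < eta by rewrite lt_min e0 divr_gt0// subr_gt0.
  have ee : eta <= eps by rewrite /eta ge_min lexx.
  have e1 : eta <= (1 - alpha) / 2 by rewrite /eta ge_min lexx orbT.
  have [|i s] := @moment_roots_summable alpha eps eta 1 eta0 ee (lexx 1).
    rewrite invr1; apply: le_lt_trans Es; apply: lee_nneseries => t _.
      by move=> _; exact: poweR_ge0.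
    rewrite poweRe1//; apply: expectation_ge0 => w; exact: two_sided_power_ge0.
  exists 1, eta; split => //; first by rewrite eta0 (le_lt_trans ee).
  by lra.
have [eps /andP[e0 ea] Es] := H2 a1.
pose eta := eps / 2.
have eta0 : 0 < eta by rewrite divr_gt0.
have ee : eta <= eps by rewrite /eta; lra.
have p1 : 1 <= alpha + eps by lra.
have [i s] := moment_roots_summable eta0 ee p1 Es.
exists (alpha + eps), eta; split => //; first by rewrite eta0 (le_lt_trans ee).
by rewrite /eta; lra.
Qed.

End Moments.

(** * The tail of the series against the tail of one term *)

Section SeriesTail.
Context d (T : measurableType d) (R : realType) (P : probability T R).
Variables (X Theta : nat -> {RV P >-> R}).
Hypothesis X_gt0 : forall t w, 0 < X t w.
Hypothesis Theta_gt0 : forall t w, 0 < Theta t w.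
Hypothesis indep : independent_families Theta X.

Let g := tail P (random_series Theta X).
Let F := tail P (EFin \o X 0%N).

Lemma independent_families_pair t : independent_pair (Theta t) (X t).
Proof.
move=> A B mA mB; apply: indep; apply: sub_sigma_algebra; exists t => //.
  by exists A => //; rewrite setTI.
by exists B => //; rewrite setTI.
Qed.

Let term_ge0 t w : (0 <= (Theta t w * X t w)%:E)%E.
Proof. by rewrite lee_fin mulr_ge0// ltW. Qed.

Lemma measurable_random_series_gt x :
  measurable [set w | (x%:E < random_series Theta X w)%E].
Proof.
rewrite -[X in measurable X]setTI; apply: emeasurable_fun_o_infty => //.
apply: ge0_emeasurable_sum => // t _.
by apply/measurable_EFinP; exact: measurable_funM.
Qed.

Lemma random_series_tail_nincr x y : x <= y -> g y <= g x.
Proof.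
move=> xy; apply: le_pr; [exact: measurable_random_series_gt..|].
by move=> w /=; apply: le_lt_trans; rewrite lee_fin.
Qed.

Lemma random_series_tail_le1 x : g x <= 1.
Proof. by apply: pr_le1; exact: measurable_random_series_gt. Qed.

(* A positive variable exceeds some positive constant with positive
   probability. *)
Let weight_bounded_below : exists2 e : R, 0 < e & 0 < pr P [set w | e < Theta 0%N w].
Proof.
apply: contrapT => no.
have zero n : P [set w | n.+1%:R^-1 < Theta 0%N w] = 0%E.
  have m : measurable [set w | n.+1%:R^-1 < Theta 0%N w] by exact: measurable_gt.
  rewrite prE//; congr EFin; apply/eqP; rewrite eq_le pr_ge0 andbT leNgt.
  by apply/negP => h; apply: no; exists n.+1%:R^-1.
have : P setT = 0%E.
  have -> : [set: T] = \bigcup_n [set w | n.+1%:R^-1 < Theta 0%N w].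
    apply/esym/seteqP; split => // w _.
    have t0 := Theta_gt0 0%N w.
    exists (Num.truncn (Theta 0%N w)^-1) => //=.
    by rewrite -[ltRHS]invrK ltf_pV2 ?posrE ?invr_gt0// truncnS_gt.
  apply/eqP; rewrite -measure_le0.
  apply: (le_trans (@measure_sigma_subadditive _ _ _ P _
     (fun n => [set w | n.+1%:R^-1 < Theta 0%N w]) _ _ (@subset_refl _ _))).
  - by move=> n; exact: measurable_gt.
  - by apply: bigcup_measurable => n _; exact: measurable_gt.
  by rewrite eseries0// => n _ _; exact: zero.
by rewrite probability_setT => /eqP; rewrite onee_eq0.
Qed.

Variable alpha : R.
Hypothesis g_gt0 : forall x, 0 < g x.
Hypothesis g_rv : forall t, 0 < t -> g (t * x) / g x @[x --> +oo] --> t `^ (- alpha).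

(** On the event that the first weight exceeds e, which is independent of X_1,
    the series exceeds e x as soon as X_1 exceeds x. So F x is at most a
    multiple of g (e x), and regular variation replaces e x by x for large x;
    for smaller x, g is bounded below. *)
Lemma single_tail_le : exists2 C : R, 0 < C & forall x, F x <= C * g x.
Proof.
have [e e0 pe] := weight_bounded_below.
set pi_e := pr P _ in pe.
have step x : 0 <= x -> pi_e * F x <= g (e * x).
  move=> x0.
  pose A := [set w | e < Theta 0%N w]; pose B := [set w | x < X 0%N w].
  have mA : measurable A by exact: measurable_gt.
  have mB : measurable B by exact: measurable_gt.
  have pB : pi_e * F x = pr P (A `&` B).
    rewrite /F tailE -[RHS]/(fine _).
    have := independent_families_pair 0%N (measurable_itv `]e, +oo[) (measurable_itv `]x, +oo[).
    have h (V : T -> R) y : V @^-1` `]y, +oo[ = [set w | y < V w].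
      by apply/seteqP; split => w /=; rewrite in_itv/= andbT.
    rewrite !h => ->; rewrite -/A -/B (prE P mA) (prE P mB) -EFinM//.
  rewrite pB; apply: le_pr; [exact: measurableI|exact: measurable_random_series_gt|].
  move=> w [/= eT xX].
  apply: (@lt_le_trans _ _ (Theta 0%N w * X 0%N w)%:E).
    rewrite lte_fin (@le_lt_trans _ _ (e * X 0%N w))//.
      by rewrite ler_pM2l// ltW.
    by rewrite ltr_pM2r.
  apply: le_trans (nneseries_lim_ge 1 (fun k _ _ => term_ge0 k w)).
  by rewrite big_nat1.
have [A [_ hA]] := regular_variation_le g_gt0 g_rv e0 (ltr01 : 0 < 1).
pose x1 := Num.max 0 (A + 1).
pose c1 := pi_e^-1 * ((1 + 1) * e `^ (- alpha)).
have c10 : 0 < c1 by rewrite !mulr_gt0 ?invr_gt0// powR_gt0.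
exists (c1 + (g x1)^-1); first by rewrite addr_gt0// invr_gt0.
move=> x; have [xx1|x1x] := leP x x1.
  rewrite (le_trans (tail_le1 _ _))// mulrDl ler_wpDl//; first exact: ltW (mulr_gt0 c10 (g_gt0 x)).
  by rewrite mulrC ler_pdivlMr// mul1r random_series_tail_nincr.
rewrite mulrDl ler_wpDr//; first by rewrite mulr_ge0 ?invr_ge0 ?(ltW (g_gt0 _)).
have x0 : 0 <= x by rewrite (le_trans _ (ltW x1x))// /x1 le_max lexx.
have xA : A < x by rewrite (lt_trans _ x1x)// /x1 lt_max ltrDl ltr01 orbT.
rewrite -mulrA ler_pdivlMl// (le_trans (step _ x0))//; exact: hA.
Qed.

End SeriesTail.

(** * Deconvolution along a multiplicative average *)

(** The domination is only asked for large parameters; sequences are truncated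
    at s0, which does not change their tails. *)
Lemma dominated_cvg_Rintegral_pinfty (R : realType) d (T : measurableType d)
    (mu : {measure set T -> \bar R}) (f_ : R -> T -> R) (f g : T -> R) (s0 : R) :
  (forall s, measurable_fun setT (f_ s)) ->
  mu.-integrable setT (EFin \o g) ->
  (forall s x, s0 <= s -> `|f_ s x| <= g x) ->
  (forall x, f_ s x @[s --> +oo] --> f x) ->
  \int[mu]_x f_ s x @[s --> +oo] --> \int[mu]_x f x.
Proof.
move=> mf_ ig fg cf; apply/cvg_pinftyP => u u_oo.
pose v n := Num.max (u n) s0.
have u_ge : \forall n \near \oo, s0 <= u n by move/cvgryPge : u_oo; apply.
have uv : \forall n \near \oo, v n = u n.
  by apply: filterS u_ge => n h; rewrite /v max_l.
have v_oo : v n @[n --> \oo] --> +oo.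
  apply/cvgryPge => A; move/cvgryPge : u_oo => /(_ A).
  by apply: filterS => n h; rewrite /v le_max h.
have key : \int[mu]_x f_ (v n) x @[n --> \oo] --> \int[mu]_x f x.
  apply: (@dominated_cvg_Rintegral _ _ _ mu _ _ g) => //.
  - by move=> n x; apply: fg; rewrite /v le_max lexx orbT.
  - by move=> x; move/cvg_pinftyP : (cf x) => /(_ v); exact.
apply: cvg_trans key; apply: near_eq_cvg.
by apply: filterS uv => n ->.
Qed.

Section MellinTauberian.
Context (R : realType) d (S : measurableType d)
  (mu : {sigma_finite_measure set S -> \bar R}).
Variables (V : S -> R) (g F : R -> R) (alpha eta C M x0 : R).
Hypothesis mV : measurable_fun setT V.
Hypothesis V_gt0 : forall u, 0 < V u.
Hypothesis g_gt0 : forall x, 0 < g x.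
Hypothesis g_nincr : forall x y, x <= y -> g y <= g x.
Hypothesis g_rv : forall t, 0 < t -> g (t * x) / g x @[x --> +oo] --> t `^ (- alpha).
Hypothesis alpha0 : 0 < alpha.
Hypothesis eta0 : 0 < eta.
Hypothesis g_le : forall x theta, x0 <= x -> 0 < theta ->
  g (x / theta) <= C * g x * two_sided_power alpha eta theta.
Hypothesis F_ge0 : forall x, 0 <= F x.
Hypothesis F_nincr : forall x y, x <= y -> F y <= F x.
Hypothesis FM : forall x, F x <= M * g x.

Local Notation psi := (two_sided_power alpha eta).
Hypothesis ipsi : mu.-integrable setT (EFin \o (fun u => psi (V u))).
Hypothesis F_mean : (\int[mu]_u F (x / V u)) / g x @[x --> +oo] --> (1 : R).

Local Notation W := (fun u => V u `^ alpha).
Local Notation Y := (fun u => ln (V u)).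
Hypothesis transform_neq0 : forall beta,
  (cos_transform mu Y W beta, sin_transform mu Y W beta) != (0, 0).

Let mW : measurable_fun setT W.
Proof. exact: (measurableT_comp (@measurable_powR R alpha) mV). Qed.

Let mY : measurable_fun setT Y.
Proof. exact: (measurableT_comp (@measurable_ln R) mV). Qed.

Let W_le u : W u <= psi (V u).
Proof.
by rewrite -[in leLHS](addr0 alpha); apply: powR_le_two_sided => //; have := eta0; lra.
Qed.

Let iW : mu.-integrable setT (EFin \o W).
Proof.
apply: integrable_le mW ipsi _ => u; rewrite ger0_norm ?powR_ge0//; exact: W_le.
Qed.

Let iWY2 : mu.-integrable setT (EFin \o (fun u => W u * Y u ^+ 2)).
Proof.
apply: (integrable_le (g := fun u => (eta / 2) ^- 2 * psi (V u))).
- by apply: measurable_funM => //; exact: measurable_funX.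
- exact: (integrableZl measurableT ((eta / 2) ^- 2) ipsi).
- move=> u; rewrite ger0_norm; last by rewrite mulr_ge0 ?powR_ge0 ?sqr_ge0.
  exact: log_square_le.
Qed.

Let r s := F (expR s) / g (expR s).

Let r_ge0 s : 0 <= r s.
Proof. by rewrite divr_ge0// ltW. Qed.

Let r_le s : r s <= M.
Proof. by rewrite ler_pdivrMr. Qed.

Let mg : measurable_fun setT g.
Proof. by apply: nonincreasing_measurable => // x y; exact: g_nincr. Qed.

Let mF : measurable_fun setT F.
Proof. by apply: nonincreasing_measurable => // x y; exact: F_nincr. Qed.

Let mr : measurable_fun setT r.
Proof.
have mexp : measurable_fun setT (@expR R) by exact: measurable_expR.
apply: measurable_funM; first exact: (measurableT_comp mF mexp).
rewrite (_ : (fun s => _) = (fun s => g (expR s) `^ (-1))).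
  exact: (measurableT_comp (@measurable_powR R (-1)) (measurableT_comp mg mexp)).
by apply/funext => s; rewrite powR_inv1// ltW.
Qed.

Let mscale x : measurable_fun setT (fun u => x / V u).
Proof. exact: measurable_div_pos. Qed.

Let F_scale_le x theta : x0 <= x -> 0 < theta -> F (x / theta) <= M * C * g x * psi theta.
Proof.
move=> xx0 t0; rewrite (le_trans (FM _))// -!mulrA ler_wpM2l//.
  exact: le_trans (r_ge0 0) (r_le 0).
by rewrite mulrA; exact: g_le.
Qed.

Let iF x : x0 <= x -> mu.-integrable setT (EFin \o (fun u => F (x / V u))).
Proof.
move=> xx0; apply: (integrable_le (g := fun u => M * C * g x * psi (V u))).
- exact: (measurableT_comp mF (mscale x)).
- exact: (integrableZl measurableT (M * C * g x) ipsi).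
- by move=> u; rewrite ger0_norm//; exact: F_scale_le.
Qed.

Let iWr s : mu.-integrable setT (EFin \o (fun u => W u * r (s - Y u))).
Proof.
apply: (integrable_le (g := fun u => M * W u)).
- apply: measurable_funM => //; apply: (measurableT_comp mr).
  exact: measurable_funB.
- exact: (integrableZl measurableT M iW).
- move=> u; rewrite (ger0_norm (mulr_ge0 (powR_ge0 _ _) (r_ge0 _))).
  by rewrite mulrC ler_wpM2r ?powR_ge0.
Qed.

(* What is lost when the average of F (e^s / V) / g (e^s) is replaced by the
   convolution of r with the image of W. *)
Let k s u := W u * r (s - Y u) - F (expR s / V u) / g (expR s).

Let expR_shift s u : expR (s - Y u) = expR s / V u.
Proof. by rewrite expRB lnK ?posrE. Qed.

Let kE s u : k s u = r (s - Y u) * (W u - g (expR s / V u) / g (expR s)).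
Proof.
rewrite /k /r expR_shift; field.
by rewrite !gt_eqF.
Qed.

Let k_le s u : x0 <= s -> `|k s u| <= M * (1 + C) * psi (V u).
Proof.
move=> ss; have es : x0 <= expR s.
  by rewrite (le_trans ss)// (le_trans _ (expR_ge1Dx _))// lerDr.
rewrite kE normrM ger0_norm// -mulrA; apply: ler_pM => //.
rewrite (le_trans (ler_normB _ _))// mulrDl mul1r lerD//.
  by rewrite ger0_norm ?powR_ge0//; exact: W_le.
rewrite ger0_norm; last by rewrite divr_ge0// ltW.
by rewrite ler_pdivrMr// mulrAC; exact: g_le.
Qed.

Let k_cvg u : k s u @[s --> +oo] --> 0.
Proof.
have h : g (expR s / V u) / g (expR s) @[s --> +oo] --> W u.
  have := g_rv (t := (V u)^-1); rewrite invr_gt0 => /(_ (V_gt0 u)).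
  rewrite -[(V u)^-1]powR_inv1 ?(ltW (V_gt0 u))// -powRrM mulN1r opprK.
  move=> /cvg_pinftyP h; apply/cvg_pinftyP => v v_oo.
  have := h (fun n => expR (v n)); rewrite powR_inv1 ?(ltW (V_gt0 u))//.
  rewrite (_ : (fun n => g ((V u)^-1 * expR (v n)) / _) =
     (fun n => g (expR (v n) / V u) / g (expR (v n)))); last first.
    by apply/funext => n; rewrite [_ * expR _]mulrC.
  apply; apply/cvgryPge => A; move/cvgryPge : v_oo => /(_ A).
  by apply: filterS => n An; rewrite (le_trans An)// (le_trans _ (expR_ge1Dx _))// lerDr.
have h2 : M * `|W u - g (expR s / V u) / g (expR s)| @[s --> +oo] --> 0.
  rewrite -(mulr0 M); apply: cvgM; first exact: cvg_cst.
  rewrite -[X in _ --> X](normr0 R); apply: cvg_norm.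
  rewrite -(subrr (W u)); apply: cvgB => //; exact: cvg_cst.
apply: norm_cvg0; apply: (squeeze_cvgr _ (cvg_cst 0) h2); apply: nearW => s.
by rewrite normr_ge0/= kE normrM ger0_norm// ler_wpM2r.
Qed.

Let convolution_cvg : \int[mu]_u (W u * r (s - Y u)) @[s --> +oo] --> (1 : R).
Proof.
have mk s : measurable_fun setT (k s).
  apply: measurable_funB.
    by apply/measurable_EFinP; exact: measurable_int (iWr s).
  apply: measurable_funM => //; exact: (measurableT_comp mF (mscale _)).
have h := dominated_cvg_Rintegral_pinfty mk (integrableZl measurableT (M * (1 + C)) ipsi)
  k_le k_cvg.
have h2 : (\int[mu]_u F (expR s / V u)) / g (expR s) @[s --> +oo] --> (1 : R).
  move/cvg_pinftyP : F_mean => F_mean'; apply/cvg_pinftyP => v v_oo.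
  apply: (F_mean' (fun n => expR (v n))).
  apply/cvgryPge => A; move/cvgryPge : v_oo => /(_ A).
  by apply: filterS => n An; rewrite (le_trans An)// (le_trans _ (expR_ge1Dx _))// lerDr.
have h3 : \int[mu]_u k s u + (\int[mu]_u F (expR s / V u)) / g (expR s) @[s --> +oo] --> (1 : R).
  by rewrite -[X in _ --> X]add0r; apply: cvgD h2; move: h; rewrite Rintegral_cst// mul0r.
apply: cvg_trans h3; apply: near_eq_cvg; near=> s.
have ss : x0 <= s by near: s; apply: nbhs_pinfty_ge; exact: num_real.
have es : x0 <= expR s.
  by rewrite (le_trans ss)// (le_trans _ (expR_ge1Dx _))// lerDr.
have iFs := integrableZr measurableT (g (expR s))^-1 (iF es).
rewrite /= -RintegralZr//; last exact: iF.
rewrite /k RintegralB//; first by rewrite subrK.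
Unshelve. all: by end_near. Qed.

(** In the variable s = ln x, the assumed limit of the multiplicative average
    of F becomes that of the convolution of r = F / g with the image of W
    under Y, the ratio g (e^s / V) / g (e^s) being asymptotically W and
    dominated by Potter's inequality. Wiener's theorem and slow decrease then
    give the limit of r. *)
Lemma mellin_tauberian : F x / g x @[x --> +oo] --> (\int[mu]_u W u)^-1.
Proof.
have rm : r s @[s --> +oo] --> (\int[mu]_u W u)^-1.
  have c0 : 0 < cos 1 / 2 :> R by rewrite divr_gt0// cos1_gt0.
  apply: (tauberian_slowly_decreasing c0 (fun L x => fejer_ge0 x)
    (fun L => @integrable_fejer R L) (fun L x => fejer_tail x) (fun L x => @fejer_bulk R L x)
    mr r_ge0 r_le).
    by move=> rho; exact: (ratio_slowly_decreasing g_gt0 g_nincr g_rv).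
  move=> L L0; rewrite -[X in X * _]mul1r.
  apply: (cvg_fejer_smoothing (fun u => powR_ge0 (V u) alpha) mY iW iWY2 transform_neq0 L0
    mr (M := M)) => // s.
  by rewrite ger0_norm.
move/cvg_pinftyP : rm => rm; apply/cvg_pinftyP => v v_oo.
have key : r (ln (v n)) @[n --> \oo] --> (\int[mu]_u W u)^-1.
  apply: (rm (fun n => ln (v n))); apply/cvgryPge => A.
  move/cvgryPge : v_oo => /(_ (expR A)); apply: filterS => n An.
  by rewrite -(expRK A) ler_ln ?posrE ?expR_gt0// (lt_le_trans (expR_gt0 A)).
apply: cvg_trans key; apply: near_eq_cvg; move/cvgryPgt : v_oo => /(_ 0).
by apply: filterS => n vn; rewrite /r lnK ?posrE.
Qed.

End MellinTauberian.

(** * The tail of a single term *)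

Section Assembly.
Context d (T : measurableType d) (R : realType) (P : probability T R).
Variables (X Theta : nat -> {RV P >-> R}) (alpha : R).
Hypothesis alpha0 : 0 < alpha.
Hypothesis X_ident : identically_distributed X.
Hypothesis X_asym : forall s t, s != t -> asymptotically_independent P (X s) (X t).
Hypothesis X_gt0 : forall t w, 0 < X t w.
Hypothesis Theta_gt0 : forall t w, 0 < Theta t w.
Hypothesis indep : independent_families Theta X.
Local Notation g := (tail P (random_series Theta X)).
Local Notation F := (tail P (EFin \o X 0%N)).
Hypothesis g_gt0 : forall x, 0 < g x.
Hypothesis g_rv : forall t, 0 < t -> g (t * x) / g x @[x --> +oo] --> t `^ (- alpha).

Variables (p eta : R).
Hypothesis p_ge1 : 1 <= p.
Hypothesis eta_bounds : 0 < eta < alpha.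
Hypothesis eta_p : alpha + eta < p.
Local Notation psi := (two_sided_power alpha eta).
Local Notation c t := (\int[P]_w psi (Theta t w)).
Hypothesis ipsi : forall t, P.-integrable setT (EFin \o (fun w => psi (Theta t w))).
Hypothesis roots_sum : (\sum_(0 <= t <oo) (c t `^ p^-1)%:E < +oo)%E.

Local Notation mu := (product_counting P).

Let eta0 : 0 < eta. Proof. by case/andP: eta_bounds. Qed.
Let eta_alpha : eta < alpha. Proof. by case/andP: eta_bounds. Qed.
Let p0 : 0 < p. Proof. exact: lt_le_trans p_ge1. Qed.

Let root_gt0 t : 0 < c t `^ p^-1.
Proof. by rewrite powR_gt0//; exact: two_sided_moment_gt0. Qed.

Let rootK t : (c t `^ p^-1) `^ p = c t.
Proof.
by rewrite -powRrM mulVf ?gt_eqF// powRr1// ltW//; exact: two_sided_moment_gt0.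
Qed.

Let c_sum : (\sum_(0 <= t <oo) (c t)%:E < +oo)%E.
Proof.
have := powR_summable root_gt0 p_ge1 roots_sum.
by under eq_eseriesr do rewrite rootK.
Qed.

Let psi_mu : mu.-integrable setT (EFin \o (fun u => psi (Theta u.2 u.1))).
Proof.
apply: (integrable_product_counting (f := fun t w => psi (Theta t w))).
  by move=> t; exact: measurable_two_sided.
apply: le_lt_trans c_sum; apply: lee_nneseries => t.
  by move=> _ _; apply: integral_ge0 => w _; rewrite lee_fin.
move=> _; rewrite /Rintegral fineK; last exact: (integrable_fin_num _ (ipsi t)).
by under [leLHS]eq_integral do rewrite ger0_norm ?two_sided_power_ge0//.
Qed.

Let F_decr := @tail_nincr _ _ _ P (X 0%N).

Let F_gt0 x : 0 < F x.
Proof. by have [h _] := X_asym (isT : 1%N != 0%N); exact: h. Qed.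

Let F_ge0 x : 0 <= F x := tail_ge0 P (EFin \o X 0%N) x.

(** By independence the integral is the sum over t of the probabilities that
    the term of index t exceeds x, so this is the equivalence of that sum with
    the tail of the series. *)
Lemma sum_of_scaled_tails x0 C : 0 < C -> 0 < x0 ->
  (forall x theta, x0 <= x -> 0 < theta -> F (x / theta) <= C * g x * psi theta) ->
  (\int[mu]_u F (x / Theta u.2 u.1)) / g x @[x --> +oo] --> (1 : R).
Proof.
move=> C0 x00 F_le.
have ThetaX := independent_families_pair indep.
pose Z t w := Theta t w * X t w.
have mZ t : measurable_fun setT (Z t) by exact: measurable_funM.
have Z0 t w : 0 < Z t w by rewrite mulr_gt0.
have term_le t x k : 1 <= k -> x0 <= x ->
    pr P [set w | x / k < Z t w] <= C * g x * (k `^ (alpha + eta) * (c t `^ p^-1) `^ p).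
  by move=> k1 xx0; rewrite rootK; exact: (weighted_tail_le Theta_gt0 X_ident ThetaX g_gt0 eta0 C0 F_le).
have pair_small := joint_exceedance_small_scaled Theta_gt0 X_ident X_asym ThetaX g_gt0 g_rv C0 x00 F_le ipsi.
have bp_sum := powR_summable root_gt0 p_ge1 roots_sum.
have gE x : g x = pr P [set w | (x%:E < \sum_(0 <= t <oo) (Z t w)%:E)%E] by [].
have upper := sum_tails_le mZ Z0 gE g_gt0 root_gt0 roots_sum bp_sum C0 term_le pair_small.
have lower := sum_tails_ge mZ Z0 gE g_gt0 g_rv alpha0 root_gt0 roots_sum bp_sum p_ge1 eta_p C0
  term_le pair_small.
have mscale t x : measurable_fun setT (fun w => F (x / Theta t w)).
  apply: (measurableT_comp (measurable_tail (X 0%N))); exact: measurable_div_pos.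
have iF t x : P.-integrable setT (EFin \o (fun w => F (x / Theta t w))).
  apply: (@integrable_le _ _ _ P _ (fun=> 1)) => //.
    exact: finite_measure_integrable_cst.
  by move=> w; rewrite ger0_norm// tail_le1.
have sumE x : (\sum_(0 <= t <oo) (pr P [set w | x < Z t w])%:E =
    \int[mu]_u (F (x / Theta u.2 u.1))%:E)%E.
  rewrite (ge0_integral_product_counting P (f := fun t w => F (x / Theta t w)))//.
  apply: eq_eseriesr => t _.
  have -> : [set w | x < Z t w] = [set w | setT (Theta t w) /\ x < Theta t w * X t w].
    by apply/seteqP; split => w //= [].
  rewrite product_tail// (identical_tails X_ident t) /Rintegral fineK.
    by apply: eq_integral => w _; rewrite indicE in_setT mul1r.
  under eq_integral do rewrite indicE in_setT mul1r.
  exact: (integrable_fin_num _ (iF t x)).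
apply/cvgrPdist_le => e e0.
pose e1 := Num.min e (2^-1).
have e10 : 0 < e1 by rewrite lt_min e0 invr_gt0 ltr0n.
have e11 : e1 < 1 by rewrite /e1 gt_min; apply/orP; right; lra.
have e1e : e1 <= e by rewrite /e1 ge_min lexx.
apply: filterS2 (upper _ e10) (lower _ e10 e11) => x; rewrite sumE => h1 h2.
have fin : (\int[mu]_u (F (x / Theta u.2 u.1))%:E)%E \is a fin_num.
  rewrite ge0_fin_numE; first by rewrite (le_lt_trans h1)// ltry.
  by apply: integral_ge0 => u _; rewrite lee_fin.
have gx := g_gt0 x.
move: h1 h2; rewrite -[X in (X <= _)%E -> _](fineK fin) -[X in _ -> (_ <= X)%E -> _](fineK fin).
rewrite !lee_fin -/(Rintegral _ _ _) => h1 h2.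
rewrite distrC (le_trans _ e1e)// ler_distl.
by rewrite ler_pdivlMr// ler_pdivrMr// h1 h2.
Qed.

Hypothesis moment_neq0 : forall beta : R,
  cseries_sum (fun t => cexpectation P
      (fun w => cpowR (Theta t w) (alpha +i* beta)%C)) != 0.

Let mTheta_alpha t : measurable_fun setT (fun w => Theta t w `^ alpha).
Proof. exact: (measurableT_comp (@measurable_powR R alpha) (measurable_funP (Theta t))). Qed.

Let mln t (beta : R) : measurable_fun setT (fun w => beta * ln (Theta t w)).
Proof.
apply: measurable_funM => //.
exact: (measurableT_comp (@measurable_ln R) (measurable_funP (Theta t))).
Qed.

Let Theta_alpha_le t w : Theta t w `^ alpha <= psi (Theta t w).
Proof.
by rewrite -[in leLHS](addr0 alpha); apply: powR_le_two_sided => //; have := eta0; lra.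
Qed.

Let dominated_sum (f : nat -> T -> R) : (forall t, measurable_fun setT (f t)) ->
  (forall t w, `|f t w| <= Theta t w `^ alpha) ->
  (\sum_(0 <= t <oo) \int[P]_w (`|f t w|)%:E < +oo)%E.
Proof.
move=> mf fle; apply: le_lt_trans c_sum; apply: lee_nneseries => t.
  by move=> _ _; apply: integral_ge0 => w _; rewrite lee_fin.
move=> _; rewrite /Rintegral fineK; last exact: (integrable_fin_num _ (ipsi t)).
apply: ge0_le_integral => //.
- by apply/measurable_EFinP; apply: measurableT_comp => //; exact: normr_measurable.
- by apply/measurable_EFinP; exact: measurable_two_sided.
- by move=> w _; rewrite lee_fin (le_trans (fle t w)).
Qed.

(* The two transforms are the real and imaginary parts of the sum of the
   complex moments. *)
Let transform_neq0 beta :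
  (cos_transform mu (fun u => ln (Theta u.2 u.1)) (fun u => Theta u.2 u.1 `^ alpha) beta,
   sin_transform mu (fun u => ln (Theta u.2 u.1)) (fun u => Theta u.2 u.1 `^ alpha) beta)
  != (0, 0).
Proof.
apply/negP => /eqP [hcos hsin]; move/negP : (moment_neq0 beta); apply; apply/eqP.
have weight_le t w v : `|v| <= 1 -> `|Theta t w `^ alpha * v| <= Theta t w `^ alpha.
  by move=> v1; rewrite normrM ger0_norm ?powR_ge0// ler_piMr ?powR_ge0.
have mcos t : measurable_fun setT (fun w => Theta t w `^ alpha * cos (beta * ln (Theta t w))).
  by apply: measurable_funM => //; exact: measurable_cos_comp.
have msin t : measurable_fun setT (fun w => Theta t w `^ alpha * sin (beta * ln (Theta t w))).
  by apply: measurable_funM => //; exact: measurable_sin_comp.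
apply: cseries_sum_eq0.
- rewrite -[X in _ --> X]hcos.
  under [X in series X]eq_fun do rewrite Re_cexpectation.
  under [X in series X]eq_fun do under eq_Rintegral do rewrite Re_cpowR.
  apply: (cvg_series_product_counting
    (f := fun t w => Theta t w `^ alpha * cos (beta * ln (Theta t w)))) => //.
  apply: dominated_sum => // t w; apply: weight_le; exact: cos_max.
- rewrite -[X in _ --> X]hsin.
  under [X in series X]eq_fun do rewrite Im_cexpectation.
  under [X in series X]eq_fun do under eq_Rintegral do rewrite Im_cpowR.
  apply: (cvg_series_product_counting
    (f := fun t w => Theta t w `^ alpha * sin (beta * ln (Theta t w)))) => //.
  apply: dominated_sum => // t w; apply: weight_le; exact: sin_max.
Qed.

Let m := fine (\sum_(0 <= t <oo) 'E_P[fun w => (Theta t w `^ alpha)%R])%E.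

(* m is the total mass of the measure that is deconvolved. *)
Let massE : \int[mu]_u (Theta u.2 u.1 `^ alpha) = m.
Proof.
rewrite /m /Rintegral (ge0_integral_product_counting P (f := fun t w => Theta t w `^ alpha))//.
  by congr fine; apply: eq_eseriesr => t _; rewrite unlock.
by move=> t w; exact: powR_ge0.
Qed.

Lemma tail_ratio_cvg : F x / g x @[x --> +oo] --> m^-1.
Proof.
rewrite -massE.
have [C1 C10 FC1] := single_tail_le X_gt0 Theta_gt0 indep g_gt0 g_rv.
have g_le1 := random_series_tail_le1 X_gt0 Theta_gt0.
have g_decr := random_series_tail_nincr X_gt0 Theta_gt0.
have [C [x0 [C0 x00 gC]]] := potter_bound g_gt0 g_le1 g_decr g_rv alpha0 eta0 eta_alpha.
have C1C : 0 < C1 * C by rewrite mulr_gt0.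
apply: (@mellin_tauberian _ _ _ mu (fun u => Theta u.2 u.1) g F alpha eta C C1 x0) => //.
- apply: (measurable_uncurry_nat (f := fun t w => Theta t w)) => t; exact: measurable_funP.
- apply: (@sum_of_scaled_tails x0 (C1 * C)) => // x theta xx0 t0.
  rewrite (le_trans (FC1 _))// -!mulrA ler_pM2l// mulrA; exact: gC.
Qed.

Lemma mass_gt0 : 0 < m.
Proof.
have := transform_neq0 0; rewrite xpair_eqE negb_and => h.
rewrite lt_neqAle -massE; apply/andP; split; last first.
  by apply: Rintegral_ge0 => u _; exact: powR_ge0.
apply: contraT; rewrite negbK => /eqP m0; move: h.
rewrite /cos_transform /sin_transform.
under eq_Rintegral do rewrite mul0r cos0 mulr1.
under [X in _ || (X != _)]eq_Rintegral do rewrite mul0r sin0 mulr0.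
by rewrite -m0 Rintegral_cst// mul0r !eqxx.
Qed.

(** F (t x) / F x is the product of g (t x) / g x with two ratios of F to g,
    whose limits cancel. *)
Lemma single_tail_regularly_varying t : 0 < t ->
  F (t * x) / F x @[x --> +oo] --> t `^ (- alpha).
Proof.
move=> t0; have mV : m^-1 != 0 by rewrite invr_eq0 gt_eqF// mass_gt0.
have h1 := tail_ratio_cvg.
have h2 : F (t * x) / g (t * x) @[x --> +oo] --> m^-1.
  move/cvg_pinftyP : h1 => h1; apply/cvg_pinftyP => v v_oo.
  apply: (h1 (fun n => t * v n)); apply/cvgryPge => A.
  move/cvgryPge : v_oo => /(_ (t^-1 * A)); apply: filterS => n.
  by rewrite ler_pdivrMl.
have h : F (t * x) / g (t * x) * (g (t * x) / g x) * (F x / g x)^-1 @[x --> +oo]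
    --> t `^ (- alpha).
  rewrite -[X in _ --> X](mulfK mV) [_ * m^-1]mulrC.
  exact: (cvgM (cvgM h2 (g_rv t0)) (cvgV mV h1)).
apply: cvg_trans h; apply: near_eq_cvg; apply: nearW => x /=.
have := g_gt0 (t * x); have := g_gt0 x; have := F_gt0 x.
move=> /gt_eqF/negbT F0 /gt_eqF/negbT gx0 /gt_eqF/negbT gt0.
by field; rewrite F0 gx0 gt0.
Qed.

Lemma series_tail_equiv : equiv_at_pinfty g (fun x => F x * m).
Proof.
have mV : m^-1 != 0 by rewrite invr_eq0 gt_eqF// mass_gt0.
have m0 : m != 0 by rewrite gt_eqF// mass_gt0.
have h : (F x / g x)^-1 * m^-1 @[x --> +oo] --> (1 : R).
  rewrite -[X in _ --> X](mulVf mV).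
  exact: (cvgM (cvgV mV tail_ratio_cvg) (cvg_cst m^-1)).
apply: cvg_trans h; apply: near_eq_cvg; apply: nearW => x /=.
have := g_gt0 x; have := F_gt0 x => /gt_eqF/negbT F0 /gt_eqF/negbT gx0.
by field; rewrite F0 gx0 m0.
Qed.

End Assembly.

Theorem theorem2p4p2 (R : realType) (d : measure_display)
    (T : measurableType d) (P : probability T R) (alpha : R)
    (X Theta : nat -> {RV P >-> R}) :
  0 < alpha ->
  identically_distributed X ->
  (forall s t : nat, s != t -> asymptotically_independent P (X s) (X t)) ->
  (forall (t : nat) (w : T), 0 < X t w) ->
  (forall (t : nat) (w : T), 0 < Theta t w) ->
  independent_families Theta X ->
  {ae P, forall w : T, random_series Theta X w \is a fin_num} ->
  regularly_varying_tail P (random_series Theta X) alpha ->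
  (alpha < 1 ->
    exists2 eps : R, 0 < eps < alpha &
    (\sum_(0 <= t <oo)
       'E_P[fun w => (Theta t w `^ (alpha + eps) + Theta t w `^ (alpha - eps))%R]
     < +oo)%E) ->
  (1 <= alpha ->
    exists2 eps : R, 0 < eps < alpha &
    (\sum_(0 <= t <oo)
       'E_P[fun w => (Theta t w `^ (alpha + eps) + Theta t w `^ (alpha - eps))%R]
         `^ (alpha + eps)^-1
     < +oo)%E) ->
  (forall beta : R,
    cseries_sum (fun t => cexpectation P
      (fun w => cpowR (Theta t w) (alpha +i* beta)%C)) != 0) ->
  regularly_varying_tail P (EFin \o X 0%N) alpha /\
  equiv_at_pinfty (tail P (random_series Theta X))
    (fun x : R => tail P (EFin \o X 0%N) x *
       fine (\sum_(0 <= t <oo) 'E_P[fun w => (Theta t w `^ alpha)%R])%E).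
Proof.
move=> a0 X_ident X_asym X_gt0 Theta_gt0 indep _ [g_gt0 g_rv] H1 H2 moment_neq0.
have [p [eta [p1 eta_bounds etap ipsi roots_sum]]] := moment_choice Theta_gt0 a0 H1 H2.
split; last first.
  exact: (series_tail_equiv a0 X_ident X_asym X_gt0 Theta_gt0 indep g_gt0 g_rv p1 eta_bounds
    etap ipsi roots_sum moment_neq0).
split; first by have [h _] := X_asym 1%N 0%N isT.
move=> t t0; exact: (single_tail_regularly_varying a0 X_ident X_asym X_gt0 Theta_gt0 indep
  g_gt0 g_rv p1 eta_bounds etap ipsi roots_sum moment_neq0).
Qed.
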